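(* Let $L\geq 1$ and $\Psi=\{\psi^1,\psi^2,\dots,\psi^L\}\subseteq L^2(K)$. Consider the conditions (O) for all $1\leq l,m\leq L$ and all integers $j\geq 0$, $$\sum_{k\in\mathbb{N}_0}\hat{\psi}^l(\xi+u(k))\,\overline{\hat{\psi}^m(\mathfrak{p}^{-j}(\xi+u(k)))}=\delta_{j,0}\delta_{l,m}\quad\text{for a.e. }\xi\in K;$$ (T) $$\sum_{l=1}^L\sum_{j\in\mathbb{Z}}|\hat{\psi}^l(\mathfrak{p}^{-j}\xi)|^2=1\quad\text{for a.e. }\xi\in K;$$ (I) $$\sum_{l=1}^L\int_K\frac{|\hat{\psi}^l(\xi)|^2}{|\xi|}\,d\xi=\frac{q-1}{q}.$$ Then the following are equivalent: (a) $\Psi$ is a set of basic wavelets of $L^2(K)$. (b) $\Psi$ satisfies (O) and (T). (c) $\Psi$ satisfies (O) and (I).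
   Context: $K$ is a local field of characteristic $p>0$, i.e. a nondiscrete, totally disconnected, locally compact topological field of characteristic $p$. Let $dx$ be a Haar measure on $K^+$; the absolute value is defined by $d(\alpha x)=|\alpha|\,dx$ for $\alpha\neq 0$, and $|0|=0$. Put $\mathfrak{D}=\{x\in K:|x|\leq 1\}$, $\mathfrak{P}=\{x\in K:|x|<1\}$, $\mathfrak{D}^*=\mathfrak{D}\setminus\mathfrak{P}$; $dx$ is normalized so that $\mathfrak{D}$ has measure $1$. Fix a prime element $\mathfrak{p}$, i.e. an element of maximal absolute value in $\mathfrak{P}$. The residue field $\mathfrak{D}/\mathfrak{P}$ is isomorphic to $GF(q)$, $q=p^c$ with $c\in\mathbb{N}$, and $|\mathfrak{p}|=q^{-1}$. $\mathbb{N}_0=\mathbb{N}\cup\{0\}$. Fix $\{1=\epsilon_0,\epsilon_1,\dots,\epsilon_{c-1}\}\subset\mathfrak{D}^*$ whose span over $GF(p)$ is a subfield of $K$ isomorphic to $GF(q)$. For $0\leq n<q$ write $n=a_0+a_1p+\dots+a_{c-1}p^{c-1}$ with $0\leq a_k<p$ and set $u(n)=(a_0+a_1\epsilon_1+\dots+a_{c-1}\epsilon_{c-1})\mathfrak{p}^{-1}$. For general $n\in\mathbb{N}_0$ write $n=b_0+b_1q+\dots+b_rq^r$ with $0\leq b_k<q$ and set $u(n)=u(b_0)+u(b_1)\mathfrak{p}^{-1}+\dots+u(b_r)\mathfrak{p}^{-r}$. The set $\{u(n):n\in\mathbb{N}_0\}$ is a subgroup of $K^+$ and a complete list of distinct coset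 representatives of $\mathfrak{D}$ in $K^+$. $\chi$ is the continuous unitary character of $K^+$ determined by $\chi(\epsilon_\mu\mathfrak{p}^{-j})=\exp(2\pi i/p)$ if $\mu=0$ and $j=1$, and $\chi(\epsilon_\mu\mathfrak{p}^{-j})=1$ if $\mu\in\{1,\dots,c-1\}$ or $j\neq 1$. It is trivial on $\mathfrak{D}$ and nontrivial on $\mathfrak{P}^{-1}=\mathfrak{p}^{-1}\mathfrak{D}$. The Fourier transform is $\hat f(\xi)=\int_K f(x)\overline{\chi(\xi x)}\,dx$ for $f\in L^1(K)\cap L^2(K)$, extended to a unitary operator on $L^2(K)$. For $\Psi=\{\psi^1,\dots,\psi^L\}\subset L^2(K)$, the affine system is the family $X(\Psi)=\{\psi^l_{j,k}:1\leq l\leq L,\ j\in\mathbb{Z},\ k\in\mathbb{N}_0\}$, where $\psi^l_{j,k}(x)=q^{j/2}\psi^l(\mathfrak{p}^{-j}x-u(k))$. $\Psi$ is called a set of basic wavelets of $L^2(K)$ if $X(\Psi)$ is an orthonormal basis of $L^2(K)$. $\delta$ denotes the Kronecker delta. *)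

(* Defs.v *)
Set Warnings "-all".
From HB Require Import structures.
From mathcomp Require Import all_boot all_order all_algebra.
From mathcomp Require Import all_classical all_reals all_analysis.
From mathcomp Require Import complex.
Set Implicit Arguments.
Unset Strict Implicit.
Unset Printing Implicit Defensive.
Import Order.TTheory GRing.Theory Num.Theory.
Import numFieldNormedType.Exports.
Local Open Scope classical_set_scope.
Local Open Scope ring_scope.
Local Open Scope complex_scope.

HB.mixin Record TopologicalZmodule_isTopologicalField K
    & TopologicalZmodule K & GRing.Field K := {
  mulf_continuous : continuous (fun x : K * K => x.1 * x.2) ;
  invf_continuous : forall x : K, x != 0 -> {for x, continuous (@GRing.inv K)}
}.

#[short(type="topologicalFieldType")]
HB.structure Definition TopologicalField :=
  {K of TopologicalZmodule K & GRing.Field K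
      & TopologicalZmodule_isTopologicalField K}.

(* The measurable-type structure on a generated sigma-algebra needs a point. *)
HB.instance Definition _ (K : topologicalFieldType) := isPointed.Build K 0.

Notation borel K := (g_sigma_algebraType (@open K)).

(* R[i] carries its usual topology only when seen as a numFieldType. *)
Definition cplx (R : realType) : numClosedFieldType := R[i].

Definition sqmod (R : realType) (z : R[i]) : R :=
  complex.Re z ^+ 2 + complex.Im z ^+ 2.

(* A totally disconnected space is T1, so Hausdorffness need not be added. *)
Definition local_field (K : topologicalFieldType) : Prop :=
  [/\ ~ (forall A : set K, open A),
      totally_disconnected [set: K] &
      locally_compact [set: K]].

Section HaarMeasure.
Context {R : realType} {K : topologicalFieldType}.
Implicit Types (mu : {measure set (borel K) -> \bar R}) (abs : K -> R).

(* Regularity is not required: it is automatic for a Borel measure finite on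
   compact sets when the group is second countable, as local fields are. *)
Record haar_measure mu : Prop := HaarMeasure {
  haar_translation : forall (a : K) (A : set (borel K)),
    measurable A -> mu [set a + x | x in A] = mu A ;
  haar_compact : forall A : set K, compact A -> (mu A < +oo)%E ;
  haar_neq0 : mu [set: K] <> 0%E }.

Record haar_modulus mu abs : Prop := HaarModulus {
  modulus0 : abs 0 = 0 ;
  modulusP : forall (a : K) (A : set (borel K)), a != 0 -> measurable A ->
    mu [set a * x | x in A] = ((abs a)%:E * mu A)%E }.

Definition integer_ring abs : set K := [set x | abs x <= 1].
Definition maximal_ideal abs : set K := [set x | abs x < 1].

Definition prime_element abs (varpi : K) : Prop :=
  maximal_ideal abs varpi /\
  forall x, maximal_ideal abs x -> abs x <= abs varpi.

(* The residue field is isomorphic to GF(q): [red] is a surjective ring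
   morphism from the integers onto a field with q elements, whose kernel is the
   maximal ideal; its values outside the integers are irrelevant. *)
Definition residue_field_GF abs (q : nat) : Prop :=
  exists (k : finFieldType) (red : K -> k),
    [/\ #|k| = q,
        red 1 = 1,
        forall x y, integer_ring abs x -> integer_ring abs y ->
          red (x + y) = red x + red y /\ red (x * y) = red x * red y,
        forall z, exists2 x, integer_ring abs x & red x = z &
        forall x, integer_ring abs x ->
          (red x = 0 <-> maximal_ideal abs x)].

Definition gfp_span (p c : nat) (eps : 'I_c -> K) : set K :=
  [set x | exists a : 'I_c -> 'I_p, x = \sum_(k < c) (a k)%:R * eps k].

Record gfq_generators abs (p c : nat) (eps : 'I_c -> K) : Prop :=
  GfqGenerators {
    gfq_gen0 : forall k : 'I_c, nat_of_ord k = 0%N -> eps k = 1 ;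
    gfq_gen_unit : forall k,
      (integer_ring abs `\` maximal_ideal abs) (eps k) ;
    gfq_gen_span : exists (E : finFieldType) (phi : {rmorphism E -> K}),
      #|E| = (p ^ c)%N /\ range phi = gfp_span p eps }.

End HaarMeasure.

Section Translations.
Context {K : fieldType}.
Variables (p c : nat) (eps : 'I_c -> K) (varpi : K).

Definition digit (b n k : nat) : nat := ((n %/ b ^ k) %% b)%N.

Definition u_digit (n : nat) : K :=
  (\sum_(k < c) (digit p n k)%:R * eps k) * varpi^-1.

(* n has at most n.+1 digits in base q, and u_digit 0 = 0, so summing over
   all k <= n only adds null terms. *)
Definition u (n : nat) : K :=
  \sum_(k < n.+1) u_digit (digit (p ^ c) n k) * varpi ^- k.

End Translations.

Section Character.
Context {R : realType} {K : topologicalFieldType}.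

Record basic_character (p c : nat) (eps : 'I_c -> K) (varpi : K)
    (chi : K -> R[i]) : Prop := BasicCharacter {
  chi_continuous : continuous (chi : K -> cplx R) ;
  chi_unitary : forall x, `|chi x| = 1 ;
  chiD : forall x y, chi (x + y) = chi x * chi y ;
  chi_basic : forall (m : 'I_c) (j : int),
    chi (eps m * varpi ^ (- j)) =
      if (nat_of_ord m == 0%N) && (j == 1)
      then cos (2 * pi / p%:R) +i* sin (2 * pi / p%:R) else 1 }.

End Character.

Section L2.
Context {R : realType} {K : topologicalFieldType}.
Variable mu : {measure set (borel K) -> \bar R}.
Implicit Types f g : K -> R[i].

Definition cmeasurable f : Prop :=
  measurable_fun [set: borel K] (fun x : borel K => complex.Re (f x)) /\
  measurable_fun [set: borel K] (fun x : borel K => complex.Im (f x)).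

Definition memL1 f : Prop :=
  cmeasurable f /\
  (\int[mu]_x (Num.sqrt (sqmod (f x)))%:E < +oo)%E.

Definition memL2 f : Prop :=
  cmeasurable f /\ (\int[mu]_x (sqmod (f x))%:E < +oo)%E.

Definition cintegral f : R[i] :=
  (\int[mu]_x complex.Re (f x)) +i* (\int[mu]_x complex.Im (f x)).

Definition inner f g : R[i] := cintegral (fun x => f x * (g x)^*).

Record orthonormal_basis (I : eqType) (e : I -> K -> R[i]) : Prop :=
  OrthonormalBasis {
    onb_L2 : forall i, memL2 (e i) ;
    onb_orthonormal : forall i j, inner (e i) (e j) = (i == j)%:R ;
    onb_dense : forall f, memL2 f -> forall r : R, 0 < r ->
      exists s : seq (R[i] * I),
        (\int[mu]_x
           (sqmod (f x - (\sum_(t <- s) t.1 * e t.2 x)%R))%:E < r%:E)%E }.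

(* F acts on representatives; identities between elements of L^2 hold a.e. *)
Record fourier_transform (chi : K -> R[i])
    (F : (K -> R[i]) -> (K -> R[i])) : Prop := FourierTransform {
  fourierE : forall f, memL1 f -> memL2 f ->
    {ae mu, forall xi : borel K,
      F f xi = cintegral (fun x => f x * (chi (xi * x))^*)} ;
  fourier_L2 : forall f, memL2 f -> memL2 (F f) ;
  fourier_linear : forall (a : R[i]) f g, memL2 f -> memL2 g ->
    {ae mu, forall xi : borel K,
      F (fun x => a * f x + g x) xi = a * F f xi + F g xi} ;
  fourier_isometry : forall f g, memL2 f -> memL2 g ->
    inner (F f) (F g) = inner f g ;
  fourier_surj : forall g, memL2 g ->
    exists2 f, memL2 f & {ae mu, forall xi : borel K, F f xi = g xi} }.

End L2.

Section Wavelets.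
Context {R : realType} {K : topologicalFieldType}.
Variable mu : {measure set (borel K) -> \bar R}.
Variables (p c : nat) (eps : 'I_c -> K) (varpi : K) (L : nat).

Definition affine_system (psi : 'I_L -> K -> R[i]) (t : 'I_L * int * nat) :
    K -> R[i] :=
  let: (l, j, k) := t in
  fun x => (((p ^ c)%:R : R) `^ (j%:~R / 2))%:C
           * psi l (varpi ^ (- j) * x - u p eps varpi k).

Definition basic_wavelets (psi : 'I_L -> K -> R[i]) : Prop :=
  orthonormal_basis mu (affine_system psi).

(* In the three conditions, hpsi stands for the Fourier transforms. *)
Definition cond_O (hpsi : 'I_L -> K -> R[i]) : Prop :=
  forall (l m : 'I_L) (j : nat),
    {ae mu, forall xi : borel K,
      (fun n : nat => (\sum_(0 <= k < n)
         hpsi l (xi + u p eps varpi k)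
         * (hpsi m (varpi ^- j * (xi + u p eps varpi k)))^* : cplx R))
      @ \oo --> (((j == 0%N) && (l == m))%:R : cplx R)}.

Definition cond_T (hpsi : 'I_L -> K -> R[i]) : Prop :=
  {ae mu, forall xi : borel K,
    (\sum_(l < L) \esum_(j in [set: int])
       (sqmod (hpsi l (varpi ^ (- j) * xi)))%:E)%E = 1%E}.

(* At xi = 0 the integrand has the value 0; {0} is a null set. *)
Definition cond_I (abs : K -> R) (hpsi : 'I_L -> K -> R[i]) : Prop :=
  (\sum_(l < L) \int[mu]_xi (sqmod (hpsi l xi) / abs xi)%:E)%E
  = (((p ^ c)%:R - 1) / (p ^ c)%:R)%:E.

End Wavelets.

(* Main.v *)
Require Import Defs.
Set Warnings "-all".
From HB Require Import structures.
From mathcomp Require Import all_boot all_order all_algebra finalg finfield.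
From mathcomp Require Import all_classical all_reals all_analysis.
From mathcomp Require Import complex measurable_realfun.
From mathcomp Require Import ring lra zify.
Set Implicit Arguments.
Unset Strict Implicit.
Unset Printing Implicit Defensive.
Import Order.TTheory GRing.Theory Num.Theory.
Import numFieldNormedType.Exports.
Local Open Scope classical_set_scope.
Local Open Scope ring_scope.
Local Open Scope complex_scope.

(** Let q = p^c, let D be the ring of integers, let hpsi^l be the transform of
    psi^l, and let the balls be the cosets of the sets varpi^n D.

    The absolute value is the factor by which multiplications change the Haar
    measure, hence is multiplicative. Some element r maps a compact
    neighbourhood of 0 into itself and at least halves its measure; it follows
    that the absolute value defines the topology and is bounded on the sums of
    two integers. In characteristic p the powers p^n are additive, so that the
    bound must be 1 and the absolute value is non-archimedean
    ([haar_modulus_ultrametric]).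

    The Fourier transform being unitary, the affine system is an orthonormal
    basis if and only if its transform is orthonormal and spans a dense subspace
    ([basic_waveletsP]). The transform of the element (l, j, k) is, up to a
    factor, hpsi^l (varpi^j xi) times the conjugate of chi (u(k) varpi^j xi).

    Orthonormality. A change of variable makes the inner product of two of these
    functions a Fourier coefficient, over D, of the periodization under the u(k)
    of hpsi^l (xi) times the conjugate of hpsi^m (varpi^-j xi). The coefficients
    determine the periodization, because the indicators of the balls inside D
    are combinations of the characters chi (u(k) xi); this gives [cond_O]
    ([fourier_coefficients_periodization], [affine_hat_orthonormal_condO]).

    Density. Fix l and j. On a ball B of radius at most q^-j the elements
    (l, -j, k) of the system restrict to a complete Fourier system, so that the
    squares of the coefficients of the indicator of B add up to the energy
    of B, the integral over B of |hpsi^l (varpi^-j xi)|^2. On larger balls the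
    sum exceeds the energy at most by a factor that is controlled
    ([coef_energy_small], [coef_energy_le]). If the system is orthonormal, Bessel's
    inequality then bounds the sum over l and j of the energies of a ball, the
    total energy, by the measure of the ball ([energy_bessel]). Call the ball tight
    when there is equality. For a ball that avoids 0, the energies weighted by
    q^j have a finite sum, because the dilates of the ball are disjoint; this
    makes the contribution of the scales that are too fine for a given
    subdivision of the ball negligible. It follows that density makes these
    balls tight ([dense_tight]), and that the indicators of tight balls belong
    to the closed span of the system ([tight_in_closed_span]). Such indicators
    span a dense subspace ([closed_span_all]). For an orthonormal system,
    density thus means that all the balls that avoid 0 are tight.

    The conditions. The total energy of a ball is the integral over the ball of
    the sum in [cond_T], so [cond_T] says that all the balls that avoid 0 are
    tight ([cond_T_tight]). The sum in [cond_I] is the total energy of the unit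
    sphere, whose measure is (q - 1) / q. If the system is orthonormal, equality
    forces the q - 1 balls that make up the sphere to be tight, and all the balls
    that avoid 0 follow by dilation and subdivision ([cond_I_tight]). *)

(** * Local fields: compactness and contraction *)

Section TopologicalFieldTheory.
Context {K : topologicalFieldType}.
Implicit Types (x y a : K) (A U V : set K).

Lemma nbhs_pair_add x y U : nbhs (x + y) U ->
  exists A B, [/\ nbhs x A, nbhs y B & forall s t, A s -> B t -> U (s + t)].
Proof.
move=> /(@add_continuous K (x, y))[[A B] /= [xA yB] AB].
by exists A, B; split => // s t As Bt; exact: (AB (s, t)).
Qed.

Lemma nbhs_pair_mul x y U : nbhs (x * y) U ->
  exists A B, [/\ nbhs x A, nbhs y B & forall s t, A s -> B t -> U (s * t)].
Proof.
move=> /(@mulf_continuous K (x, y))[[A B] /= [xA yB] AB].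
by exists A, B; split => // s t As Bt; exact: (AB (s, t)).
Qed.

Lemma continuous_addl a : continuous (fun x : K => a + x).
Proof.
move=> x U /nbhs_pair_add[A [B [aA xB AB]]]; apply: filterS xB => y.
by apply: AB; exact: nbhs_singleton.
Qed.

Lemma continuous_mull a : continuous (fun x : K => a * x).
Proof.
move=> x U /nbhs_pair_mul[A [B [aA xB AB]]]; apply: filterS xB => y.
by apply: AB; exact: nbhs_singleton.
Qed.

Lemma continuous_affine a b : continuous (fun x : K => a * x + b).
Proof.
move=> x; have -> : (fun x => a * x + b) = (fun y => b + y) \o (fun x => a * x).
  by apply/funext => y /=; rewrite addrC.
by apply: continuous_comp; [exact: continuous_mull|exact: continuous_addl].
Qed.

Lemma nbhs_addl a x U : nbhs x U -> nbhs (a + x) [set a + y | y in U].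
Proof.
move=> xU; have : nbhs (a + x) [set y | U (- a + y)].
  by apply: (@continuous_addl (- a) (a + x)); rewrite addKr.
by apply: filterS => y Uy; exists (- a + y) => //; rewrite addrA subrr add0r.
Qed.

Lemma compact_image (f : K -> K) A :
  (forall x, A x -> {for x, continuous f}) -> compact A -> compact (f @` A).
Proof.
move=> cf; apply: continuous_compact.
by apply: continuous_in_subspaceT => x /set_mem; exact: cf.
Qed.

Lemma compact_image2 (f : K * K -> K) A B :
  continuous f -> compact A -> compact B ->
  compact [set f (x, y) | x in A & y in B].
Proof.
move=> cf cA cB.
have -> : [set f (x, y) | x in A & y in B] = f @` (A `*` B).
  rewrite eqEsubset; split => z /=.
    by move=> [x Ax [y By <-]]; exists (x, y).
  by move=> [[x y] [/= Ax By] <-]; exists x => //; exists y.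
by apply: continuous_compact; [exact: continuous_subspaceT|exact: compact_setX].
Qed.

(** Continuity of the product at the points (0, y), made uniform in y by
    compactness. *)
Lemma compact_mul_near0 A U : compact A -> nbhs 0 U ->
  \forall x \near (0 : K), forall y, A y -> U (x * y).
Proof.
move=> /compact_near_coveringP cA U0.
apply: (cA K (nbhs 0) (fun x y => U (x * y))) => y Ay.
have := U0; rewrite -{1}(mul0r y) => /nbhs_pair_mul[B [C [B0 Cy BC]]].
by exists (C, B) => //= -[s t] /= [Cs Bt]; exact: BC.
Qed.
End TopologicalFieldTheory.

Section LocalFieldTopology.
Context {K : topologicalFieldType} (K_local : local_field K).
Implicit Types (x y a : K) (A U V : set K).

Lemma local_field_closed1 x : closed [set x].
Proof.
have [_ td _] := K_local.
by rewrite -(td x I); exact/component_closed/closedT.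
Qed.

(** Points are closed because they are their own components, and a topological
    group with closed points is Hausdorff. *)
Lemma local_field_hausdorff : hausdorff_space K.
Proof.
move=> x y xy; apply: contrapT => /eqP neq.
have : nbhs (y + - x) (~` [set 0]).
  apply: open_nbhs_nbhs; split; first exact/closed_openC/local_field_closed1.
  by move=> /eqP; rewrite subr_eq0 eq_sym; exact/negP.
move=> /nbhs_pair_add[A [B [Ay Bx AB]]].
have Bx' : nbhs x (-%R @^-1` B) by exact: (@opp_continuous K x).
have [z [/= Bz Az]] := xy _ _ Bx' Ay.
by apply: (AB z (- z)) => //=; rewrite subrr.
Qed.

Lemma local_field_compact_closed A : compact A -> closed A.
Proof. by apply: compact_closed; exact: local_field_hausdorff. Qed.

(** If 0 were isolated, translations would make every set open. *)
Lemma local_field_not_isolated U : nbhs 0 U -> exists2 r, r != 0 & U r.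
Proof.
move=> U0; apply: contrapT => nr; have [nd _ _] := K_local; apply: nd => A.
have U1 : nbhs 0 [set (0 : K)].
  apply: filterS U0 => x Ux /=; apply: contrapT => /eqP x0.
  by apply: nr; exists x.
rewrite openE => x Ax; have := nbhs_addl x U1; rewrite addr0.
by apply: filterS => _ [_ -> <-]; rewrite addr0.
Qed.

(** The compact neighbourhood contains 1, so that it contains all the powers of
    [r], and two disjoint translates of its image by [r], so that [r] shrinks
    the Haar measure by a factor of at least 2. *)
Lemma local_field_contraction : exists (V : set K) (r : K),
  [/\ compact V, nbhs 0 V, V 1 & r != 0] /\
  [/\ forall v, V v -> V (r * v), forall v, V v -> r * v <> 1,
      forall v w, V v -> V w -> r * v <> 1 + r * w &
      forall v, V v -> V (1 + r * v)].
Proof.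
have [_ _ lc] := K_local.
have [V0 V00 [cV0 _]] := lc 0 I.
have {}V00 : nbhs (0 : K) [set x | [set: K] x -> V0 x] := V00.
have {}V00 : nbhs 0 V0 by apply: filterS V00 => x /(_ I).
pose V := V0 `|` [set 1 + y | y in V0].
have cV : compact V.
  by apply: compactU => //; apply: compact_image => // x _; exact: continuous_addl.
have : nbhs (0 + 0 : K) (~` [set 1]).
  apply: open_nbhs_nbhs; split; first exact/closed_openC/local_field_closed1.
  by rewrite /= addr0 => /esym/eqP; rewrite oner_eq0.
move=> /nbhs_pair_add[A [B [A0 B0 AB]]].
have B0' : nbhs (0 : K) (-%R @^-1` B) by apply: opp_continuous; rewrite oppr0.
have [r r0 rO] := local_field_not_isolated
  (compact_mul_near0 cV (filterI V00 (filterI A0 B0'))).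
exists V, r; split; split => //.
- by apply: filterS V00 => x; left.
- by right; exists 0; [exact: nbhs_singleton|rewrite addr0].
- by move=> v /rO[]; left.
- move=> v /rO[_ [Av _]] rv1.
  by apply: (AB (r * v) 0 Av (nbhs_singleton B0)) => /=; rewrite addr0.
- move=> v w /rO[_ [Av _]] /rO[_ [_ Bw]] e.
  by apply: (AB _ _ Av Bw) => /=; rewrite e addrK.
- by move=> v /rO[V0v _]; right; exists (r * v).
Qed.
End LocalFieldTopology.

Section Contraction.
Context {K : topologicalFieldType} (K_local : local_field K).
Variables (V : set K) (r : K).
Hypotheses (cV : compact V) (V0 : nbhs 0 V) (V1 : V 1) (r0 : r != 0).
Hypotheses (rV : forall v, V v -> V (r * v)) (rV1 : forall v, V v -> r * v <> 1).

Lemma contraction_exp n v : V v -> V (r ^+ n * v).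
Proof.
by move=> Vv; elim: n => [|n ih]; [rewrite mul1r|rewrite exprS -mulrA; exact: rV].
Qed.

Lemma contraction_le m n x : (m <= n)%N -> V (r ^+ m * x) -> V (r ^+ n * x).
Proof.
by move=> /subnK <- Vm; rewrite exprD -mulrA; exact: contraction_exp.
Qed.

(** At a cluster point s <> 0 the quotients r^m / r^n with m > n would come
    close to 1, while r^(m - n) stays in the closed set r V, which omits 1. *)
Lemma contraction_cvg0 : (fun n => r ^+ n) @ \oo --> (0 : K).
Proof.
have FV : ((fun n => r ^+ n) @ \oo) V.
  by exists 0%N => // n _ /=; rewrite -(mulr1 (r ^+ n)); exact: contraction_exp.
have sub0 s : cluster ((fun n => r ^+ n) @ \oo) s -> s = 0.
  move=> cs; apply: contrapT => /eqP s0.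
  have nC : nbhs (s * s^-1) (~` [set r * v | v in V]).
    rewrite divff//; apply: open_nbhs_nbhs; split.
      apply: closed_openC; apply: (local_field_compact_closed K_local).
      by apply: compact_image cV => x _; exact: continuous_mull.
    by move=> [v Vv]; exact: rV1.
  have [A [B [As Bs AB]]] := nbhs_pair_mul nC.
  have Bs' : nbhs s (@GRing.inv K @^-1` B) by exact: invf_continuous.
  have sN : nbhs s (A `&` @GRing.inv K @^-1` B) by exact: filterI.
  have freq n : exists2 m, (n < m)%N & (A `&` @GRing.inv K @^-1` B) (r ^+ m).
    have Fn : ((fun n => r ^+ n) @ \oo) [set r ^+ m | m in [set m | (n < m)%N]].
      by exists n.+1 => // m /= nm; exists m.
    by have [_ [[m /= nm <-] Nm]] := cs _ _ Fn sN; exists m.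
  have [n _ [_ Bn]] := freq 0%N; have [m nm [Am _]] := freq n.
  apply: (AB _ _ Am Bn).
  exists (r ^+ (m - n).-1).
    by rewrite -(mulr1 (_ ^+ _)); exact: contraction_exp.
  rewrite -exprS prednK ?subn_gt0// -[in RHS](subnK (ltnW nm)) exprD mulfK//.
  exact: expf_neq0.
have [s [Vs cs]] := cV _ FV.
apply: (compact_cluster_set1 (local_field_hausdorff K_local) cV V0 _ FV).
rewrite eqEsubset; split => [x /sub0 ->//|_ ->].
by rewrite -(sub0 _ cs).
Qed.

Lemma contraction_absorbs A : compact A ->
  exists n, forall x, A x -> V (r ^+ n * x).
Proof.
move=> /compact_near_coveringP cA.
have [n _ nV] : \forall n \near \oo, A `<=` (fun x => V (r ^+ n * x)).
  apply: (cA nat \oo (fun n x => V (r ^+ n * x))) => y Ay.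
  have := V0; rewrite -{1}(mul0r y) => /nbhs_pair_mul[B [C [B0 Cy BC]]].
  exists (C, [set n | B (r ^+ n)]) => /=; first by split => //; apply: contraction_cvg0.
  by move=> -[s t] /= [Cs Bt]; exact: BC.
by exists n => x Ax; exact: (nV n (leqnn n) x Ax).
Qed.

Lemma contraction_absorbs1 x : exists n, V (r ^+ n * x).
Proof.
by have [n nV] := contraction_absorbs (@compact_set1 K x); exists n; exact: nV.
Qed.

Lemma contraction_nbhs0 U : nbhs 0 U ->
  exists n, forall v, V v -> U (r ^+ n * v).
Proof.
move=> /(compact_mul_near0 cV)/contraction_cvg0[n _ nU].
by exists n => v Vv; exact: (nU n (leqnn n) v Vv).
Qed.
End Contraction.

(** * The Haar modulus is a non-archimedean absolute value *)

Lemma bernoulli {R : realDomainType} (d : R) n : 0 <= d -> 1 + d *+ n <= (1 + d) ^+ n.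
Proof.
move=> d0; elim: n => [|n ih]; first by rewrite expr0 mulr0n addr0.
have h1 : 0 <= d * (d *+ n) by rewrite mulr_ge0 ?mulrn_wge0.
have h2 : 0 <= d * ((1 + d) ^+ n - (1 + d *+ n)) by rewrite mulr_ge0// subr_ge0.
by rewrite exprS mulrS; move: h1 h2 ih d0; nra.
Qed.

Section BorelSets.
Context {K : topologicalFieldType}.

Lemma borel_open (A : set K) : open A -> measurable (A : set (borel K)).
Proof. by move=> oA; exact: sub_sigma_algebra. Qed.

Lemma borel_closed (A : set K) : closed A -> measurable (A : set (borel K)).
Proof.
move=> cA; rewrite -[A]setCK; apply: measurableC; apply: borel_open.
exact: closed_openC.
Qed.

Lemma borel_continuous (f : K -> K) : continuous f ->
  measurable_fun [set: borel K] (f : borel K -> borel K).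
Proof.
move=> cf.
apply: (@measurability _ _ (borel K) (borel K) setT f (@open K)) => //.
move=> _ -[A oA <-]; rewrite setTI; apply: borel_open.
by move/continuousP: cf; exact.
Qed.
End BorelSets.

Section HaarModulus.
Context {R : realType} {K : topologicalFieldType} (K_local : local_field K).
Variables (mu : {measure set (borel K) -> \bar R}) (abs : K -> R).
Hypotheses (mu_haar : haar_measure mu) (abs_modulus : haar_modulus mu abs).
Variables (V : set K) (r : K).
Hypotheses (cV : compact V) (V0 : nbhs 0 V) (V1 : V 1) (r0 : r != 0).
Hypotheses (rV : forall v, V v -> V (r * v)) (rV1 : forall v, V v -> r * v <> 1).
Hypotheses (rVV : forall v w, V v -> V w -> r * v <> 1 + r * w).
Hypothesis (V1r : forall v, V v -> V (1 + r * v)).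

Let mV : measurable (V : set (borel K)).
Proof. by apply: borel_closed; exact: local_field_compact_closed. Qed.

Let m := fine (mu V).

Let muV_fin : mu V = m%:E.
Proof.
rewrite fineK// ge0_fin_numE ?measure_ge0//; exact: (haar_compact mu_haar).
Qed.

Let compactM x : compact [set x * v | v in V].
Proof. by apply: compact_image cV => y _; exact: continuous_mull. Qed.

Let mM x : measurable ([set x * v | v in V] : set (borel K)).
Proof. by apply: borel_closed; exact: local_field_compact_closed. Qed.

(** K is the union of the sets r^-n V, which are null if V is. *)
Let m_gt0 : 0 < m.
Proof.
rewrite lt_def fine_ge0 ?measure_ge0// andbT; apply/eqP => m0.
apply: (haar_neq0 mu_haar).
have : mu (\bigcup_n [set r ^- n * v | v in V]) = 0%E.
  apply/eqP; rewrite eq_le measure_ge0 andbT.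
  apply: (le_trans (measure_sigma_subadditive _ _ _ (@subset_refl _ _))) => //.
  - exact: bigcup_measurable.
  - rewrite eseries0// => n _ _.
    rewrite (modulusP abs_modulus) ?muV_fin ?m0 ?mule0//.
    by rewrite invr_eq0 expf_neq0.
move=> <-; congr (mu _); rewrite eqEsubset; split => // x _.
have [n Vn] := contraction_absorbs1 K_local cV V0 V1 r0 rV rV1 x.
by exists n => //; exists (r ^+ n * x) => //; rewrite mulKf ?expf_neq0.
Qed.

Let muM x : x != 0 -> mu [set x * v | v in V] = (abs x * m)%:E.
Proof. by move=> x0; rewrite (modulusP abs_modulus)// muV_fin EFinM. Qed.

Lemma modulus_ge0 x : 0 <= abs x.
Proof.
have [->|x0] := eqVneq x 0; first by rewrite (modulus0 abs_modulus).
have : (0 <= (abs x * m)%:E)%E by rewrite -muM// measure_ge0.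
by rewrite lee_fin pmulr_lge0.
Qed.

(** Both sides are the factor by which multiplication by x y changes the
    measure of V, which is finite and positive. *)
Lemma modulusM x y : abs (x * y) = abs x * abs y.
Proof.
have [->|x0] := eqVneq x 0; first by rewrite mul0r (modulus0 abs_modulus) mul0r.
have [->|y0] := eqVneq y 0; first by rewrite mulr0 (modulus0 abs_modulus) mulr0.
have := muM (mulf_neq0 x0 y0).
have -> : [set x * y * v | v in V] = [set x * v | v in [set y * v | v in V]].
  rewrite eqEsubset; split => z /=.
    by move=> [v Vv <-]; exists (y * v); [exists v|rewrite mulrA].
  by move=> [_ [v Vv <-] <-]; exists v => //; rewrite mulrA.
rewrite (modulusP abs_modulus)// muM// -EFinM mulrA => -[].
by move/(mulIf (lt0r_neq0 m_gt0)).
Qed.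

Lemma modulus1 : abs 1 = 1.
Proof.
have := muM (oner_neq0 K).
have -> : [set 1 * v | v in V] = V.
  rewrite eqEsubset; split => z /=; first by move=> [v Vv <-]; rewrite mul1r.
  by exists z => //; rewrite mul1r.
rewrite muV_fin => -[/esym]; rewrite -{2}(mul1r m).
by move/(mulIf (lt0r_neq0 m_gt0)).
Qed.

Lemma modulus_gt0 x : x != 0 -> 0 < abs x.
Proof.
move=> x0; rewrite lt_def modulus_ge0 andbT; apply/eqP => ax0.
have := modulus1; rewrite -(divff x0) modulusM ax0 mul0r => /eqP.
by rewrite eq_sym oner_eq0.
Qed.

Lemma modulusX x n : abs (x ^+ n) = abs x ^+ n.
Proof.
by elim: n => [|n ih]; rewrite ?expr0 ?modulus1// !exprS modulusM ih.
Qed.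

(** V contains the disjoint sets r V and 1 + r V of equal measure. *)
Let abs_r : abs r <= 2^-1.
Proof.
pose A : set K := [set r * v | v in V].
pose B : set K := [set 1 + x | x in A].
have mB : measurable (B : set (borel K)).
  apply: borel_closed; apply: local_field_compact_closed => //.
  rewrite /B /A; apply: compact_image; first by move=> y _; exact: continuous_addl.
  exact: compactM.
have : (mu (A `|` B) <= mu V)%E.
  apply: le_measure.
  - by rewrite inE; apply: measurableU => //; exact: mM.
  - by rewrite inE.
  move=> x [[v Vv <-]|[_ [v Vv <-] <-]]; first exact: rV.
  exact: V1r.
have mA : measurable (A : set (borel K)) by exact: mM.
have AB0 : A `&` B = set0.
  by rewrite -subset0 => x [[v Vv <-] [_ [w Vw <-]]] /esym; exact: rVV.
have -> : mu (A `|` B) = ((abs r * m)%:E + (abs r * m)%:E)%E.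
  rewrite -(muM r0) -{2}((haar_translation mu_haar) 1 _ mA).
  exact: measureU.
rewrite muV_fin -EFinD lee_fin.
by move: m_gt0; nra.
Qed.

Let abs_rX n : abs (r ^+ n) <= 2^-1 ^+ n.
Proof. by rewrite modulusX lerXn2r// ?nnegrE ?modulus_ge0// invr_ge0. Qed.

(** If r^n A V is contained in V, then multiplication by r^n x does not increase
    the measure of V for x in A. *)
Lemma modulus_bounded A : compact A -> exists2 B, 0 < B & forall x, A x -> abs x <= B.
Proof.
move=> cA; have cAV := compact_image2 mulf_continuous cA cV.
have [n nV] := contraction_absorbs K_local cV V0 V1 r0 rV rV1 cAV.
have rn0 : 0 < abs (r ^+ n) by apply: modulus_gt0; rewrite expf_neq0.
exists (abs (r ^+ n))^-1; first by rewrite invr_gt0.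
move=> x Ax; have [->|x0] := eqVneq x 0.
  by rewrite (modulus0 abs_modulus) invr_ge0 modulus_ge0.
rewrite -(ler_pM2l rn0) divff ?lt0r_neq0// -modulusM.
have rx0 : r ^+ n * x != 0 by rewrite mulf_neq0// expf_neq0.
rewrite -(ler_pM2r m_gt0) mul1r -lee_fin -muM// -muV_fin.
apply: le_measure; rewrite ?inE// => _ [v Vv <-].
by rewrite -mulrA; apply: nV; exists x => //; exists v.
Qed.

(** An element a outside [V] has a first multiple r^n a in [V]. It lies in the
    compact set of the points of V outside r times the interior of V. This set
    omits 0, so that the modulus is bounded below on it; as |r^n a| <= 2^-n |a|,
    this bounds n when |a| <= 1. *)
Lemma integer_ring_bounded : exists n, forall x, abs x <= 1 -> V (r ^+ n * x).
Proof.
pose W := [set x | V^° (r^-1 * x)].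
have oW : open W.
  apply: open_comp; [by move=> x _; exact: continuous_mull|exact: open_interior].
have W0 : W 0 by rewrite /W /= mulr0; exact: V0.
have cC : compact (V `&` ~` W) by apply: compact_closedI => //; exact: open_closedC.
have cI : compact (@GRing.inv K @` (V `&` ~` W)).
  apply: compact_image cC => x [_ Wx]; apply: invf_continuous.
  by apply/eqP => x0; apply: Wx; rewrite x0.
have [B B0 absB] := modulus_bounded cI.
pose N := (Num.truncn B).+1; exists N => a a1.
have [Va|nVa] := pselect (V a); first exact: (contraction_exp rV).
have ex : exists n, `[< V (r ^+ n * a) >].
  have [n nV] := contraction_absorbs1 K_local cV V0 V1 r0 rV rV1 a.
  by exists n; apply/asboolP.
case: (ex_minnP ex) => -[|n] /asboolP Vn minn; first by rewrite mul1r in Vn.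
apply: (contraction_le rV _ Vn).
have Wn : ~ W (r ^+ n.+1 * a).
  rewrite /W /= exprS -mulrA mulKf// => /interior_subset/asboolP/minn.
  by rewrite ltnn.
have a0 : a != 0.
  by apply/eqP => a0; apply: nVa; rewrite a0; exact: nbhs_singleton.
have rn0 : r ^+ n.+1 * a != 0 by rewrite mulf_neq0// expf_neq0.
have : abs (r ^+ n.+1 * a)^-1 <= B by apply: absB; exists (r ^+ n.+1 * a).
rewrite -(ler_pM2r (modulus_gt0 rn0)) -modulusM mulVf// modulus1 modulusM => h.
have h1 : 1 <= B * 2^-1 ^+ n.+1.
  apply: (le_trans h); rewrite ler_pM2l//.
  rewrite -[leRHS]mulr1 ler_pM ?modulus_ge0//.
rewrite /N -(ler_nat R) (@le_trans _ _ B)//; last exact/ltW/truncnS_gt.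
have h2 : 2 ^+ n.+1 <= B.
  by move: h1; rewrite exprVn ler_pdivlMr ?exprn_gt0// mul1r.
by apply: le_trans h2; rewrite -natrX ler_nat ltnW// ltn_expl.
Qed.

Lemma modulusD_bounded :
  exists B, forall x y, abs x <= 1 -> abs y <= 1 -> abs (x + y) <= B.
Proof.
have [n nV] := integer_ring_bounded.
have [B B0 absB] := modulus_bounded (compact_image2 (@add_continuous K) cV cV).
have rn0 : 0 < abs (r ^+ n) by apply: modulus_gt0; rewrite expf_neq0.
exists (B / abs (r ^+ n)) => x y x1 y1; rewrite ler_pdivlMr// mulrC -modulusM.
apply: absB; exists (r ^+ n * x); first exact: nV.
by exists (r ^+ n * y); [exact: nV|rewrite mulrDr].
Qed.

(** In characteristic p the p^n-th powers are additive: they turn the bound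
    |x + y| <= B for integers x and y into |x + y|^(p^n) <= B for all n. *)
Lemma modulusD_le1 (p : nat) : p \in [pchar K] ->
  forall x y, abs x <= 1 -> abs y <= 1 -> abs (x + y) <= 1.
Proof.
move=> chp x y x1 y1; have [B absB] := modulusD_bounded.
have p1 : (1 < p)%N by exact/prime_gt1/(pcharf_prime chp).
have pow n : abs (x + y) ^+ (p ^ n) <= B.
  have -> : abs (x + y) ^+ (p ^ n) = abs (x ^+ (p ^ n) + y ^+ (p ^ n)).
    rewrite -modulusX; congr abs; elim: n => [//|n ih].
    by rewrite expnSr !exprM ih -!(pFrobenius_autE chp) rmorphD.
  by apply: absB; rewrite modulusX exprn_ile1 ?modulus_ge0.
rewrite leNgt; apply/negP => gt1.
pose d := abs (x + y) - 1; have d0 : 0 < d by rewrite subr_gt0.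
have bern n : 1 + d *+ n <= abs (x + y) ^+ n.
  have -> : abs (x + y) = 1 + d by rewrite /d [1 + _]addrC subrK.
  exact: bernoulli (ltW d0).
pose n := (Num.truncn (B / d)).+1.
have : B < d *+ n.
  by rewrite -mulr_natl -ltr_pdivrMr// truncnS_gt.
apply/negP; rewrite -leNgt; apply: le_trans (pow n); apply: le_trans (bern _).
have : d *+ n <= d *+ (p ^ n) by apply: ler_wpMn2l; [exact: ltW|rewrite ltnW// ltn_expl].
by move: d0; lra.
Qed.

(** The sets r^n V form a basis of neighbourhoods of 0, and they are comparable
    to the balls of the modulus because the modulus is bounded on V and the
    integers are contained in some r^-n V. *)
Lemma modulus_nbhs0 (U : set K) :
  nbhs 0 U <-> exists2 e, 0 < e & forall x, abs x <= e -> U x.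
Proof.
split=> [U0|[e e0 eU]].
  have [n1 nU] := contraction_nbhs0 K_local cV V0 V1 r0 rV rV1 U0.
  have [n2 nV] := integer_ring_bounded.
  have rn0 k : r ^+ k != 0 by rewrite expf_neq0.
  exists (abs (r ^+ (n1 + n2))) => [|x xle]; first exact: modulus_gt0.
  rewrite -(mulVKf (rn0 n1) x); apply: nU.
  rewrite -(mulVKf (rn0 n2) (_ * x)); apply: nV.
  rewrite mulrA -invfM -exprD addnC.
  rewrite -(ler_pM2l (modulus_gt0 (rn0 (n1 + n2)%N))) mulr1 -modulusM mulVKf//.
have [B B0 absB] := modulus_bounded cV.
have : \forall n \near \oo, abs (r ^+ n) * B <= e.
  pose n0 := Num.truncn (B / e); exists n0 => // n /= n0n.
  rewrite -ler_pdivlMr//; apply: (le_trans (abs_rX n)).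
  rewrite exprVn -lef_pV2 ?posrE ?invr_gt0 ?exprn_gt0 ?divr_gt0// invrK invf_div.
  apply: ltW; apply: (@lt_le_trans _ _ n0.+1%:R); first exact: truncnS_gt.
  by rewrite -natrX ler_nat (leq_ltn_trans n0n)// ltn_expl.
case=> n _ /(_ n (leqnn n)) rnB.
have : nbhs 0 [set x | V (r ^- n * x)].
  by apply: (@continuous_mull K (r ^- n) 0); rewrite mulr0.
apply: filterS => x Vx; apply: eU; apply: le_trans rnB.
rewrite -{1}(mulVKf (expf_neq0 n r0) x) modulusM ler_wpM2l ?modulus_ge0//.
exact: absB.
Qed.
End HaarModulus.

(** What the topology and the Haar measure of a local field of characteristic
    p say about its absolute value. *)
Record ultrametric_abs {R : realType} {K : topologicalFieldType} (abs : K -> R) :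
    Prop := UltrametricAbs {
  uabs0 : abs 0 = 0 ;
  uabs1 : abs 1 = 1 ;
  uabsM : forall x y, abs (x * y) = abs x * abs y ;
  uabs_gt0 : forall x, x != 0 -> 0 < abs x ;
  uabsD1 : forall x y, abs x <= 1 -> abs y <= 1 -> abs (x + y) <= 1 ;
  uabs_nbhs0 : forall U : set K,
    nbhs 0 U <-> exists2 e, 0 < e & forall x, abs x <= e -> U x }.

Lemma haar_modulus_ultrametric {R : realType} {K : topologicalFieldType}
    (mu : {measure set (borel K) -> \bar R}) (abs : K -> R) (p : nat) :
  local_field K -> p \in [pchar K] -> haar_measure mu -> haar_modulus mu abs ->
  ultrametric_abs abs.
Proof.
move=> Kl chp hm am.
have [V [r [[cV V0 V1 r0] [rV rV1 rVV V1r]]]] := local_field_contraction Kl.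
split.
- exact: modulus0 am.
- exact: (modulus1 Kl hm am cV V0 V1 r0).
- exact: (modulusM Kl hm am cV V0 V1 r0).
- exact: (modulus_gt0 Kl hm am cV V0 V1 r0).
- exact: (modulusD_le1 Kl hm am cV V0 V1 r0 rV rV1 rVV V1r chp).
- exact: (modulus_nbhs0 Kl hm am cV V0 V1 r0 rV rV1 rVV V1r).
Qed.

(** * Ultrametric balls and the digits of the residue field *)

Section UltrametricAbs.
Context {R : realType} {K : topologicalFieldType} (abs : K -> R).
Hypothesis uabs : ultrametric_abs abs.

Lemma uabs_ge0 x : 0 <= abs x.
Proof.
have [->|/(uabs_gt0 uabs)/ltW//] := eqVneq x 0.
by rewrite (uabs0 uabs).
Qed.

Lemma uabs_eq0 x : (abs x == 0) = (x == 0).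
Proof.
have [->|x0] := eqVneq x 0; first by rewrite (uabs0 uabs) eqxx.
by rewrite gt_eqF// uabs_gt0.
Qed.

Lemma uabsX x n : abs (x ^+ n) = abs x ^+ n.
Proof.
by elim: n => [|n ih]; rewrite ?expr0 ?(uabs1 uabs)// !exprS (uabsM uabs) ih.
Qed.

Lemma uabsV x : abs x^-1 = (abs x)^-1.
Proof.
have [->|x0] := eqVneq x 0; first by rewrite invr0 (uabs0 uabs) invr0.
have ax0 : abs x != 0 by rewrite uabs_eq0.
by apply: (mulfI ax0); rewrite -(uabsM uabs) !divff// (uabs1 uabs).
Qed.

Lemma uabsXz x (n : int) : abs (x ^ n) = abs x ^ n.
Proof. by case: n => n; rewrite ?NegzE -?exprnN ?uabsV -?exprnP uabsX. Qed.

Lemma uabsN x : abs (- x) = abs x.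
Proof.
rewrite -mulN1r (uabsM uabs); suff -> : abs (-1) = 1 by rewrite mul1r.
apply/eqP; rewrite -(@pexpr_eq1 _ _ 2)//; last exact: uabs_ge0.
by rewrite -uabsX sqrrN expr1n (uabs1 uabs).
Qed.

(** Dividing by the larger of x and y reduces the general ultrametric
    inequality to the case of two integers. *)
Lemma uabsD x y e : abs x <= e -> abs y <= e -> abs (x + y) <= e.
Proof.
wlog xy : x y / abs x <= abs y.
  move=> wl xe ye; have [xy|/ltW yx] := leP (abs x) (abs y); first exact: wl.
  by rewrite addrC; exact: wl.
move=> _; apply: le_trans.
have [y0|y0] := eqVneq y 0.
  by move: xy; rewrite y0 (uabs0 uabs) addr0.
have ay0 := uabs_gt0 uabs y0.
rewrite -[in x + y](divfK y0 x) -[X in _ + X]mul1r -mulrDl (uabsM uabs).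
rewrite ler_piMl ?uabs_ge0// (uabsD1 uabs)// ?(uabs1 uabs)//.
by rewrite (uabsM uabs) uabsV ler_pdivrMr// mul1r.
Qed.

Lemma uabsB x y e : abs x <= e -> abs y <= e -> abs (x - y) <= e.
Proof. by move=> xe ye; apply: uabsD => //; rewrite uabsN. Qed.

(** Every triangle is isosceles. *)
Lemma uabs_dist_max x y : abs (x - y) < abs x -> abs y = abs x.
Proof.
move=> xy; apply/eqP; rewrite eq_le; apply/andP; split; last first.
  rewrite leNgt; apply/negP => yx.
  have : abs x < abs x; last by rewrite ltxx.
  rewrite -{1}(subrK y x).
  apply: (@le_lt_trans _ _ (Num.max (abs (x - y)) (abs y))); last first.
    by rewrite gt_max xy.
  by apply: uabsD; rewrite le_max lexx ?orbT.
by rewrite -(subKr x y); apply: uabsB => //; exact: ltW.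
Qed.

Lemma uabs_open (A : set K) e : 0 < e ->
  (forall x y, A x -> abs (x - y) <= e -> A y) -> open A.
Proof.
move=> e0 Ae; rewrite openE => x Ax; rewrite /interior.
have U0 : nbhs 0 [set y | abs y <= e] by apply/(uabs_nbhs0 uabs); exists e.
have := nbhs_addl x U0; rewrite addr0.
apply: filterS => _ [y ye <-]; apply: (Ae x) => //.
by rewrite opprD addrA subrr add0r uabsN.
Qed.
End UltrametricAbs.

Lemma digit0 b n : digit b n 0 = (n %% b)%N.
Proof. by rewrite /digit expn0 divn1. Qed.

Lemma digitS b n k : digit b n k.+1 = digit b (n %/ b) k.
Proof. by rewrite /digit expnS divnMA. Qed.

Lemma digit_small b n k : (n < b ^ k)%N -> digit b n k = 0%N.
Proof. by move=> nb; rewrite /digit divn_small// mod0n. Qed.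

Lemma digit_surj (b c : nat) (a : nat -> nat) : (0 < b)%N ->
  (forall k, a k < b)%N ->
  exists2 n, (n < b ^ c)%N & forall k, (k < c)%N -> digit b n k = a k.
Proof.
move=> b0; elim: c a => [|c ih] a ab; first by exists 0%N.
have [n nb na] := ih (a \o succn) (fun k => ab k.+1).
exists (n * b + a 0%N)%N.
  rewrite expnSr (@leq_trans (n.+1 * b))// ?leq_mul//.
  by rewrite mulSn addnC ltn_add2r.
case=> [|k] kc; first by rewrite digit0 modnMDl modn_small.
by rewrite digitS divnMDl// divn_small// addn0 na.
Qed.

Section ResidueDigits.
Context {R : realType} {K : topologicalFieldType} (abs : K -> R).
Hypothesis uabs : ultrametric_abs abs.
Variables (p c : nat) (eps : 'I_c -> K).
Hypotheses (chp : p \in [pchar K]) (c_gt0 : (0 < c)%N).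
Hypotheses (residue_GFq : residue_field_GF abs (p ^ c))
           (eps_gen : gfq_generators abs p eps).

Let q := (p ^ c)%N.
Let p_gt1 : (1 < p)%N. Proof. exact/prime_gt1/(pcharf_prime chp). Qed.
Lemma residue_card_gt1 : (1 < p ^ c)%N.
Proof. by rewrite -(expn0 p) ltn_exp2l. Qed.

(** For n < q these are the elements of the copy of GF(q) in K, and u(n) is
    the quotient of [digit_rep n] by the prime element. *)
Definition digit_rep (n : nat) : K := \sum_(k < c) (digit p n k)%:R * eps k.

(** Base-p digits make [digit_rep] onto the span of the generators; as that
    span is a field with q elements, its restriction to n < q is bijective. *)
Lemma digit_repP : exists (E : finFieldType) (phi : {rmorphism E -> K})
    (sigma : 'I_(p ^ c) -> E),
  [/\ #|E| = (p ^ c)%N, bijective sigma,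
      (forall n : 'I_(p ^ c), digit_rep n = phi (sigma n)) &
      forall n, exists e, digit_rep n = phi e].
Proof.
have [E [phi [cE rphi]]] := gfq_gen_span eps_gen.
have rep n : exists e, digit_rep n = phi e.
  have : gfp_span p eps (digit_rep n).
    have lt k : (digit p n k < p)%N by rewrite ltn_mod ltnW.
    by exists (fun k => Ordinal (lt k)).
  by rewrite -rphi => -[e _ <-]; exists e.
pose sigma (n : 'I_(p ^ c)) := xchoose (ex_intro (fun e => digit_rep n == phi e)
  (projT1 (cid (rep n))) (introT eqP (projT2 (cid (rep n))))).
have sigmaE (n : 'I_(p ^ c)) : digit_rep n = phi (sigma n).
  by apply/eqP; exact: (xchooseP (ex_intro (fun e => digit_rep n == phi e) _ _)).
exists E, phi, sigma; split => //.
have surj e : exists n : 'I_(p ^ c), sigma n == e.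
  have : gfp_span p eps (phi e) by rewrite -rphi; exists e.
  case=> a ea.
  pose a' k := if insub k is Some i then nat_of_ord (a i) else 0%N.
  have a'p k : (a' k < p)%N by rewrite /a'; case: insubP => // _; exact: ltnW.
  have [n nq na] := digit_surj c (ltnW p_gt1) a'p.
  exists (Ordinal nq); apply/eqP/(fmorph_inj phi); rewrite -sigmaE ea.
  apply: eq_bigr => k _; rewrite na//= /a' insubT//= => kc.
  by congr ((_)%:R * _); congr (nat_of_ord (a _)); exact: val_inj.
pose g e := xchoose (surj e).
have gK : cancel g sigma by move=> e; exact/eqP/(xchooseP (surj e)).
apply: (bij_can_bij _ gK); apply: inj_card_bij; first exact: can_inj gK.
by rewrite card_ord cE.
Qed.

(** The nonzero elements of a finite field are roots of unity. *)
Let unit_phi (E : finFieldType) (phi : {rmorphism E -> K}) e : e != 0 -> abs (phi e) = 1.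
Proof.
move=> e0; apply/eqP; rewrite -(@pexpr_eq1 _ _ #|E|.-1) ?uabs_ge0//; last first.
  by rewrite -ltnS prednK ?finNzRing_gt1//; exact: ltnW (finNzRing_gt1 E).
rewrite -(uabsX uabs) -rmorphXn /=.
suff -> : e ^+ #|E|.-1 = 1 by rewrite rmorph1 (uabs1 uabs).
apply: (mulfI e0); rewrite -exprS prednK ?expf_card ?mulr1//.
exact: ltnW (finNzRing_gt1 E).
Qed.

Let le1_phi (E : finFieldType) (phi : {rmorphism E -> K}) e : abs (phi e) <= 1.
Proof.
have [->|e0] := eqVneq e 0; first by rewrite rmorph0 (uabs0 uabs) ler01.
by rewrite unit_phi.
Qed.

Lemma digit_rep_le1 n : abs (digit_rep n) <= 1.
Proof.
by have [E [phi [sigma [_ _ _ /(_ n)[e ->]]]]] := digit_repP; exact: le1_phi.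
Qed.

Lemma digit_rep_inj n m : (n < p ^ c)%N -> (m < p ^ c)%N ->
  abs (digit_rep n - digit_rep m) < 1 -> n = m.
Proof.
have [E [phi [sigma [_ bij rep _]]]] := digit_repP => nq mq.
rewrite (rep (Ordinal nq)) (rep (Ordinal mq)) -rmorphB => lt1.
have : Ordinal nq = Ordinal mq by apply: (bij_inj bij); apply/eqP;
  rewrite -subr_eq0; apply: contraTT lt1 => ne; rewrite unit_phi// ltxx.
by case.
Qed.

(** The finite subfield embeds in the residue field, because its nonzero
    elements are units; both have q elements. *)
Lemma digit_rep_surj x : abs x <= 1 ->
  exists2 n, (n < p ^ c)%N & abs (x - digit_rep n) < 1.
Proof.
have [E [phi [sigma [cE [g gK sigmaK] rep _]]]] := digit_repP => x1.
have [k [red [ck _ redDM _ red0]]] := residue_GFq.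
have inj : injective (red \o phi).
  move=> e e' /= eq; apply/eqP; rewrite -subr_eq0; apply/negP => /negP ne.
  have : red (phi (e - e') + phi e') = red (phi (e - e')) + red (phi e').
    by have [] := redDM (phi (e - e')) (phi e') (le1_phi _ _) (le1_phi _ _).
  rewrite -rmorphD subrK eq -{1}(add0r (red _)) => /addIr/esym.
  move=> /(red0 _ (le1_phi _ _)); rewrite /maximal_ideal /= unit_phi//.
  by rewrite ltxx.
have [h hK Kh] : bijective (red \o phi) by apply: inj_card_bij => //; rewrite ck cE.
pose e := h (red x); exists (g e) => //; rewrite rep sigmaK.
have xe1 : integer_ring abs (x - phi e) by apply: uabsB => //; exact: le1_phi.
apply/(red0 _ xe1); have [+ _] := redDM (x - phi e) (phi e) xe1 (le1_phi _ _).
rewrite subrK -[red (phi e)]/((red \o phi) (h (red x))) Kh -{1}(add0r (red x)).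
by move/addIr.
Qed.

Let digit_rep_closed n m (op : forall E : finFieldType, E -> E -> E) (opK : K -> K -> K) :
  (forall (E : finFieldType) (phi : {rmorphism E -> K}) e e',
    phi (op E e e') = opK (phi e) (phi e')) ->
  exists2 k, (k < p ^ c)%N & opK (digit_rep n) (digit_rep m) = digit_rep k.
Proof.
move=> opE; have [E [phi [sigma [cE [g gK sigmaK] rep rep']]]] := digit_repP.
have [e ->] := rep' n; have [e' ->] := rep' m.
by exists (g (op E e e')) => //; rewrite rep sigmaK opE.
Qed.

Lemma digit_repB n m :
  exists2 k, (k < p ^ c)%N & digit_rep n - digit_rep m = digit_rep k.
Proof.
apply: (@digit_rep_closed n m (fun E e e' => e - e') (fun x y => x - y)).
by move=> E phi e e'; exact: rmorphB.
Qed.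

Lemma digit_repM n m :
  exists2 k, (k < p ^ c)%N & digit_rep n * digit_rep m = digit_rep k.
Proof.
apply: (@digit_rep_closed n m (fun E e e' => e * e') (fun x y => x * y)).
by move=> E phi e e'; exact: rmorphM.
Qed.

Lemma digit_rep0 : digit_rep 0 = 0.
Proof. by apply: big1 => k _; rewrite /digit div0n mod0n mul0r. Qed.

(** Translations permute the finite subfield. *)
Lemma sum_digit_rep_shift (T : nmodType) (f : K -> T) m :
  \sum_(n < p ^ c) f (digit_rep n + digit_rep m) = \sum_(n < p ^ c) f (digit_rep n).
Proof.
have [E [phi [sigma [cE [g gK sigmaK] rep rep']]]] := digit_repP.
have [e ->] := rep' m.
have bij : bijective (fun n => g (sigma n + e)).
  exists (fun n => g (sigma n - e)) => n; rewrite sigmaK ?addrK ?subrK gK//.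
rewrite [RHS](reindex (fun n => g (sigma n + e)))/=; last exact: onW_bij.
by apply: eq_bigr => n _; rewrite !rep sigmaK rmorphD.
Qed.

End ResidueDigits.

(** * The setting *)

(** The data of the theorem apart from the wavelets, on which everything below
    depends. *)
Record wavelet_setting {R : realType} {K : topologicalFieldType}
    (mu : {measure set (borel K) -> \bar R}) (abs : K -> R) (p c : nat)
    (eps : 'I_c -> K) (varpi : K) (chi : K -> R[i]) : Prop := WaveletSetting {
  ws_local : local_field K ;
  ws_char : p \in [pchar K] ;
  ws_haar : haar_measure mu ;
  ws_modulus : haar_modulus mu abs ;
  ws_unit : mu (integer_ring abs) = 1%E ;
  ws_prime : prime_element abs varpi ;
  ws_c_gt0 : (0 < c)%N ;
  ws_residue : residue_field_GF abs (p ^ c) ;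
  ws_eps : gfq_generators abs p eps ;
  ws_chi : basic_character p eps varpi chi }.

Section Setting.
Context {R : realType} {K : topologicalFieldType}.
Variables (mu : {measure set (borel K) -> \bar R}) (abs : K -> R) (p c : nat).
Variables (eps : 'I_c -> K) (varpi : K) (chi : K -> R[i]).
Hypothesis S : wavelet_setting mu abs p eps varpi chi.

Local Notation q := (p ^ c)%N.
Local Notation un := (u p eps varpi).
Local Notation rep := (digit_rep p eps).

Lemma ws_uabs : ultrametric_abs abs.
Proof.
exact: (haar_modulus_ultrametric (ws_local S) (ws_char S) (ws_haar S) (ws_modulus S)).
Qed.
Let A := ws_uabs.

Lemma ws_q_gt1 : (1 < q)%N.
Proof. exact: residue_card_gt1 (ws_char S) (ws_c_gt0 S). Qed.
Lemma ws_q_gt0 : (0 < q)%N. Proof. exact: ltnW ws_q_gt1. Qed.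
Let p_gt1 : (1 < p)%N. Proof. exact/prime_gt1/(pcharf_prime (ws_char S)). Qed.

Let rep_le1 n := digit_rep_le1 A (ws_char S) (ws_eps S) n.

Lemma abs_prime_lt1 : abs varpi < 1. Proof. by have [] := ws_prime S. Qed.

(** As 0 is not isolated, the maximal ideal has nonzero elements. *)
Lemma prime_neq0 : varpi != 0.
Proof.
have U0 : nbhs 0 [set x | abs x <= 2^-1].
  by apply/(uabs_nbhs0 A); exists 2^-1 => //; rewrite invr_gt0.
have [x x0 x1] := local_field_not_isolated (ws_local S) U0.
have [_ /(_ x)] := ws_prime S.
have xlt1 : maximal_ideal abs x.
  by apply: le_lt_trans x1 _; rewrite invf_lt1// ltr1n.
move=> /(_ xlt1); apply: contraTneq => ->.
by rewrite (uabs0 A) -ltNge (uabs_gt0 A).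
Qed.
Let w0 := prime_neq0.
Let aw0 : 0 < abs varpi. Proof. exact: uabs_gt0. Qed.

Lemma abs_lt1_prime x : abs x < 1 -> abs (varpi^-1 * x) <= 1.
Proof.
move=> x1; rewrite (uabsM A) (uabsV A) mulrC ler_pdivrMr// mul1r.
by have [_] := ws_prime S; exact.
Qed.

Lemma abs_prime_lt1M x : abs x <= 1 -> abs (varpi * x) < 1.
Proof.
move=> x1; rewrite (uabsM A); apply: le_lt_trans abs_prime_lt1.
by rewrite ler_piMr// ltW.
Qed.

(** The digit is the representative of the residue class of x. *)
Lemma digit_split x : abs x <= 1 ->
  exists n y, [/\ (n < q)%N, abs y <= 1 & x = rep n + varpi * y].
Proof.
move=> /(digit_rep_surj A (ws_char S) (ws_residue S) (ws_eps S))[n nq lt1].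
exists n, (varpi^-1 * (x - rep n)); split => //; first exact: abs_lt1_prime.
by rewrite mulVKf// addrC subrK.
Qed.

(** * The translations *)

Lemma u_digitE n : u_digit p eps varpi n = rep n / varpi.
Proof. by []. Qed.

Let u_widen n N : (n < N)%N ->
  un n = \sum_(k < N) u_digit p eps varpi (digit q n k) * varpi ^- k.
Proof.
move=> nN; rewrite /u -(subnKC nN) big_split_ord /= [X in _ + X]big1 ?addr0//.
move=> k _; rewrite digit_small; last first.
  apply: leq_trans (ltn_expl n ws_q_gt1) _; rewrite leq_pexp2l ?ws_q_gt0//.
  by rewrite addSn ltnW// ltnS leq_addr.
by rewrite u_digitE digit_rep0 !mul0r.
Qed.

(** Splitting off the last base-q digit of n; the facts about u are proved by
    induction along this recursion. *)
Lemma u_rec n : un n = varpi^-1 * (rep (n %% q) + un (n %/ q)).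
Proof.
rewrite (@u_widen n n.+2)// (@u_widen (n %/ q) n.+1) ?ltnS ?leq_div//.
rewrite big_ord_recl/= digit0 u_digitE invr1 mulr1 mulrDr [rep _ * _]mulrC.
congr (_ + _); rewrite big_distrr; apply: eq_bigr => k _ /=.
by rewrite digitS mulrCA -invfM -exprS.
Qed.

Lemma u_cat n i : (i < q)%N -> un (n * q + i) = varpi^-1 * (rep i + un n).
Proof.
move=> iq; rewrite u_rec modnMDl modn_small// divnMDl ?ws_q_gt0//.
by rewrite divn_small// addn0.
Qed.

Lemma u_at0 : un 0 = 0.
Proof. by rewrite /u big_ord1 digit0 mod0n u_digitE digit_rep0 !mul0r. Qed.

Lemma u_mulq n j : un (n * q ^ j) = varpi ^- j * un n.
Proof.
elim: j => [|j ih]; first by rewrite muln1 invr1 mul1r.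
rewrite expnSr mulnA -[(_ * q)%N]addn0 u_cat ?ws_q_gt0// digit_rep0 add0r.
by rewrite ih mulrA -invfM -exprS.
Qed.

Lemma prime_exp_lt e : 0 < e -> exists n, abs (varpi ^+ n) < e.
Proof.
move=> e0; have d0 : 0 < (abs varpi)^-1 - 1.
  by rewrite subr_gt0 invf_gt1// abs_prime_lt1.
set d := _ - 1 in d0.
have bern n : 1 + d *+ n <= (abs varpi)^-1 ^+ n.
  have -> : (abs varpi)^-1 = 1 + d by rewrite /d addrC subrK.
  exact: bernoulli (ltW d0).
exists (Num.truncn (e^-1 / d)).+1; rewrite (uabsX A).
rewrite -ltf_pV2 ?posrE ?exprn_gt0// -exprVn.
apply: lt_le_trans (bern _); rewrite -[ltLHS]add0r ltr_leD//.
by rewrite -mulr_natl -ler_pdivrMr// ltW// truncnS_gt.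
Qed.

(** By induction on a power of the prime element that makes x an integer: each
    division by the prime element splits off one digit. *)
Lemma u_surj x : exists n, abs (x - un n) <= 1.
Proof.
have [r xr] : exists r, abs (varpi ^+ r * x) <= 1.
  have [->|x0] := eqVneq x 0; first by exists 0%N; rewrite mulr0 (uabs0 A).
  have ax0 : 0 < abs x by exact: uabs_gt0.
  have ax0' : 0 < (abs x)^-1 by rewrite invr_gt0.
  have [r h] := prime_exp_lt ax0'; exists r.
  by rewrite (uabsM A) -ler_pdivlMr// mul1r ltW.
elim: r x xr => [|r ih] x; first by rewrite mul1r => x1; exists 0%N; rewrite u_at0 subr0.
rewrite exprSr -mulrA => /ih[n /digit_split[i [y [iq y1 e]]]].
exists (n * q + i)%N; rewrite u_cat//.
have -> : x - varpi^-1 * (rep i + un n) = varpi^-1 * (varpi * x - un n - rep i).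
  by rewrite -addrA -opprD [un n + _]addrC mulrBr mulKf.
by rewrite e addrAC subrr add0r mulKf.
Qed.

(** Multiplication by the prime element brings the last digits to the surface;
    these are equal because distinct elements of the finite subfield have
    distance 1. Induction applies to the remaining digits. *)
Lemma u_inj n m : abs (un n - un m) <= 1 -> n = m.
Proof.
have [N nN mN] : exists2 N, (n <= N)%N & (m <= N)%N.
  by exists (maxn n m); rewrite ?leq_maxl ?leq_maxr.
elim: N n m nN mN => [|N ih] n m; first by rewrite !leqn0 => /eqP -> /eqP ->.
move=> nN mN h.
have half k : (k <= N.+1)%N -> (k %/ q <= N)%N.
  case: k => [|k] kN; first by rewrite div0n.
  by rewrite -ltnS (leq_trans _ kN)// ltn_Pdiv// ws_q_gt1.
have lt1 : abs ((rep (n %% q) - rep (m %% q)) + (un (n %/ q) - un (m %/ q))) < 1.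
  have -> : (rep (n %% q) - rep (m %% q)) + (un (n %/ q) - un (m %/ q)) =
      varpi * (un n - un m).
    by rewrite (u_rec n) (u_rec m) -mulrBr mulVKf// opprD addrACA.
  exact: abs_prime_lt1M.
have nm : (n %/ q = m %/ q)%N.
  apply: ih; rewrite ?half//.
  set b := un _ - un _ in lt1 *; set a := rep _ - rep _ in lt1 *.
  have -> : b = (a + b) - a by rewrite [a + b]addrC addrK.
  by apply: (uabsB A); [exact: ltW|exact: (uabsB A)].
move: lt1; rewrite nm subrr addr0 => /(digit_rep_inj A (ws_char S) (ws_eps S)).
rewrite !ltn_mod ws_q_gt0 => /(_ isT isT) mm.
by rewrite (divn_eq n q) (divn_eq m q) nm mm.
Qed.

Lemma u_sub n m : exists k, un n - un m = un k.
Proof.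
have [N nN mN] : exists2 N, (n <= N)%N & (m <= N)%N.
  by exists (maxn n m); rewrite ?leq_maxl ?leq_maxr.
elim: N n m nN mN => [|N ih] n m.
  by rewrite !leqn0 => /eqP -> /eqP ->; exists 0%N; rewrite u_at0 subrr.
move=> nN mN.
have half k : (k <= N.+1)%N -> (k %/ q <= N)%N.
  case: k => [|k] kN; first by rewrite div0n.
  by rewrite -ltnS (leq_trans _ kN)// ltn_Pdiv// ws_q_gt1.
have [k uk] := ih _ _ (half _ nN) (half _ mN).
have [i iq ri] := digit_repB (ws_char S) (ws_eps S) (n %% q) (m %% q).
by exists (k * q + i)%N; rewrite u_cat// -uk -ri (u_rec n) (u_rec m) -mulrBr opprD addrACA.
Qed.

(** * The character *)

Let ch := ws_chi S.

Lemma chi0 : chi 0 = 1.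
Proof.
have c0 : chi 0 != 0 by rewrite -normr_eq0 (chi_unitary ch) oner_neq0.
by have := chiD ch 0 0; rewrite addr0 -{1}[chi 0]mulr1 => /(mulfI c0).
Qed.

Lemma chi_neq0 x : chi x != 0.
Proof. by rewrite -normr_eq0 (chi_unitary ch) oner_neq0. Qed.

Lemma chi_nat x n : chi (n%:R * x) = chi x ^+ n.
Proof.
elim: n => [|n ih]; first by rewrite mul0r chi0.
by rewrite -natr1 mulrDl mul1r (chiD ch) ih exprSr.
Qed.

Lemma chi_digit_rep n (j : int) : j != 1 -> chi (rep n * varpi ^ (- j)) = 1.
Proof.
move=> j1; rewrite /digit_rep mulr_suml.
apply: (big_ind (fun x => chi x = 1)); first exact: chi0.
  by move=> x y hx hy; rewrite (chiD ch) hx hy mulr1.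
move=> k _; rewrite -mulrA chi_nat (chi_basic ch) (negbTE j1) andbF.
by rewrite expr1n.
Qed.

(** The value of chi does not change when an integer loses its first digit, so
    that chi x is the value of chi at elements arbitrarily close to 0. *)
Lemma chi_integer x : abs x <= 1 -> chi x = 1.
Proof.
move=> x1; apply: contrapT => /eqP nx.
have step k : exists2 y, abs y <= 1 & chi x = chi (varpi ^+ k * y).
  elim: k => [|k [y /digit_split[n [z [nq z1 ->]]] ->]].
    by exists x; rewrite // mul1r.
  exists z => //; rewrite mulrDr (chiD ch) mulrA -exprSr.
  have := @chi_digit_rep n (- k%:Z); rewrite opprK -exprnP mulrC => ->; last first.
    by case: k.
  by rewrite mul1r.
have : nbhs 0 [set y | chi y != chi x].
  have := @chi_continuous _ _ _ _ _ _ _ ch 0 [set z : cplx R | z != chi x].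
  rewrite chi0; apply.
  apply: open_nbhs_nbhs; split; last by rewrite /= eq_sym.
  have -> : [set z : cplx R | z != chi x] = ~` [set chi x : cplx R].
    by apply/seteqP; split => z /= /eqP.
  by apply: closed_openC; apply: accessible_closed_set1; apply: hausdorff_accessible;
    exact: norm_hausdorff.
move=> /(uabs_nbhs0 A)[e e0 eU].
have [k ke] := prime_exp_lt e0; have [y y1 xy] := step k.
suff : chi (varpi ^+ k * y) != chi x by rewrite -xy eqxx.
apply: eU; rewrite (uabsM A); apply: le_trans (ltW ke).
by rewrite ler_piMr// (uabs_ge0 A).
Qed.

Lemma chi_prime_inv : chi varpi^-1 != 1.
Proof.
have := chi_basic ch (Ordinal (ws_c_gt0 S)) 1.
rewrite (gfq_gen0 (ws_eps S))// mul1r => /= ->.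
apply/eqP => -[c1 _]; have p0 : (0 : R) < p%:R by rewrite ltr0n ltnW.
have : cos (2 * pi / p%:R) < cos (0 : R); last by rewrite cos0 c1 ltxx.
have tp : 0 < (2 * pi / p%:R : R) by rewrite divr_gt0// mulr_gt0// pi_gt0.
rewrite ltr_cos// in_itv/= ?lexx ?pi_ge0// ltW//=.
rewrite ler_pdivrMr// mulrC ler_pM2l ?pi_gt0//.
by rewrite ler_nat.
Qed.

Lemma abs_u_gt1 n : (0 < n)%N -> 1 < abs (un n).
Proof.
move=> n0; rewrite ltNge; apply/negP => un1.
by have : n = 0%N; [apply: u_inj; rewrite u_at0 subr0|case: n n0 {un1}].
Qed.

(** The product of two digits is a digit, and it occurs in the product of u(n)
    and u(m) with an exponent at most -2, where chi is trivial. *)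
Lemma chi_uM n m : chi (un n * un m) = 1.
Proof.
have A1 i j : chi (rep i * varpi ^- j.+1 * un m) = 1.
  elim/ltn_ind: m j => m ih j.
  have [->|m0] := posnP m; first by rewrite u_at0 mulr0 chi0.
  rewrite (u_rec m) mulrA -[_ / varpi]mulrA -invfM -exprSr mulrDr (chiD ch).
  rewrite ih ?ltn_Pdiv ?ws_q_gt1// mulr1 mulrAC.
  have [k _ ->] := digit_repM (ws_char S) (ws_eps S) i (m %% q).
  by have := @chi_digit_rep k j.+2%:Z; rewrite -exprnN => ->.
have B1 j : chi (varpi ^- j * un n * un m) = 1.
  elim/ltn_ind: n j => n ih j.
  have [->|n0] := posnP n; first by rewrite u_at0 mulr0 mul0r chi0.
  rewrite (u_rec n) mulrA -invfM -exprSr mulrDr mulrDl (chiD ch).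
  by rewrite ih ?ltn_Pdiv ?ws_q_gt1// mulr1 [_ * rep _]mulrC A1.
by have := B1 0%N; rewrite invr1 mul1r.
Qed.

(** The summand is a character of the additive group of the finite subfield.
    It is not trivial: at the digit n of y^-1 its value is chi(1 / varpi). *)
Lemma sum_chi_digit y : abs y = 1 -> \sum_(i < q) chi (rep i * varpi^-1 * y) = 0.
Proof.
move=> y1; have y0 : y != 0 by rewrite -(uabs_eq0 A) y1 oner_eq0.
have yV1 : abs y^-1 <= 1 by rewrite (uabsV A) y1 invr1.
have [n [z [nq z1 e]]] := digit_split yV1.
have : chi (rep n * varpi^-1 * y) != 1.
  have -> : rep n * varpi^-1 * y = varpi^-1 - z * y.
    have -> : rep n = y^-1 - varpi * z.
      by rewrite e addrK.
    rewrite !mulrBl mulrAC mulVf// mul1r; congr (_ - _).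
    by rewrite mulrAC -mulrA mulrCA mulrAC mulfV// mul1r mulrC.
  rewrite (chiD ch) (chi_integer (x := - _)) ?mulr1 ?chi_prime_inv//.
  by rewrite (uabsN A) (uabsM A) y1 mulr1 z1// (uabsV A) y1 invr1.
set S0 := \sum_(i < q) _ => ne.
have : S0 = S0 * chi (rep n * varpi^-1 * y).
  rewrite {1}/S0 -(sum_digit_rep_shift (ws_char S) (ws_eps S)
    (fun x => chi (x * varpi^-1 * y)) n).
  rewrite mulr_suml; apply: eq_bigr => i _.
  by rewrite 2!mulrDl (chiD ch).
rewrite -{1}(mulr1 S0) => /eqP; rewrite -subr_eq0 -mulrBr mulf_eq0 subr_eq0.
by rewrite [1 == _]eq_sym (negbTE ne) orbF => /eqP.
Qed.
End Setting.

(** * Sums of nonnegative extended reals *)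

Section ESums.
Context {R : realType}.
Local Open Scope ereal_scope.

Lemma nneseries_gt (a : nat -> \bar R) (x : \bar R) : (forall k, 0 <= a k) ->
  x < \sum_(k <oo) a k -> exists n, x < \sum_(0 <= k < n) a k.
Proof.
move=> a0 xa; apply: contrapT => nex; move: xa; apply/negP; rewrite -leNgt.
apply: lime_le; first by apply: is_cvg_nneseries => k _.
by apply: nearW => n; rewrite leNgt; apply/negP => h; apply: nex; exists n.
Qed.

Lemma nneseries_tail (a : nat -> \bar R) (r : R) : (forall k, 0 <= a k) ->
  \sum_(k <oo) a k < +oo -> (0 < r)%R ->
  exists n, \sum_(k <oo) a k < \sum_(0 <= k < n) a k + r%:E.
Proof.
move=> a0 fin r0; have fin' : \sum_(k <oo) a k \is a fin_num.
  by rewrite ge0_fin_numE// nneseries_ge0.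
have [|n xn] := @nneseries_gt a (\sum_(k <oo) a k - r%:E) a0.
  by rewrite lte_subel_addr// lteDl.
by exists n; rewrite -lteBlDr.
Qed.
Lemma esum_le_seq (T : choiceType) (a : T -> \bar R) (b : \bar R) :
  (forall s : seq T, uniq s -> \sum_(t <- s) a t <= b) ->
  \esum_(t in [set: T]) a t <= b.
Proof.
move=> h; apply: ge_ereal_sup => _ [X [finX _] <-].
by rewrite fsbig_finite//=; apply: h; exact: finmap.fset_uniq.
Qed.

Lemma seq_le_esum (T : choiceType) (a : T -> \bar R) (s : seq T) : uniq s ->
  \sum_(t <- s) a t <= \esum_(t in [set: T]) a t.
Proof.
move=> us; apply: esum_ge; exists [set` s]; last by rewrite fsbig_seq.
by split => //; exact: finite_seq.
Qed.

Lemma esum_gt_seq (T : choiceType) (a : T -> \bar R) (x : \bar R) :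
  x < \esum_(t in [set: T]) a t ->
  exists2 s : seq T, uniq s & x < \sum_(t <- s) a t.
Proof.
move=> xa; apply: contrapT => nex; move: xa; apply/negP; rewrite -leNgt.
apply: esum_le_seq => s us; rewrite leNgt; apply/negP => h.
by apply: nex; exists s.
Qed.

(** An encoding of T in the natural numbers turns the sum into a series, so
    that monotone convergence applies to it. *)
Lemma esum_nneseries (T : countType) (a : T -> \bar R) : (forall t, 0 <= a t) ->
  \esum_(t in [set: T]) a t =
  \sum_(n <oo) (if pickle_inv n is Some t then a t else 0).
Proof.
move=> a0; pose b n := if pickle_inv n is Some t then a t else 0.
rewrite (@nneseries_esumT _ b) /b; last by move=> n; case: pickle_inv.
transitivity (\esum_(t in [set: T]) b (pickle t)).
  by apply: eq_esum => t _; rewrite /b pickleK_inv.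
rewrite -(esum_image [set: T] pickle b); last first.
  by move=> x y _ _; exact: (pcan_inj pickleK).
rewrite esum_mkcond; apply: eq_esum => n _; case: ifPn => //.
rewrite notin_setE /b; have := @pickle_invK T n; case: pickle_inv => //= t tn h.
by exfalso; apply: h; exists t.
Qed.

Lemma integral_esum d (X : measurableType d) (mu : {measure set X -> \bar R})
    (D : set X) (T : countType) (f : T -> X -> \bar R) : measurable D ->
  (forall t, measurable_fun D (f t)) -> (forall t x, 0 <= f t x) ->
  \int[mu]_(x in D) (\esum_(t in [set: T]) f t x) =
  \esum_(t in [set: T]) \int[mu]_(x in D) f t x.
Proof.
move=> mD mf f0; rewrite esum_nneseries; last by move=> t; exact: integral_ge0.
under eq_integral do rewrite esum_nneseries//.
rewrite integral_nneseries//.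
- apply: eq_eseriesr => n _; case: pickle_inv => //; exact: integral0.
- by move=> n; case: pickle_inv.
- by move=> n x _; case: pickle_inv.
Qed.

Lemma measurable_esum d (X : measurableType d) (T : countType)
    (f : T -> X -> \bar R) : (forall t, measurable_fun setT (f t)) ->
  (forall t x, 0 <= f t x) ->
  measurable_fun setT (fun x => \esum_(t in [set: T]) f t x).
Proof.
move=> mf f0; under eq_fun do rewrite esum_nneseries//.
apply: ge0_emeasurable_sum => //.
- by move=> n x _ _; case: pickle_inv.
- by move=> n _; case: pickle_inv.
Qed.

Lemma esumZl (T : countType) (a : T -> \bar R) (r : R) : (0 <= r)%R ->
  (forall t, 0 <= a t) ->
  \esum_(t in [set: T]) (r%:E * a t) = r%:E * \esum_(t in [set: T]) a t.
Proof.
move=> r0 a0; rewrite !esum_nneseries//; last first.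
  by move=> t; rewrite mule_ge0.
rewrite -nneseriesZl//; last by move=> n _; case: pickle_inv.
by apply: eq_eseriesr => n _; case: pickle_inv => //; rewrite mule0.
Qed.

Lemma sum_esum_pair (L : nat) (T : choiceType) (a : 'I_L * T -> \bar R) :
  (forall x, 0 <= a x) ->
  \sum_(l < L) \esum_(t in [set: T]) a (l, t) = \esum_(x in [set: 'I_L * T]) a x.
Proof.
move=> a0.
have -> : \sum_(l < L) \esum_(t in [set: T]) a (l, t) =
    \esum_(l in [set: 'I_L]) \esum_(t in [set: T]) a (l, t).
  have fin : finite_set [set: 'I_L] by exact: finite_finset.
  have e0 l : l \in [set: 'I_L] -> 0 <= \esum_(t in [set: T]) a (l, t).
    by move=> _; exact: esum_ge0.
  have := @esum_fset R _ [set: 'I_L] (fun l => \esum_(t in [set: T]) a (l, t)) fin e0.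
  move=> ->; rewrite fsbig_finite//=; apply: perm_big; apply: uniq_perm.
  - exact: index_enum_uniq.
  - exact: finmap.fset_uniq.
  - by move=> l; rewrite mem_index_enum in_fset_set// in_setT.
rewrite (@esum_esum R _ _ [set: 'I_L] (fun=> [set: T]) (fun l t => a (l, t)))//.
rewrite [X in esum X](_ : _ = [set: 'I_L * T]); last by apply/seteqP; split.
by apply: eq_esum => -[].
Qed.

Lemma esum_integral_disjoint d (X : measurableType d) (mu : {measure set X -> \bar R})
    (T : countType) (D : T -> set X) (f : X -> \bar R) :
  (forall t, measurable (D t)) -> trivIset setT D ->
  measurable_fun setT f -> (forall x, 0 <= f x) ->
  \esum_(t in [set: T]) \int[mu]_(x in D t) f x =
  \int[mu]_(x in \bigcup_t D t) f x.
Proof.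
move=> mD tD mf f0.
have e1 t : \int[mu]_(x in D t) f x = \int[mu]_x (f \_ (D t)) x.
  by rewrite [LHS]integral_mkcond.
under eq_esum do rewrite e1.
rewrite -integral_esum//; last 2 first.
- by move=> t; apply/(measurable_restrictT _ (mD t)); exact: measurable_funTS.
- by move=> t x; rewrite patchE; case: ifP.
rewrite [RHS]integral_mkcond; apply: eq_integral => x _.
rewrite patchE; case: ifPn => [/set_mem[t _ xt]|/negP nx].
  rewrite (esumID [set t])//; last by move=> i _; rewrite patchE; case: ifP.
  rewrite setTI esum_set1; last by rewrite patchE; case: ifP.
  rewrite patchE mem_set// esum1 ?adde0// => i [_ /= it].
  rewrite patchE; case: ifP => // /set_mem xi; exfalso; apply: it.
  by apply: tD => //; exists x.
apply: esum1 => t _; rewrite patchE; case: ifP => // /set_mem xt.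
by exfalso; apply: nx; apply: mem_set; exists t.
Qed.
End ESums.

Lemma sume_eq_bounds {R : realType} (s : seq nat) (a : nat -> \bar R) (b : R) :
  (forall i, 0 <= a i <= b%:E)%E -> (\sum_(i <- s) a i = \sum_(i <- s) b%:E)%E ->
  forall i, i \in s -> a i = b%:E.
Proof.
move=> ab sab i si; have /andP[ai0 aib] := ab i.
have afin j : a j \is a fin_num.
  have /andP[aj0 ajb] := ab j.
  by rewrite ge0_fin_numE//; apply: le_lt_trans ajb (ltry _).
apply/eqP; rewrite eq_le aib /= leNgt; apply/negP => lt_ab.
have : (\sum_(i <- s) a i < \sum_(i <- s) b%:E)%E.
  rewrite -(fineK (afin i)) lte_fin in lt_ab.
  rewrite (eq_bigr (fun j => (fine (a j))%:E)); last by move=> j _; rewrite fineK.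
  rewrite !sumEFin lte_fin; elim: s si {sab} => // j s ih.
  have le t : t \in (s : seq nat) -> fine (a t) <= b.
    by move=> _; have /andP[_] := ab t; rewrite -lee_fin fineK.
  have lej : fine (a j) <= b by have /andP[_] := ab j; rewrite -lee_fin fineK.
  rewrite inE !big_cons => /orP[/eqP <-|/ih h]; last by rewrite ler_ltD.
  rewrite ltr_leD// big_seq [leRHS]big_seq; exact: ler_sum.
by rewrite sab ltxx.
Qed.

(** * Balls and changes of variables *)

Section DensityMeasure.
Local Open Scope ereal_scope.
Context {d} {T : measurableType d} {R : realType} (mu : {measure set T -> \bar R}).
Variables (f : T -> \bar R).
Hypotheses (mf : measurable_fun [set: T] f) (f0 : forall x, 0 <= f x).

(** The proofs are arguments in order that the measure structure can be attached
    to this function. *)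
Definition density_measure of measurable_fun [set: T] f & (forall x, 0 <= f x) :=
  fun B : set T => \int[mu]_(x in B) f x.

Let density0 : density_measure mf f0 set0 = 0.
Proof. exact: integral_set0. Qed.

Let density_ge0 B : 0 <= density_measure mf f0 B.
Proof. exact: integral_ge0. Qed.

Let density_sigma_additive : semi_sigma_additive (density_measure mf f0).
Proof.
move=> B mB tB mUB; rewrite /density_measure ge0_integral_bigcup//.
  by apply: is_cvg_ereal_nneg_natsum_cond => n _ _; exact: integral_ge0.
exact: measurable_funTS.
Qed.

HB.instance Definition _ := isMeasure.Build _ _ _ (density_measure mf f0)
  density0 density_ge0 density_sigma_additive.
End DensityMeasure.

Section Balls.
Context {R : realType} {K : topologicalFieldType}.
Variables (mu : {measure set (borel K) -> \bar R}) (abs : K -> R) (p c : nat).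
Variables (eps : 'I_c -> K) (varpi : K) (chi : K -> R[i]).
Hypothesis S : wavelet_setting mu abs p eps varpi chi.

Local Notation q := (p ^ c)%N.
Local Notation un := (u p eps varpi).
Local Notation rep := (digit_rep p eps).
Let A := ws_uabs S.
Let w0 := prime_neq0 S.

(** The coset of radius q^-n that contains varpi^n u(k). For fixed n these cosets
    partition K, and only the one with k = 0 contains 0. *)
Definition qball (n : int) (k : nat) : set K :=
  [set x | abs (varpi ^ (- n) * x - un k) <= 1].

Lemma locally_constant_measurable d (T : measurableType d) (f : K -> T) (e : R) :
  0 < e -> (forall x y, abs (x - y) <= e -> f x = f y) ->
  measurable_fun [set: borel K] (f : borel K -> T).
Proof.
move=> e0 fe _ B mB; rewrite setTI; apply: borel_open.
apply: (uabs_open A e0) => x y Bx /fe xy.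
by rewrite /preimage /= -xy.
Qed.

Lemma qball_ultra n k x y : qball n k x -> abs (x - y) <= abs varpi ^ n -> qball n k y.
Proof.
rewrite /qball /= => xk xy.
have -> : varpi ^ (- n) * y - un k =
    (varpi ^ (- n) * x - un k) - varpi ^ (- n) * (x - y).
  by move: (varpi ^ (- n)) => t; ring.
apply: (uabsB A) => //; rewrite (uabsM A) (uabsXz A) -invr_expz.
by rewrite mulrC ler_pdivrMr ?mul1r// exprz_gt0// (uabs_gt0 A).
Qed.

Lemma qball_open n k : open (qball n k).
Proof.
apply: (uabs_open A (e := abs varpi ^ n)); first by rewrite exprz_gt0// (uabs_gt0 A).
exact: qball_ultra.
Qed.

Lemma measurable_qball n k : measurable (qball n k : set (borel K)).
Proof. by apply: borel_open; exact: qball_open. Qed.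

Lemma qball_cover n x : exists k, qball n k x.
Proof. exact: (u_surj S). Qed.

Lemma qball_inj n k l x : qball n k x -> qball n l x -> k = l.
Proof.
rewrite /qball /= => xk xl; apply: (u_inj S).
have -> : un k - un l = (varpi ^ (- n) * x - un l) - (varpi ^ (- n) * x - un k).
  by move: (varpi ^ (- n) * x) => t; ring.
exact: (uabsB A).
Qed.

(** Division by the prime element appends a last digit i to k. *)
Lemma qball_split n k x : qball n k x <->
  exists2 i, (i < q)%N & qball (n + 1) (k * q + i) x.
Proof.
have e i : (i < q)%N -> varpi ^ (- (n + 1)) * x - un (k * q + i) =
    varpi^-1 * (varpi ^ (- n) * x - un k - rep i).
  move=> iq; rewrite (u_cat S)// opprD expfzDr// exprN1 [_ / varpi]mulrC.
  by rewrite -mulrA -mulrBr opprD addrA addrAC.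
split=> [/(digit_split S)[i [y [iq y1 ey]]]|[i iq]].
  exists i => //; rewrite /qball /= e// ey [rep i + _]addrC addrK mulKf//.
rewrite /qball /= e//; set z := _ - un k => /(abs_prime_lt1M S)/ltW.
rewrite mulVKf// => zi; rewrite -(subrK (rep i) z).
by apply: (uabsD A) => //; exact: (digit_rep_le1 A (ws_char S) (ws_eps S)).
Qed.

Lemma qball_parent n (j : nat) k x : qball (n + j%:Z) k x -> qball n (k %/ q ^ j) x.
Proof.
elim: j k => [|j ih] k; first by rewrite addr0 expn0 divn1.
move=> h; rewrite expnS divnMA; apply: ih.
apply/qball_split; exists (k %% q)%N; first by rewrite ltn_mod (ws_q_gt0 S).
by rewrite -divn_eq -addrA -PoszD addn1.
Qed.

(** The balls of level n + j inside the ball number k of level n are those whose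
    number begins with the base-q digits of k, followed by j more digits. *)
Lemma qball_sub n (j : nat) k x : qball n k x <->
  exists2 i, (i < q ^ j)%N & qball (n + j%:Z) (k * q ^ j + i) x.
Proof.
have qj0 : (0 < q ^ j)%N by rewrite expn_gt0 (ws_q_gt0 S).
split=> [xk|[i iq /qball_parent]].
  have [l xl] := qball_cover (n + j%:Z) x.
  have -> : k = (l %/ q ^ j)%N by apply: (qball_inj xk); exact: qball_parent.
  by exists (l %% q ^ j)%N; [rewrite ltn_mod|rewrite -divn_eq].
by rewrite divnMDl// divn_small// addn0.
Qed.

Lemma qball_sub_bigsetU n (j : nat) k : qball n k =
  \big[setU/set0]_(i < q ^ j) qball (n + j%:Z) (k * q ^ j + i).
Proof.
rewrite -(bigcup_mkord (q ^ j) (fun i => qball (n + j%:Z) (k * q ^ j + i))).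
apply/seteqP; split => x.
  by move=> /(qball_sub n j)[i iq xi]; exists i.
by case=> i iq xi; apply/(qball_sub n j); exists i.
Qed.

Lemma qball0 n k : qball n k 0 <-> k = 0%N.
Proof.
rewrite /qball /= mulr0 sub0r (uabsN A); split=> [|->]; last first.
  by rewrite u_at0 (uabs0 A).
by case: (posnP k) => // /(abs_u_gt1 S); rewrite ltNge => /negP.
Qed.

(** * Affine changes of variable *)

Lemma affine_preimage (a b : K) (B : set K) : a != 0 ->
  (fun x => a * x + b) @^-1` B = [set a^-1 * x | x in [set - b + x | x in B]].
Proof.
move=> a0; apply/seteqP; split => x /=.
  move=> Bx; exists (a * x); last by rewrite mulKf.
  by exists (a * x + b) => //; rewrite addrC addrK.
by move=> [_ [y By <-] <-]; rewrite mulVKf// addrC addrA subrr add0r.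
Qed.

Lemma measurable_affine (a b : K) :
  measurable_fun [set: borel K] ((fun x => a * x + b) : borel K -> borel K).
Proof. by apply: borel_continuous; exact: continuous_affine. Qed.

Lemma mu_affine_preimage (a b : K) (B : set (borel K)) : a != 0 -> measurable B ->
  mu ((fun x => a * x + b) @^-1` B) = ((abs a)^-1%:E * mu B)%E.
Proof.
move=> a0 mB.
have mB' : measurable ([set - b + x | x in B] : set (borel K)).
  have <- : (fun x => 1 * x + b) @^-1` B = [set - b + x | x in B].
    rewrite affine_preimage ?oner_neq0// invr1; apply/seteqP; split => x /=.
      by move=> [y + <-]; rewrite mul1r.
    by move=> h; exists x; rewrite ?mul1r.
  by rewrite -[X in measurable X]setTI; exact: measurable_affine.
rewrite affine_preimage// (modulusP (ws_modulus S)) ?invr_eq0// (uabsV A).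
by rewrite (haar_translation (ws_haar S)).
Qed.

Local Open Scope ereal_scope.

Lemma ge0_integral_affine (a b : K) (D : set (borel K)) (f : borel K -> \bar R) :
  a != 0%R -> measurable D -> measurable_fun setT f -> (forall x, 0 <= f x) ->
  \int[mu]_(x in (fun x => a * x + b)%R @^-1` D) f (a * x + b)%R =
  (abs a)^-1%:E * \int[mu]_(x in D) f x.
Proof.
move=> a0 mD mf f0.
have ai : (0 <= (abs a)^-1)%R by rewrite invr_ge0 (uabs_ge0 A).
have mT := @measurable_affine a b.
rewrite -[LHS](ge0_integral_pushforward mT)//; last exact: measurable_funTS.
rewrite (eq_measure_integral (mscale (NngNum ai) mu)); last first.
  by move=> B mB _; rewrite /mscale; exact: mu_affine_preimage.
by rewrite ge0_integral_mscale//; exact: measurable_funTS.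
Qed.

Lemma integrable_affine (a b : K) (f : borel K -> \bar R) : a != 0%R ->
  mu.-integrable setT f ->
  mu.-integrable setT (fun x : borel K => f (a * x + b)%R).
Proof.
move=> a0 /integrableP[mf fi]; apply/integrableP; split.
  by apply: (@measurableT_comp _ _ _ _ _ _ f) => //; exact: measurable_affine.
have := @ge0_integral_affine a b setT (fun x => `|f x|) a0 measurableT.
rewrite preimage_setT => ->//; last by apply: measurableT_comp.
rewrite lte_mul_pinfty// lee_fin invr_ge0; exact: (uabs_ge0 A).
Qed.

Lemma integral_affine (a b : K) (f : borel K -> \bar R) : a != 0%R ->
  mu.-integrable setT f ->
  \int[mu]_x f (a * x + b)%R = (abs a)^-1%:E * \int[mu]_x f x.
Proof.
move=> a0 fi; have /integrableP[mf _] := fi.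
have scale (g : borel K -> \bar R) : measurable_fun setT g -> (forall x, 0 <= g x) ->
    \int[mu]_x g (a * x + b)%R = (abs a)^-1%:E * \int[mu]_x g x.
  by move=> mg g0; rewrite -(@ge0_integral_affine a b setT g)// preimage_setT.
rewrite integralE [in RHS]integralE.
have -> : (fun x : borel K => f (a * x + b)%R)^\+ = (fun x => f^\+ (a * x + b)%R).
  exact: (funepos_comp f (fun x => a * x + b)%R).
have -> : (fun x : borel K => f (a * x + b)%R)^\- = (fun x => f^\- (a * x + b)%R).
  exact: (funeneg_comp f (fun x => a * x + b)%R).
rewrite !scale//; [|exact: measurable_funeneg|exact: measurable_funepos].
rewrite -(fineK (integrable_pos_fin_num measurableT fi)).
rewrite -(fineK (integrable_neg_fin_num measurableT fi)).
by rewrite -[X in _ = _ * X]EFinB -!EFinM -EFinB mulrBr.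
Qed.

Lemma ae_affine (a b : K) (P : K -> Prop) : a != 0%R ->
  {ae mu, forall x : borel K, P x} -> {ae mu, forall x : borel K, P (a * x + b)%R}.
Proof.
move=> a0 [N [mN N0 PN]]; exists ((fun x => a * x + b)%R @^-1` N); split.
- by rewrite -[X in measurable X]setTI; exact: measurable_affine.
- by rewrite [LHS](mu_affine_preimage b a0 mN) N0 mule0.
- by move=> x /= nP; apply: PN.
Qed.

(** * The measure of the balls *)

(** The integers have measure 1 and are the disjoint union of q cosets of
    varpi D. *)
Lemma abs_prime : abs varpi = ((q%:R)^-1)%R.
Proof.
have q0 : (0 < q%:R :> R)%R by rewrite ltr0n (ws_q_gt0 S).
pose D : set (borel K) := integer_ring abs.
have D0 : D = qball 0 0.
  by apply/seteqP; split => x; rewrite /D /qball /= oppr0 expr0z mul1r u_at0 subr0.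
have mD : measurable D by rewrite D0; exact: measurable_qball.
have muB i : (i < q)%N -> mu (qball 1 i) = (abs varpi)%:E.
  move=> iq; have -> : qball 1 i = (fun x => varpi^-1 * x + - un i)%R @^-1` D.
    by apply/seteqP; split => x; rewrite /qball /D /= exprN1.
  rewrite mu_affine_preimage ?invr_eq0// (uabsV A) invrK.
  by rewrite (ws_unit S) mule1.
have : mu D = \sum_(i < q) mu (qball 1 i).
  rewrite D0 (qball_sub_bigsetU 0 1) expn1 mul0n add0r.
  rewrite -[RHS](measure_bigsetU_ord mu _ _) //.
  - by move=> i; exact: measurable_qball.
  - move=> i j _ _ [x [xi xj]]; exact/val_inj/(qball_inj xi xj).
rewrite (ws_unit S) (eq_bigr (fun=> (abs varpi)%:E)); last by move=> i _; exact: muB.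
rewrite sumEFin sumr_const card_ord => -[/esym] e.
by apply: (mulfI (lt0r_neq0 q0)); rewrite divff ?lt0r_neq0// mulr_natl.
Qed.

Lemma abs_primeV (n : int) : abs (varpi ^ (- n)) = (q%:R ^ n)%R.
Proof. by rewrite (uabsXz A) abs_prime exprz_inv opprK. Qed.

Lemma mu_qball n k : mu (qball n k) = ((q%:R : R) ^ (- n))%:E.
Proof.
pose D : set (borel K) := qball 0 0.
have mD : measurable D by exact: measurable_qball.
have -> : qball n k = (fun x => varpi ^ (- n) * x + - un k)%R @^-1` D.
  apply/seteqP; split => x; rewrite /qball /D /qball /= oppr0 expr0z mul1r u_at0 ?subr0//.
rewrite mu_affine_preimage ?expfz_neq0// abs_primeV invr_expz.
have -> : D = integer_ring abs.
  by apply/seteqP; split => x; rewrite /D /qball /= oppr0 expr0z mul1r u_at0 subr0.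
by rewrite (ws_unit S) mule1.
Qed.

Lemma qexpz_gt0 (n : int) : (0 < (q%:R : R) ^ n)%R.
Proof. by rewrite exprz_gt0// ltr0n (ws_q_gt0 S). Qed.

Lemma qball_basis (O : set K) x : open O -> O x ->
  exists n : nat, forall m k : nat, (n <= m)%N -> qball m k x -> qball m k `<=` O.
Proof.
move=> oO Ox; have : nbhs 0%R [set y | O (x + y)%R].
  apply: (@continuous_addl K x 0%R); rewrite addr0.
  exact: open_nbhs_nbhs.
move=> /(uabs_nbhs0 A)[e e0 eO].
have [n ne] := prime_exp_lt S e0; exists n => m k nm xk y yk.
rewrite -(subrK x y) addrC; apply: eO; apply: le_trans (ltW ne).
have : (abs (varpi ^ (- m%:Z) * (y - x)) <= 1)%R.
  have -> : (varpi ^ (- m%:Z) * (y - x) =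
      (varpi ^ (- m%:Z) * y - un k) - (varpi ^ (- m%:Z) * x - un k))%R.
    by move: (varpi ^ (- m%:Z)) => t; ring.
  exact: (uabsB A).
rewrite (uabsM A) (uabsXz A) -invr_expz mulrC ler_pdivrMr; last first.
  by rewrite exprz_gt0// (uabs_gt0 A).
rewrite mul1r => /le_trans; apply; rewrite (uabsX A) -exprnP.
by rewrite ler_wiXn2l// ?(uabs_ge0 A)// ltW// (abs_prime_lt1 S).
Qed.

(** * Functions with the same integrals over the balls *)

(** The balls that avoid 0 suffice to generate the Borel sets, once the null set
    {0} is added. It is on these balls that the functions met below have finite
    integrals. *)
Let pi_sys : set (set (borel K)) :=
  [set B | [\/ B = set0, B = [set 0%R] |
    exists (n : int) (k : nat), (0 < k)%N /\ B = qball n k]].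

Let pi_sysI : setI_closed pi_sys.
Proof.
move=> B C [->|->|[n [k [k0 ->]]]]; first by move=> _; constructor 1; rewrite set0I.
  move=> [->|->|[m [l [l0 ->]]]].
  - by constructor 1; rewrite setI0.
  - by constructor 2; rewrite setIid.
  - constructor 1; rewrite -subset0 => x [-> /qball0 l00].
    by rewrite l00 in l0.
move=> [->|->|[m [l [l0 ->]]]].
- by constructor 1; rewrite setI0.
- constructor 1; rewrite -subset0 => x [/[swap] -> /qball0 k00].
  by rewrite k00 in k0.
have wl (n1 m1 : int) (k1 l1 : nat) : (n1 <= m1)%R -> (0 < l1)%N ->
    pi_sys (qball n1 k1 `&` qball m1 l1).
  move=> nm l10; have [j jE] : exists j : nat, m1 = (n1 + j%:Z)%R.
    by exists `|m1 - n1|%N; rewrite gez0_abs ?subr_ge0// addrCA subrr addr0.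
  have [[x [xk xl]]|h] := pselect (qball n1 k1 `&` qball m1 l1 !=set0).
    constructor 3; exists m1, l1; split => //; apply/setIidr => y yl.
    rewrite jE in xl yl; rewrite (qball_inj xk (qball_parent xl)).
    exact: qball_parent.
  by constructor 1; rewrite -subset0 => x xkl; apply: h; exists x.
have [nm|/ltW mn] := leP n m; first exact: wl.
by rewrite setIC; exact: wl.
Qed.

(** An open set is the union of the countably many balls inside it that avoid
    0, and of {0} if it contains 0. *)
Let pi_sys_gen : @measurable _ (borel K) = <<s pi_sys >>.
Proof.
apply/seteqP; split; last first.
  apply: smallest_sub; first exact: sigma_algebra_measurable.
  move=> B [->|->|[n [k [_ ->]]]]; first exact: measurable0.
    by apply: borel_closed; exact: (local_field_closed1 (ws_local S)).
  exact: measurable_qball.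
apply: smallest_sub; first exact: smallest_sigma_algebra.
move=> O oO.
pose G (nk : nat * nat) : set (borel K) := if nk.2 == 0%N then set0 else
  if pselect (qball nk.1 nk.2 `<=` O) then qball nk.1 nk.2 else set0.
pose H i := if i is i'.+1 then oapp G set0 (unpickle i')
  else if pselect (O 0%R) then [set 0%R] else set0.
have -> : O = \bigcup_i H i.
  apply/seteqP; split => x.
    move=> Ox; have [x0|/eqP x0] := pselect (x = 0%R).
      by exists 0%N => //; rewrite /H; case: pselect; rewrite -x0.
    have oO' : open (O `&` ~` [set 0%R]).
      apply: openI => //; apply: closed_openC.
      exact: (local_field_closed1 (ws_local S)).
    have [n nO] := qball_basis oO' (conj Ox (elimN eqP x0)).
    have [k xk] := qball_cover n x; have kO := nO n k (leqnn n) xk.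
    exists (pickle (n, k)).+1 => //; rewrite /H pickleK /= /G /=.
    have -> : (k == 0)%N = false.
      by apply/eqP => k0; have [_] := kO 0%R ((qball0 n k).2 k0); apply.
    by case: pselect => // -[] y /kO[].
  case=> -[|i] _; rewrite /H /=; first by case: pselect => // O0 ->.
  case: (unpickle i) => //= -[n k]; rewrite /G /=; case: ifP => // _.
  by case: pselect => // h; exact: h.
apply: sigma_algebra_bigcup => -[|i]; rewrite /H.
  by case: (pselect (O 0%R)) => O0; apply: sub_sigma_algebra; [constructor 2|constructor 1].
case: (unpickle i) => [[n k]|]/=; last by apply: sub_sigma_algebra; constructor 1.
rewrite /G /=; have [k0|] := eqVneq k 0%N; first by apply: sub_sigma_algebra; constructor 1.
rewrite -lt0n => k0.
case: (pselect (qball n k `<=` O)) => nkO; apply: sub_sigma_algebra; last by constructor 1.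
by constructor 3; exists n, k.
Qed.

Lemma mu_set0 : mu [set 0%R : K] = 0.
Proof.
apply/eqP; rewrite eq_le measure_ge0 andbT; apply/lee_addgt0Pr => e e0.
have [n ne] := prime_exp_lt S e0; rewrite add0e.
apply: (@le_trans _ _ (mu (qball n 0))).
  apply: le_measure; rewrite ?inE.
  - by apply: borel_closed; exact: (local_field_closed1 (ws_local S)).
  - exact: measurable_qball.
  - by move=> _ ->; exact/qball0.
rewrite mu_qball lee_fin; apply: le_trans (ltW ne).
by rewrite (uabsX A) abs_prime exprVn -exprnN.
Qed.

Let punctured i : set (borel K) := if i is i'.+1 then
  oapp (fun nk : nat * nat => if nk.2 == 0%N then set0 else qball nk.1 nk.2) set0
    (unpickle i') else [set 0%R].

Let punctured_cover : \bigcup_i punctured i = setT.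
Proof.
apply/seteqP; split => // x _; have [x0|/eqP x0] := pselect (x = 0%R).
  by exists 0%N.
have oO : open (~` [set 0%R : K]).
  by apply: closed_openC; exact: (local_field_closed1 (ws_local S)).
have [n nO] := qball_basis oO (elimN eqP x0).
have [k xk] := qball_cover n x; have kO := nO n k (leqnn n) xk.
exists (pickle (n, k)).+1 => //; rewrite /punctured pickleK /=.
by case: eqP => // k0; case: (kO 0%R) => //; exact/qball0.
Qed.

Let punctured_pi i : pi_sys (punctured i).
Proof.
case: i => [|i]; first by constructor 2.
rewrite /punctured; case: unpickle => [[n k]|]/=; last by constructor 1.
have [k0|] := eqVneq k 0%N; first by constructor 1.
by rewrite -lt0n => k0; constructor 3; exists n, k.
Qed.

Let punctured_measurable i : measurable (punctured i).
Proof. by rewrite pi_sys_gen; apply: sub_sigma_algebra. Qed.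

(** Both functions are densities of measures that agree on a pi-system and
    are finite on a countable cover taken from it. *)
Lemma qball_integral_unique (f g : borel K -> \bar R) :
  measurable_fun setT f -> measurable_fun setT g ->
  (forall x, 0 <= f x) -> (forall x, 0 <= g x) ->
  (forall (n : int) k, (0 < k)%N ->
    \int[mu]_(x in qball n k) f x = \int[mu]_(x in qball n k) g x) ->
  (forall (n : int) k, (0 < k)%N -> \int[mu]_(x in qball n k) f x < +oo) ->
  {ae mu, forall x, f x = g x}.
Proof.
move=> mf mg f0 g0 fg foo.
have null h : measurable_fun setT h -> \int[mu]_(x in [set 0%R]) h x = 0.
  move=> mh; apply: null_set_integral; last exact: mu_set0.
  - by apply: borel_closed; exact: (local_field_closed1 (ws_local S)).
  - exact: measurable_funTS.
have eqpi B : pi_sys B -> \int[mu]_(x in B) f x = \int[mu]_(x in B) g x.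
  move=> [->|->|[n [k [k0 ->]]]]; first by rewrite !integral_set0.
    by rewrite !null.
  exact: fg.
have piloo B : pi_sys B -> \int[mu]_(x in B) f x < +oo.
  by move=> [->|->|[n [k [k0 ->]]]]; rewrite ?integral_set0 ?null// foo.
have eqm B : measurable B -> \int[mu]_(x in B) f x = \int[mu]_(x in B) g x.
  move=> mB.
  have := measure_unique pi_sys punctured pi_sys_gen pi_sysI punctured_pi
    punctured_cover (density_measure mu mf f0) (density_measure mu mg g0).
  by apply => // i; exact/piloo/punctured_pi.
have aei i : ae_eq mu (punctured i) f g.
  apply: integral_ae_eq => //; last by move=> B _; exact: eqm.
  - apply/integrableP; split; first exact: measurable_funTS.
    under eq_integral do rewrite gee0_abs//.
    exact: piloo.
  - exact: measurable_funTS.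
have : mu.-negligible (\bigcup_i ~` [set x | punctured i x -> f x = g x]).
  by apply: negligible_bigcup => i; exact: aei.
apply: negligibleS => x /= nfg.
have [i _ xi] : (\bigcup_i punctured i) x by rewrite punctured_cover.
by exists i => //= h; exact/nfg/h.
Qed.
End Balls.

(** * Square-integrable complex functions *)

Section SqMod.
Context {R : realType}.
Implicit Types (x y z : R[i]) (t : R).

Lemma sqmod_ge0 z : 0 <= sqmod z.
Proof. by rewrite addr_ge0// sqr_ge0. Qed.

Lemma mulr_conjc z : z * z^* = (sqmod z)%:C.
Proof.
case: z => a b; apply/eqP; rewrite eq_complex /sqmod /=.
by apply/andP; split; apply/eqP; ring.
Qed.

Lemma sqmodM x y : sqmod (x * y) = sqmod x * sqmod y.
Proof. by case: x => a b; case: y => c d; rewrite /sqmod /=; ring. Qed.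

Lemma sqmod_conj z : sqmod z^* = sqmod z.
Proof. by case: z => a b; rewrite /sqmod /= sqrrN. Qed.

Lemma sqmodN z : sqmod (- z) = sqmod z.
Proof. by case: z => a b; rewrite /sqmod /= !sqrrN. Qed.

Lemma sqmod_real t : sqmod t%:C = t ^+ 2.
Proof. by rewrite /sqmod /= expr0n /= addr0. Qed.

Lemma sqmod0 : sqmod (0 : R[i]) = 0.
Proof. by rewrite /sqmod /= expr0n /= addr0. Qed.

Lemma sqmod1 : sqmod (1 : R[i]) = 1.
Proof. by rewrite /sqmod /= expr0n expr1n /= addr0. Qed.

Lemma sqmod_norm1 z : `|z| = 1 -> sqmod z = 1.
Proof.
case: z => a b; rewrite normc_def => -[/(congr1 (fun t => t ^+ 2))].
by rewrite sqr_sqrtr ?addr_ge0 ?sqr_ge0// expr1n.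
Qed.

Lemma sqmod_eq0 z : sqmod z = 0 -> z = 0.
Proof.
case: z => a b /eqP; rewrite /sqmod /= paddr_eq0 ?sqr_ge0// !sqrf_eq0.
by move=> /andP[/eqP -> /eqP ->].
Qed.

Lemma sqmodD_weighted t x y : 0 < t ->
  sqmod (x + y) <= (1 + t^-1) * sqmod x + (1 + t) * sqmod y.
Proof.
case: x => a b; case: y => c d t0; rewrite /sqmod /= -(ler_pM2l t0) -subr_ge0.
have -> : t * ((1 + t^-1) * (a ^+ 2 + b ^+ 2) + (1 + t) * (c ^+ 2 + d ^+ 2)) -
    t * ((a + c) ^+ 2 + (b + d) ^+ 2) = (a - t * c) ^+ 2 + (b - t * d) ^+ 2.
  by field; rewrite lt0r_neq0.
by rewrite addr_ge0 ?sqr_ge0.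
Qed.

Lemma sqmodD_le x y : sqmod (x + y) <= 2 * sqmod x + 2 * sqmod y.
Proof. by have := @sqmodD_weighted 1 x y ltr01; rewrite invr1. Qed.

(** The Cauchy-Schwarz inequality against the constant family. *)
Lemma sqmod_sum_le n (z : nat -> R[i]) :
  sqmod (\sum_(i < n) z i) <= n%:R * \sum_(i < n) sqmod (z i).
Proof.
elim: n => [|n ih]; first by rewrite !big_ord0 sqmod0 mulr0.
have [->|n0] := posnP n; first by rewrite !big_ord1 mul1r.
rewrite !big_ord_recr /=; have n0' : (0 : R) < n%:R by rewrite ltr0n.
apply: le_trans (sqmodD_weighted _ _ n0') _.
rewrite [leRHS]mulrDr; apply: lerD; last by rewrite addrC natr1.
have -> : 1 + n%:R^-1 = n.+1%:R * n%:R^-1 :> R.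
  by rewrite -natr1; field; rewrite lt0r_neq0.
rewrite -mulrA ler_wpM2l ?ler0n//.
by rewrite ler_pdivrMl.
Qed.

Lemma Re_mulc_le x y : `|complex.Re (x * y)| <= sqmod x + sqmod y.
Proof.
case: x => a b; case: y => c d; rewrite /sqmod /= ler_norml.
have h1 := sqr_ge0 (a + c); have h2 := sqr_ge0 (a - c).
have h3 := sqr_ge0 (b + d); have h4 := sqr_ge0 (b - d).
have h5 := sqr_ge0 a; have h6 := sqr_ge0 b; have h7 := sqr_ge0 c; have h8 := sqr_ge0 d.
by apply/andP; split; nra.
Qed.

Lemma Im_mulc_le x y : `|complex.Im (x * y)| <= sqmod x + sqmod y.
Proof.
case: x => a b; case: y => c d; rewrite /sqmod /= ler_norml.
have h1 := sqr_ge0 (a + d); have h2 := sqr_ge0 (a - d).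
have h3 := sqr_ge0 (b + c); have h4 := sqr_ge0 (b - c).
have h5 := sqr_ge0 a; have h6 := sqr_ge0 b; have h7 := sqr_ge0 c; have h8 := sqr_ge0 d.
by apply/andP; split; nra.
Qed.

Lemma ReM x y : complex.Re (x * y) =
  complex.Re x * complex.Re y - complex.Im x * complex.Im y.
Proof. by case: x; case: y. Qed.
Lemma ImM x y : complex.Im (x * y) =
  complex.Re x * complex.Im y + complex.Im x * complex.Re y.
Proof. by case: x; case: y. Qed.
Lemma ReD x y : complex.Re (x + y) = complex.Re x + complex.Re y.
Proof. by case: x; case: y. Qed.
Lemma ImD x y : complex.Im (x + y) = complex.Im x + complex.Im y.
Proof. by case: x; case: y. Qed.
Lemma Re_conjc x : complex.Re x^* = complex.Re x.
Proof. by case: x. Qed.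
Lemma Im_conjc x : complex.Im x^* = - complex.Im x.
Proof. by case: x. Qed.
Lemma normRe_le x : `|complex.Re x| <= Num.sqrt (sqmod x).
Proof. by rewrite -sqrtr_sqr ler_wsqrtr// lerDl sqr_ge0. Qed.
Lemma normIm_le x : `|complex.Im x| <= Num.sqrt (sqmod x).
Proof. by rewrite -sqrtr_sqr ler_wsqrtr// lerDr sqr_ge0. Qed.
End SqMod.

Section ComplexIntegral.
Context {R : realType} {K : topologicalFieldType}.
Variable mu : {measure set (borel K) -> \bar R}.
Implicit Types (f g h : K -> R[i]) (a : R[i]).

Lemma cmeasurableD f g : cmeasurable f -> cmeasurable g ->
  cmeasurable (fun x => f x + g x).
Proof.
move=> [f1 f2] [g1 g2]; split.
  under eq_fun do rewrite ReD; exact: measurable_funD.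
under eq_fun do rewrite ImD; exact: measurable_funD.
Qed.

Lemma cmeasurableM f g : cmeasurable f -> cmeasurable g ->
  cmeasurable (fun x => f x * g x).
Proof.
move=> [f1 f2] [g1 g2]; split.
  under eq_fun do rewrite ReM.
  by apply: measurable_funB; exact: measurable_funM.
under eq_fun do rewrite ImM.
by apply: measurable_funD; exact: measurable_funM.
Qed.

Lemma cmeasurable_cst a : cmeasurable (cst a : K -> R[i]).
Proof. by split; exact: measurable_cst. Qed.

Lemma cmeasurableZ a f : cmeasurable f -> cmeasurable (fun x => a * f x).
Proof. by move=> mf; apply: cmeasurableM => //; exact: cmeasurable_cst. Qed.

Lemma cmeasurable_conj f : cmeasurable f -> cmeasurable (fun x => (f x)^*).
Proof.
move=> [f1 f2]; split; first by under eq_fun do rewrite Re_conjc.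
by under eq_fun do rewrite Im_conjc; exact: measurable_funN.
Qed.

Lemma cmeasurable_sum (I : Type) (s : seq I) (f : I -> K -> R[i]) :
  (forall i, cmeasurable (f i)) -> cmeasurable (fun x => \sum_(i <- s) f i x).
Proof.
move=> mf; elim: s => [|i s ih].
  by under eq_fun do rewrite big_nil; exact: cmeasurable_cst.
by under eq_fun do rewrite big_cons; exact: cmeasurableD.
Qed.

Lemma cmeasurable_comp (T : borel K -> borel K) f :
  measurable_fun [set: borel K] T -> cmeasurable f -> cmeasurable (f \o T).
Proof.
move=> mT [f1 f2]; split.
  exact: (@measurableT_comp _ _ _ _ _ _ (fun x : borel K => complex.Re (f x))).
exact: (@measurableT_comp _ _ _ _ _ _ (fun x : borel K => complex.Im (f x))).
Qed.

Lemma cmeasurable_sqmod f : cmeasurable f ->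
  measurable_fun [set: borel K] (fun x : borel K => sqmod (f x)).
Proof. by move=> [f1 f2]; apply: measurable_funD; exact: measurable_funX. Qed.

Lemma cmeasurable_Esqmod f : cmeasurable f ->
  measurable_fun [set: borel K] (fun x : borel K => (sqmod (f x))%:E).
Proof. by move=> mf; apply/measurable_EFinP; exact: cmeasurable_sqmod. Qed.

Definition cindic (D : set K) : K -> R[i] := fun x => (\1_D x)%:C.

Lemma conj_cindic (D : set K) x :
  Num.conj (cindic D x : R[i]) = cindic D x.
Proof. exact: conjc_real. Qed.

Lemma cindic_idem (D : set K) x :
  cindic D x * cindic D x = cindic D x :> R[i].
Proof. by rewrite /cindic indicE -rmorphM -natrM mulnb andbb. Qed.

Lemma cmeasurable_indic (D : set K) : measurable (D : set (borel K)) ->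
  cmeasurable (cindic D).
Proof. by move=> mD; split => //=; exact: measurable_indic. Qed.

Definition cintegrable f :=
  mu.-integrable [set: borel K] (EFin \o (fun x : borel K => complex.Re (f x))) /\
  mu.-integrable [set: borel K] (EFin \o (fun x : borel K => complex.Im (f x))).

Lemma cintegrable_le f (b : borel K -> \bar R) : cmeasurable f ->
  mu.-integrable [set: borel K] b ->
  (forall x, ((`|complex.Re (f x)|)%:E <= b x)%E) ->
  (forall x, ((`|complex.Im (f x)|)%:E <= b x)%E) -> cintegrable f.
Proof.
move=> [f1 f2] ib h1 h2; split; apply: (le_integrable _ _ _ ib) => //.
- exact/measurable_EFinP.
- move=> x _ /=; apply: le_trans (h1 x) _; exact: lee_abs.
- exact/measurable_EFinP.
- move=> x _ /=; apply: le_trans (h2 x) _; exact: lee_abs.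
Qed.

Lemma cintegrableD f g : cintegrable f -> cintegrable g ->
  cintegrable (fun x => f x + g x).
Proof.
move=> [f1 f2] [g1 g2]; split.
  under [EFin \o _]eq_fun do rewrite /= ReD EFinD; exact: integrableD.
under [EFin \o _]eq_fun do rewrite /= ImD EFinD; exact: integrableD.
Qed.

Lemma cintegralD f g : cintegrable f -> cintegrable g ->
  cintegral mu (fun x => f x + g x) = cintegral mu f + cintegral mu g.
Proof.
move=> [f1 f2] [g1 g2].
apply/eqP; rewrite eq_complex /=; apply/andP; split; apply/eqP.
  by under eq_Rintegral do rewrite ReD; rewrite RintegralD.
by under eq_Rintegral do rewrite ImD; rewrite RintegralD.
Qed.

Lemma cintegral_conj f : cintegrable f ->
  cintegral mu (fun x => (f x)^*) = (cintegral mu f)^*.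
Proof.
move=> [f1 f2]; rewrite /cintegral /=; congr (_ +i* _).
  by apply: eq_Rintegral => x _; rewrite Re_conjc.
rewrite -mulN1r -RintegralZl//.
by apply: eq_Rintegral => x _; rewrite Im_conjc mulN1r.
Qed.

Lemma cintegrableZ a f : cintegrable f -> cintegrable (fun x => a * f x).
Proof.
move=> [f1 f2]; split.
  under [EFin \o _]eq_fun do rewrite /= ReM EFinB !EFinM.
  by apply: integrableB => //; exact: integrableZl.
under [EFin \o _]eq_fun do rewrite /= ImM EFinD !EFinM.
by apply: integrableD => //; exact: integrableZl.
Qed.

Lemma cintegralZ a f : cintegrable f ->
  cintegral mu (fun x => a * f x) = a * cintegral mu f.
Proof.
move=> [f1 f2]; rewrite /cintegral; case: a => a b /=; congr (_ +i* _).
  under eq_Rintegral do rewrite ReM; rewrite RintegralB//=.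
  - by rewrite !RintegralZl.
  - by under [EFin \o _]eq_fun do rewrite /= EFinM; exact: integrableZl.
  - by under [EFin \o _]eq_fun do rewrite /= EFinM; exact: integrableZl.
under eq_Rintegral do rewrite ImM; rewrite RintegralD//=.
- by rewrite !RintegralZl.
- by under [EFin \o _]eq_fun do rewrite /= EFinM; exact: integrableZl.
- by under [EFin \o _]eq_fun do rewrite /= EFinM; exact: integrableZl.
Qed.

Lemma cintegral_sum (I : Type) (s : seq I) (f : I -> K -> R[i]) :
  (forall i, cintegrable (f i)) ->
  cintegrable (fun x => \sum_(i <- s) f i x) /\
  cintegral mu (fun x => \sum_(i <- s) f i x) = \sum_(i <- s) cintegral mu (f i).
Proof.
move=> fi; elim: s => [|i s [ih1 ih2]].
  have -> : (fun x => \sum_(i <- [::]) f i x) = (fun=> 0).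
    by apply/funext => x; rewrite big_nil.
  split; first by split; exact: integrable0.
  by rewrite big_nil /cintegral !Rintegral_cst//= !mul0r.
have -> : (fun x => \sum_(j <- i :: s) f j x) =
    (fun x => f i x + \sum_(j <- s) f j x).
  by apply/funext => x; rewrite big_cons.
split; first exact: cintegrableD.
by rewrite cintegralD// ih2 big_cons.
Qed.

Lemma cintegral_ae f g : cmeasurable f -> cmeasurable g ->
  {ae mu, forall x : borel K, f x = g x} -> cintegral mu f = cintegral mu g.
Proof.
move=> [f1 f2] [g1 g2] fg; rewrite /cintegral /Rintegral; congr (_ +i* _).
  congr fine; apply: ae_eq_integral => //; try exact/measurable_EFinP.
  by apply: filterS fg => x -> _.
congr fine; apply: ae_eq_integral => //; try exact/measurable_EFinP.
by apply: filterS fg => x -> _.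
Qed.

(** The squared L2-norm, infinite outside L2. *)
Definition nrm2 f : \bar R := (\int[mu]_x (sqmod (f x))%:E)%E.

Lemma nrm2_ge0 f : (0 <= nrm2 f)%E.
Proof. by apply: integral_ge0 => x _; rewrite lee_fin sqmod_ge0. Qed.

Lemma nrm2_ae f g : cmeasurable f -> cmeasurable g ->
  {ae mu, forall x : borel K, f x = g x} -> nrm2 f = nrm2 g.
Proof.
move=> f1 g1 fg; apply: ae_eq_integral => //; try exact: cmeasurable_Esqmod.
by apply: filterS fg => x -> _.
Qed.

Lemma memL2_nrm2 f : memL2 mu f -> nrm2 f \is a fin_num.
Proof. by move=> [_ f2]; rewrite ge0_fin_numE// nrm2_ge0. Qed.

Lemma memL2_sqmod_integrable f : memL2 mu f ->
  mu.-integrable [set: borel K] (fun x : borel K => (sqmod (f x))%:E).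
Proof.
move=> [mf fi]; apply/integrableP; split; first exact: cmeasurable_Esqmod.
by under eq_integral do rewrite gee0_abs ?lee_fin ?sqmod_ge0//.
Qed.

Lemma memL2_le f g (b : R) : 0 <= b -> cmeasurable f -> memL2 mu g ->
  (forall x, sqmod (f x) <= b * sqmod (g x)) -> memL2 mu f.
Proof.
move=> b0 mf [mg gi] fg; split => //.
apply: (@le_lt_trans _ _ (\int[mu]_x (b%:E * (sqmod (g x))%:E))%E).
  apply: ge0_le_integral => //.
  - by move=> x _; rewrite lee_fin sqmod_ge0.
  - exact: cmeasurable_Esqmod.
  - by apply: measurable_funeM; exact: cmeasurable_Esqmod.
  - by move=> x _; rewrite -EFinM lee_fin.
rewrite ge0_integralZl//; last 2 first.
- exact: cmeasurable_Esqmod.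
- by move=> x _; rewrite lee_fin sqmod_ge0.
by rewrite lte_mul_pinfty.
Qed.

Lemma nrm2D_le f g : memL2 mu f -> memL2 mu g ->
  (nrm2 (fun x => f x + g x)%R <= 2%:E * nrm2 f + 2%:E * nrm2 g)%E.
Proof.
move=> [mf fi] [mg gi].
have mf' := cmeasurable_Esqmod mf; have mg' := cmeasurable_Esqmod mg.
rewrite /nrm2 -!ge0_integralZl// -?ge0_integralD//.
- apply: ge0_le_integral => //.
  + by move=> x _; rewrite lee_fin sqmod_ge0.
  + by apply: cmeasurable_Esqmod; exact: cmeasurableD.
  + by apply: emeasurable_funD; apply: measurable_funeM.
  + by move=> x _; rewrite -!EFinM -EFinD lee_fin sqmodD_le.
all: try by move=> x _; rewrite -?EFinM lee_fin ?mulr_ge0 ?sqmod_ge0.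
all: by apply: measurable_funeM.
Qed.

Lemma memL2D f g : memL2 mu f -> memL2 mu g -> memL2 mu (fun x => f x + g x).
Proof.
move=> fL gL; split; first by apply: cmeasurableD; [case: fL|case: gL].
apply: le_lt_trans (nrm2D_le fL gL) _.
by apply: lte_add_pinfty; rewrite lte_mul_pinfty//; [case: fL|case: gL].
Qed.

Lemma memL2M f g : (forall x, sqmod (g x) <= 1) -> cmeasurable g ->
  memL2 mu f -> memL2 mu (fun x => f x * g x).
Proof.
move=> g1 mg fL; apply: (@memL2_le _ f 1) => //.
  by apply: cmeasurableM => //; case: fL.
by move=> x; rewrite sqmodM mul1r ler_piMr ?sqmod_ge0.
Qed.

Lemma memL2Z a f : memL2 mu f -> memL2 mu (fun x => a * f x).
Proof.
move=> fL; apply: (@memL2_le _ f (sqmod a)) => //; first exact: sqmod_ge0.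
  by apply: cmeasurableZ; case: fL.
by move=> x; rewrite sqmodM.
Qed.

Lemma memL2N f : memL2 mu f -> memL2 mu (fun x => - f x).
Proof. by move=> /(memL2Z (-1)); under eq_fun do rewrite mulN1r. Qed.

Lemma memL2B f g : memL2 mu f -> memL2 mu g -> memL2 mu (fun x => f x - g x).
Proof. by move=> fL /memL2N; exact: memL2D. Qed.

Lemma memL20 : memL2 mu (fun=> 0).
Proof.
split; first exact: cmeasurable_cst.
by under eq_integral do rewrite sqmod0; rewrite integral0.
Qed.

Lemma memL2_sum (I : Type) (s : seq I) (f : I -> K -> R[i]) :
  (forall i, memL2 mu (f i)) -> memL2 mu (fun x => \sum_(i <- s) f i x).
Proof.
move=> fL; elim: s => [|i s ih].
  by under eq_fun do rewrite big_nil; exact: memL20.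
by under eq_fun do rewrite big_cons; exact: memL2D.
Qed.

Lemma nrm2Z a f : cmeasurable f ->
  nrm2 (fun x => a * f x)%R = ((sqmod a)%:E * nrm2 f)%E.
Proof.
move=> mf; rewrite /nrm2 -ge0_integralZl//.
- by apply: eq_integral => x _; rewrite sqmodM EFinM.
- exact: cmeasurable_Esqmod.
- by move=> x _; rewrite lee_fin sqmod_ge0.
- by rewrite lee_fin sqmod_ge0.
Qed.

Lemma nrm2_sum_le n (f : nat -> K -> R[i]) : (forall i, cmeasurable (f i)) ->
  (nrm2 (fun x => \sum_(i < n) f i x)%R
   <= n%:R%:E * \sum_(i < n) nrm2 (f i))%E.
Proof.
move=> mf; have mf' i := cmeasurable_Esqmod (mf i).
have m1 : measurable_fun [set: borel K]
    (fun x : borel K => (\sum_(i < n) (sqmod (f i x))%:E)%E).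
  exact: emeasurable_sum.
rewrite /nrm2 -ge0_integral_sum//; last first.
  by move=> i x _; rewrite lee_fin sqmod_ge0.
rewrite -ge0_integralZl//; last first.
  by move=> x _; apply: sume_ge0 => i _; rewrite lee_fin sqmod_ge0.
apply: ge0_le_integral => //.
- by move=> x _; rewrite lee_fin sqmod_ge0.
- by apply: cmeasurable_Esqmod; exact: cmeasurable_sum.
- exact: measurable_funeM.
- move=> x _; rewrite sumEFin -EFinM lee_fin.
  exact: (sqmod_sum_le n (fun i => f i x)).
Qed.

(** * The inner product *)

Lemma memL2_cintegrable f g : memL2 mu f -> memL2 mu g ->
  cintegrable (fun x => f x * (g x)^*).
Proof.
move=> fL gL; have fi := memL2_sqmod_integrable fL.
have gi := memL2_sqmod_integrable gL.
apply: (cintegrable_le _ (integrableD measurableT fi gi)).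
- apply: cmeasurableM; first by case: fL.
  by apply: cmeasurable_conj; case: gL.
- by move=> x; rewrite -EFinD lee_fin -(sqmod_conj (g x)) Re_mulc_le.
- by move=> x; rewrite -EFinD lee_fin -(sqmod_conj (g x)) Im_mulc_le.
Qed.

Lemma inner_conj f g : memL2 mu f -> memL2 mu g -> inner mu g f = (inner mu f g)^*.
Proof.
move=> fL gL; rewrite /inner -cintegral_conj; last exact: memL2_cintegrable.
by congr cintegral; apply/funext => x; rewrite rmorphM /= conjcK mulrC.
Qed.

Lemma innerDl f g h : memL2 mu f -> memL2 mu g -> memL2 mu h ->
  inner mu (fun x => f x + g x) h = inner mu f h + inner mu g h.
Proof.
move=> fL gL hL; rewrite /inner -cintegralD; [|exact: memL2_cintegrable..].
by congr cintegral; apply/funext => x; rewrite mulrDl.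
Qed.

Lemma innerZl a f h : memL2 mu f -> memL2 mu h ->
  inner mu (fun x => a * f x) h = a * inner mu f h.
Proof.
move=> fL hL; rewrite /inner -cintegralZ; last exact: memL2_cintegrable.
by congr cintegral; apply/funext => x; rewrite mulrA.
Qed.

Lemma innerBl f g h : memL2 mu f -> memL2 mu g -> memL2 mu h ->
  inner mu (fun x => f x - g x) h = inner mu f h - inner mu g h.
Proof.
move=> fL gL hL; rewrite innerDl//; last exact: memL2N.
have -> : (fun x => - g x) = (fun x => -1 * g x).
  by apply/funext => x; rewrite mulN1r.
by rewrite innerZl// mulN1r.
Qed.

Lemma inner_suml (I : Type) (s : seq I) (f : I -> K -> R[i]) h :
  (forall i, memL2 mu (f i)) -> memL2 mu h ->
  inner mu (fun x => \sum_(i <- s) f i x) h = \sum_(i <- s) inner mu (f i) h.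
Proof.
move=> fL hL; have := cintegral_sum s (fun i => memL2_cintegrable (fL i) hL).
move=> [_ <-]; congr cintegral; apply/funext => x; exact: mulr_suml.
Qed.

Lemma inner_nrm2 f : memL2 mu f -> inner mu f f = (fine (nrm2 f))%:C.
Proof.
move=> fL; rewrite /inner /cintegral /nrm2; congr (_ +i* _).
  by apply: eq_Rintegral => x _; rewrite mulr_conjc.
transitivity (\int[mu]_x (0 : R)).
  by apply: eq_Rintegral => x _; rewrite mulr_conjc.
by rewrite Rintegral_cst// mul0r.
Qed.

Lemma inner_ae f f' g g' : memL2 mu f -> memL2 mu f' -> memL2 mu g -> memL2 mu g' ->
  {ae mu, forall x : borel K, f x = f' x} ->
  {ae mu, forall x : borel K, g x = g' x} -> inner mu f g = inner mu f' g'.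
Proof.
move=> [f1 _] [f2 _] [g1 _] [g2 _] ff gg; apply: cintegral_ae.
- by apply: cmeasurableM => //; exact: cmeasurable_conj.
- by apply: cmeasurableM => //; exact: cmeasurable_conj.
by apply: filterS2 ff gg => x -> ->.
Qed.
End ComplexIntegral.

(** * Orthonormal systems and closed spans *)

Section Orthonormal.
Context {R : realType} {K : topologicalFieldType}.
Variable mu : {measure set (borel K) -> \bar R}.
Implicit Types (f g h : K -> R[i]) (a : R[i]).

Lemma realc_inj (x y : R) : x%:C = y%:C -> x = y.
Proof. by case. Qed.

Lemma nrm2_pythagoras f g : memL2 mu f -> memL2 mu g -> inner mu f g = 0 ->
  nrm2 mu (fun x => f x + g x) = (nrm2 mu f + nrm2 mu g)%E.
Proof.
move=> fL gL fg0; have fgL := memL2D fL gL.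
rewrite -(fineK (memL2_nrm2 fgL)) -(fineK (memL2_nrm2 fL)) -(fineK (memL2_nrm2 gL)).
rewrite -EFinD; congr EFin; apply: realc_inj.
rewrite rmorphD /= -!inner_nrm2// innerDl// (inner_conj fgL fL).
rewrite (inner_conj fgL gL) !innerDl// fg0 (inner_conj fL gL) fg0 conjc0.
by rewrite addr0 add0r !inner_nrm2// !conjc_real.
Qed.

Variables (I : eqType) (e : I -> K -> R[i]).
Hypotheses (eL : forall i, memL2 mu (e i))
           (eON : forall i j, inner mu (e i) (e j) = (i == j)%:R).

(** When e is orthonormal and T has no repetition, this is the orthogonal
    projection of f on the span of the e t for t in T. *)
Definition onproj (T : seq I) f : K -> R[i] :=
  fun x => \sum_(t <- T) inner mu f (e t) * e t x.

Lemma memL2_comb (s : seq (R[i] * I)) :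
  memL2 mu (fun x => \sum_(t <- s) t.1 * e t.2 x).
Proof. by apply: memL2_sum => t; exact: memL2Z. Qed.

Lemma memL2_onproj T f : memL2 mu (onproj T f).
Proof. by apply: memL2_sum => t; exact: memL2Z. Qed.

Lemma inner_onproj T f t : uniq T -> t \in T ->
  inner mu (onproj T f) (e t) = inner mu f (e t).
Proof.
move=> uT tT; rewrite inner_suml; [|by move=> i; exact: memL2Z|by []].
rewrite (bigD1_seq t)//= innerZl// eON eqxx mulr1 big1 ?addr0//.
by move=> i it; rewrite innerZl// eON (negbTE it) mulr0.
Qed.

Lemma inner_sub_onproj T f (s : seq (R[i] * I)) : memL2 mu f -> uniq T ->
  (forall t, t \in s -> t.2 \in T) ->
  inner mu (fun x => f x - onproj T f x) (fun x => \sum_(t <- s) t.1 * e t.2 x) = 0.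
Proof.
move=> fL uT sT; have fpL := memL2B fL (memL2_onproj T f).
rewrite (inner_conj (memL2_comb s) fpL) inner_suml//; last first.
  by move=> t; exact: memL2Z.
rewrite big_seq big1 ?conjc0// => t ts.
rewrite innerZl// (inner_conj fpL (eL t.2)) innerBl//; last exact: memL2_onproj.
by rewrite inner_onproj// ?sT// subrr conjc0 mulr0.
Qed.

Lemma nrm2_sub_onproj T f : memL2 mu f -> uniq T ->
  nrm2 mu (fun x => f x - onproj T f x) =
  (fine (nrm2 mu f) - \sum_(t <- T) sqmod (inner mu f (e t)))%:E.
Proof.
move=> fL uT; have pL := memL2_onproj T f; have fpL := memL2B fL pL.
have op0 : inner mu (fun x => f x - onproj T f x) (onproj T f) = 0.
  have := @inner_sub_onproj T f [seq (inner mu f (e t), t) | t <- T] fL uT.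
  rewrite /onproj; under [X in inner mu _ X]eq_fun do rewrite big_map.
  by apply=> t /mapP[t' t'T ->].
rewrite -(fineK (memL2_nrm2 fpL)); congr EFin; apply: realc_inj.
rewrite -inner_nrm2// [LHS](_ : _ = inner mu (fun x => f x - onproj T f x) f).
  rewrite innerBl// rmorphB /= -inner_nrm2//; congr (_ - _).
  rewrite inner_suml//; last by move=> t; exact: memL2Z.
  rewrite rmorph_sum /=; apply: eq_bigr => t _.
  by rewrite innerZl// (inner_conj fL (eL t)) mulr_conjc.
rewrite (inner_conj fpL fpL) innerBl// (inner_conj fpL pL) op0 conjc0 subr0.
by rewrite -inner_conj.
Qed.

Lemma bessel T f : memL2 mu f -> uniq T ->
  \sum_(t <- T) sqmod (inner mu f (e t)) <= fine (nrm2 mu f).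
Proof.
move=> fL uT; rewrite -subr_ge0 -lee_fin -nrm2_sub_onproj//; exact: nrm2_ge0.
Qed.

(** The error of the projection is orthogonal to the span, so Pythagoras
    applies to the difference with any other element of the span. *)
Lemma onproj_best T f (s : seq (R[i] * I)) : memL2 mu f -> uniq T ->
  (forall t, t \in s -> t.2 \in T) ->
  (nrm2 mu (fun x => f x - onproj T f x)%R <=
   nrm2 mu (fun x => f x - \sum_(t <- s) t.1 * e t.2 x)%R)%E.
Proof.
move=> fL uT sT; have pL := memL2_onproj T f; have fpL := memL2B fL pL.
pose s' := [seq (inner mu f (e t), t) | t <- T] ++ [seq (- t.1, t.2) | t <- s].
have sE : (fun x => \sum_(t <- s') t.1 * e t.2 x) =
    (fun x => onproj T f x - \sum_(t <- s) t.1 * e t.2 x).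
  apply/funext => x; rewrite /s' big_cat !big_map /=; congr (_ + _).
  by rewrite -sumrN; apply: eq_bigr => t _; rewrite mulNr.
have -> : (fun x => f x - \sum_(t <- s) t.1 * e t.2 x) =
    (fun x => (f x - onproj T f x) + \sum_(t <- s') t.1 * e t.2 x).
  apply/funext => x; have /(congr1 (fun u => u x)) /= -> := sE.
  by rewrite addrA subrK.
rewrite [leRHS]nrm2_pythagoras//.
- by rewrite leeDl// nrm2_ge0.
- exact: memL2_comb.
- apply: inner_sub_onproj => // t; rewrite mem_cat => /orP[|] /mapP[t' t'T ->]//=.
  exact: sT.
Qed.

(** * The closed span *)

Definition in_closed_span f : Prop := forall r : R, 0 < r ->
  exists s : seq (R[i] * I),
    (nrm2 mu (fun x => f x - \sum_(t <- s) t.1 * e t.2 x)%R < r%:E)%E.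

Lemma closed_span_limit f : memL2 mu f ->
  (forall r : R, 0 < r -> exists g, [/\ memL2 mu g, in_closed_span g &
     (nrm2 mu (fun x => f x - g x)%R < r%:E)%E]) -> in_closed_span f.
Proof.
move=> fL fg r r0; have r4 : 0 < r / 4 by rewrite divr_gt0.
have [g [gL gS fgr]] := fg _ r4; have [s sr] := gS _ r4; exists s.
have -> : (fun x => f x - \sum_(t <- s) t.1 * e t.2 x) =
    (fun x => (f x - g x) + (g x - \sum_(t <- s) t.1 * e t.2 x)).
  by apply/funext => x; rewrite addrA subrK.
apply: le_lt_trans (nrm2D_le _ _) _; [exact: memL2B| |].
  by apply: memL2B => //; exact: memL2_comb.
have -> : r%:E = (2%:E * (r / 4)%:E + 2%:E * (r / 4)%:E)%E.
  by rewrite -!EFinM -EFinD; congr EFin; field.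
by apply: lteD; rewrite lte_pmul2l.
Qed.

Lemma closed_span_lin a f g : memL2 mu f -> memL2 mu g ->
  in_closed_span f -> in_closed_span g -> in_closed_span (fun x => a * f x + g x).
Proof.
move=> fL gL fS gS r r0.
have a0 : 0 < 4 * (sqmod a + 1) by rewrite mulr_gt0// ltr_wpDl// sqmod_ge0.
have [s1 s1r] := fS (r / (4 * (sqmod a + 1))) (divr_gt0 r0 a0).
have r4 : 0 < r / 4 by rewrite divr_gt0.
have [s2 s2r] := gS _ r4.
exists ([seq (a * t.1, t.2) | t <- s1] ++ s2).
have -> : (fun x => a * f x + g x -
      \sum_(t <- [seq (a * t.1, t.2) | t <- s1] ++ s2) t.1 * e t.2 x) =
    (fun x => a * (f x - \sum_(t <- s1) t.1 * e t.2 x) +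
      (g x - \sum_(t <- s2) t.1 * e t.2 x)).
  apply/funext => x; rewrite big_cat big_map /= mulrBr opprD addrACA.
  congr (_ - _ + _); rewrite mulr_sumr; apply: eq_bigr => t _.
  by rewrite mulrA.
have fsL : memL2 mu (fun x => f x - \sum_(t <- s1) t.1 * e t.2 x).
  by apply: memL2B => //; exact: memL2_comb.
apply: le_lt_trans (nrm2D_le _ _) _; [exact: memL2Z| |].
  by apply: memL2B => //; exact: memL2_comb.
rewrite nrm2Z; last by case: fsL.
have -> : r%:E = ((r / 2)%:E + 2%:E * (r / 4)%:E)%E.
  by rewrite -!EFinM -EFinD; congr EFin; field.
apply: lee_ltD; [by rewrite !fin_numM// memL2_nrm2| |by rewrite lte_pmul2l].
apply: (@le_trans _ _ (2%:E * ((sqmod a + 1)%:E * (r / (4 * (sqmod a + 1)))%:E))%E).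
  rewrite lee_pmul2l//; apply: lee_pmul; rewrite ?lee_fin ?sqmod_ge0 ?nrm2_ge0//.
    by rewrite lerDl.
  exact: ltW.
rewrite -!EFinM lee_fin le_eqVlt; apply/orP; left; apply/eqP; field.
by rewrite -(mulr0 4) gt_eqF// in a0 *; rewrite ltr_wpDl// sqmod_ge0.
Qed.

Lemma closed_span0 : in_closed_span (fun=> 0).
Proof.
move=> r r0; exists [::]; rewrite /nrm2.
under eq_integral do rewrite big_nil subr0 sqmod0.
by rewrite integral0.
Qed.

Lemma closed_span_sum (J : Type) (s : seq J) (c : J -> R[i]) (f : J -> K -> R[i]) :
  (forall j, memL2 mu (f j)) -> (forall j, in_closed_span (f j)) ->
  in_closed_span (fun x => \sum_(j <- s) c j * f j x).
Proof.
move=> fL fS; elim: s => [|j s ih].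
  by under eq_fun do rewrite big_nil; exact: closed_span0.
under eq_fun do rewrite big_cons; apply: closed_span_lin => //.
by apply: memL2_sum => i; exact: memL2Z.
Qed.
End Orthonormal.

(** * Characters and affine changes of variable *)

Section Fourier.
Context {R : realType} {K : topologicalFieldType}.
Variables (mu : {measure set (borel K) -> \bar R}) (abs : K -> R) (p c : nat).
Variables (eps : 'I_c -> K) (varpi : K) (chi : K -> R[i]).
Hypothesis S : wavelet_setting mu abs p eps varpi chi.
Implicit Types (f g : K -> R[i]) (a b w : K).

Local Notation q := (p ^ c)%N.
Local Notation un := (u p eps varpi).
Local Notation qball := (qball abs p eps varpi).
Let A := ws_uabs S.
Let ch := ws_chi S.

Lemma sqmod_chi x : sqmod (chi x) = 1.
Proof. by apply: sqmod_norm1; exact: (chi_unitary ch). Qed.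

Lemma chi_periodic x y : abs (x - y) <= 1 -> chi x = chi y.
Proof.
by move=> xy; rewrite -(subrK y x) (chiD ch) (chi_integer S xy) mul1r.
Qed.

Lemma cmeasurable_chi : cmeasurable chi.
Proof.
by split; apply: (locally_constant_measurable S ltr01) => x y /chi_periodic ->.
Qed.

Lemma cmeasurable_affine f a b : cmeasurable f -> cmeasurable (fun x => f (a * x + b)).
Proof. by move=> mf; apply: cmeasurable_comp mf; exact: measurable_affine. Qed.

Lemma cmeasurable_chiM a : cmeasurable (fun x => (chi (a * x))^*).
Proof.
apply: cmeasurable_conj; have := cmeasurable_affine a 0 cmeasurable_chi.
by under eq_fun do rewrite addr0.
Qed.

Lemma sqmod_chi_conj x : sqmod (chi x)^* = 1.
Proof. by rewrite sqmod_conj sqmod_chi. Qed.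

Lemma cintegrable_affine f a b : a != 0 -> cintegrable mu f ->
  cintegrable mu (fun x => f (a * x + b)).
Proof.
move=> a0 [f1 f2]; split; first exact: (integrable_affine S b a0 f1).
exact: (integrable_affine S b a0 f2).
Qed.

Lemma cintegral_affine f a b : a != 0 -> cintegrable mu f ->
  cintegral mu (fun x => f (a * x + b)) = ((abs a)^-1)%:C * cintegral mu f.
Proof.
move=> a0 [f1 f2]; rewrite /cintegral /Rintegral.
have -> := integral_affine S b a0 f1; have -> := integral_affine S b a0 f2.
rewrite !fineM ?integrable_fin_num//=.
by apply/eqP; rewrite eq_complex /= !mul0r subr0 addr0 !eqxx.
Qed.

Lemma nrm2_affine f a b : a != 0 -> cmeasurable f ->
  nrm2 mu (fun x => f (a * x + b)) = (((abs a)^-1)%:E * nrm2 mu f)%E.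
Proof.
move=> a0 mf; rewrite /nrm2 -(ge0_integral_affine S b a0 measurableT)//.
- exact: cmeasurable_Esqmod.
- by move=> x; rewrite lee_fin sqmod_ge0.
Qed.

Lemma memL2_affine f a b : a != 0 -> memL2 mu f -> memL2 mu (fun x => f (a * x + b)).
Proof.
move=> a0 [mf fi]; split; first exact: cmeasurable_affine.
by have := nrm2_affine b a0 mf; rewrite /nrm2 => ->; rewrite lte_mul_pinfty// lee_fin invr_ge0 (uabs_ge0 A).
Qed.

Lemma measurable_sqrt_sqmod f : cmeasurable f ->
  measurable_fun [set: borel K] (fun x : borel K => (Num.sqrt (sqmod (f x)))%:E).
Proof.
move=> mf; apply/measurable_EFinP.
apply: (@measurableT_comp _ _ _ _ _ _ (@Num.sqrt R)); last exact: cmeasurable_sqmod.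
by apply: continuous_measurable_fun; exact: sqrt_continuous.
Qed.

Lemma memL1_cintegrable f : memL1 mu f -> cintegrable mu f.
Proof.
move=> [mf fi]; apply: (@cintegrable_le _ _ mu f (fun x => (Num.sqrt (sqmod (f x)))%:E)) => //.
- apply/integrableP; split; first exact: measurable_sqrt_sqmod.
  by under eq_integral do rewrite gee0_abs ?lee_fin ?sqrtr_ge0//.
- by move=> x; rewrite lee_fin normRe_le.
- by move=> x; rewrite lee_fin normIm_le.
Qed.

Lemma memL1_support f (D : set K) : measurable (D : set (borel K)) ->
  (mu D < +oo)%E -> memL2 mu f -> (forall x, ~ D x -> f x = 0) -> memL1 mu f.
Proof.
move=> mD Doo [mf fi] f0; split => //.
apply: (@le_lt_trans _ _ (\int[mu]_x ((\1_D x)%:E + (sqmod (f x))%:E))%E).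
  apply: ge0_le_integral => //.
  - exact: measurable_sqrt_sqmod.
  - apply: emeasurable_funD; last exact: cmeasurable_Esqmod.
    by apply/measurable_EFinP; exact: measurable_indic.
  - move=> x _; rewrite -EFinD lee_fin indicE; have [xD|xD] := boolP (x \in D).
      have := sqr_ge0 (Num.sqrt (sqmod (f x)) - 2^-1).
      rewrite -{3}(sqr_sqrtr (sqmod_ge0 (f x))) /=.
      by move: (Num.sqrt _) => t; nra.
    by rewrite f0 ?sqmod0 ?sqrtr0// => /mem_set; apply/negP.
have h1 (x : borel K) : [set: borel K] x -> (0 <= (\1_D x)%:E :> \bar R)%E.
  by move=> _; rewrite lee_fin indicE.
have h2 : measurable_fun [set: borel K] (fun x : borel K => (\1_D x)%:E : \bar R).
  by apply/measurable_EFinP; exact: measurable_indic.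
have h3 (x : borel K) : [set: borel K] x -> (0 <= (sqmod (f x))%:E)%E.
  by move=> _; rewrite lee_fin sqmod_ge0.
have h4 := cmeasurable_Esqmod mf.
by rewrite ge0_integralD//; apply: lte_add_pinfty => //; rewrite integral_indic// setIT.
Qed.

Lemma memL1M_chi f a : memL1 mu f -> memL1 mu (fun x => f x * (chi (a * x))^*).
Proof.
move=> [mf fi]; split; first by apply: cmeasurableM => //; exact: cmeasurable_chiM.
by under eq_integral do rewrite sqmodM sqmod_chi_conj mulr1.
Qed.

Lemma sqmod_cindic (D : set K) x : sqmod (cindic D x : R[i]) = \1_D x.
Proof. by rewrite /cindic sqmod_real indicE; case: (x \in D); rewrite ?expr1n ?expr0n. Qed.

Lemma sqmod_cindic_le1 (D : set K) x : sqmod (cindic D x : R[i]) <= 1.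
Proof. by rewrite sqmod_cindic indicE; case: (x \in D). Qed.

Lemma memL2_cindic f (D : set K) : measurable (D : set (borel K)) -> memL2 mu f ->
  memL2 mu (fun x => f x * cindic D x).
Proof.
move=> mD fL; apply: memL2M => //; first exact: sqmod_cindic_le1.
exact: cmeasurable_indic.
Qed.

Lemma nrm2_cindic f (D : set K) : measurable (D : set (borel K)) ->
  nrm2 mu (fun x => f x * cindic D x) = (\int[mu]_(x in D) (sqmod (f x))%:E)%E.
Proof.
move=> mD; rewrite [RHS]integral_mkcond; apply: eq_integral => x _.
rewrite sqmodM sqmod_cindic indicE patchE; case: ifPn => xD; first by rewrite mulr1.
by rewrite mulr0.
Qed.

(** * Truncation to bounded sets *)

(** A bounded set, used to truncate functions. The first M balls of level 0
    exhaust K as M grows. *)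
Definition qball_union (M : nat) : set K := \bigcup_(k in `I_M) qball 0 k.

Lemma measurable_qball_union M : measurable (qball_union M : set (borel K)).
Proof. by apply: bigcup_measurable => k _; exact: (measurable_qball S). Qed.

Lemma trivIset_qball (n : int) (D : set nat) : trivIset D (fun k => qball n k).
Proof. by move=> i j _ _ [x [xi xj]]; exact: (qball_inj S xi xj). Qed.

Lemma mu_qball0 k : mu (qball 0 k) = 1%E.
Proof. by rewrite (mu_qball S) oppr0 expr0z. Qed.

Lemma mu_qball_union M : (mu (qball_union M) < +oo)%E.
Proof.
rewrite /qball_union measure_fin_bigcup//; last 2 first.
- exact: trivIset_qball.
- by move=> i _; exact: (measurable_qball S).
by rewrite -fsbig_ord (eq_bigr (fun=> 1%E)) ?sumEFin ?ltry// => i _; exact: mu_qball0.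
Qed.

Lemma bigcup_qball (n : int) : \bigcup_k qball n k = [set: K].
Proof.
by apply/seteqP; split => // x _; have [k xk] := qball_cover S n x; exists k.
Qed.

Lemma ge0_integral_qballs (n : int) (f : borel K -> \bar R) :
  measurable_fun [set: borel K] f -> (forall x, 0 <= f x)%E ->
  (\int[mu]_x f x = \sum_(k <oo) \int[mu]_(x in qball n k) f x)%E.
Proof.
move=> mf f0; rewrite -(bigcup_qball n) ge0_integral_bigcup//.
- by move=> k; exact: (measurable_qball S).
- exact: measurable_funTS.
- exact: trivIset_qball.
Qed.

Lemma trunc_approx f (r : R) : memL2 mu f -> 0 < r ->
  exists M, (nrm2 mu (fun x => f x - f x * cindic (qball_union M) x)%R < r%:E)%E.
Proof.
move=> fL r0; have [mf fi] := fL.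
have mfE := cmeasurable_Esqmod mf.
have fE : nrm2 mu f = (\sum_(k <oo) \int[mu]_(x in qball 0 k) (sqmod (f x))%:E)%E.
  by apply: ge0_integral_qballs => // x; rewrite lee_fin sqmod_ge0.
have i0 k : (0 <= \int[mu]_(x in qball 0 k) (sqmod (f x))%:E)%E.
  by apply: integral_ge0 => x _; rewrite lee_fin sqmod_ge0.
have [|M hM] := nneseries_tail i0 _ r0; first by rewrite -fE.
exists M; have mU := measurable_qball_union M.
have e1 : nrm2 mu f = (nrm2 mu (fun x => f x * cindic (qball_union M) x)%R +
    nrm2 mu (fun x => f x - f x * cindic (qball_union M) x)%R)%E.
  have fU := memL2_cindic mU fL; have fU' := memL2B fL fU.
  rewrite /nrm2 -ge0_integralD//.
  - apply: eq_integral => x _; rewrite -EFinD /cindic indicE; congr EFin.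
    by case: (x \in _); rewrite ?mulr1 ?mulr0 ?subrr ?subr0 sqmod0 ?addr0 ?add0r.
  - by move=> x _; rewrite lee_fin sqmod_ge0.
  - by apply: cmeasurable_Esqmod; case: fU.
  - by move=> x _; rewrite lee_fin sqmod_ge0.
  - by apply: cmeasurable_Esqmod; case: fU'.
have e2 : nrm2 mu (fun x => f x * cindic (qball_union M) x) =
    (\sum_(0 <= k < M) \int[mu]_(x in qball 0 k) (sqmod (f x))%:E)%E.
  rewrite nrm2_cindic// /qball_union bigcup_mkord big_mkord.
  apply: (@ge0_integral_bigsetU _ _ _ mu _ (fun i : 'I_M => qball 0 i)).
  - by move=> i; exact: (measurable_qball S).
  - exact: index_enum_uniq.
  - by move=> i j _ _ [x [xi xj]]; exact/val_inj/(qball_inj S xi xj).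
  - exact: measurable_funTS.
  - by move=> x _; rewrite lee_fin sqmod_ge0.
have fin1 : nrm2 mu (fun x => f x * cindic (qball_union M) x) \is a fin_num.
  exact/memL2_nrm2/memL2_cindic.
by move: hM; rewrite -fE e1 -e2 lteD2lE.
Qed.

(** * Elementary properties of the Fourier transform *)

Variable F : (K -> R[i]) -> (K -> R[i]).
Hypothesis FF : fourier_transform mu chi F.

Lemma nrm2_fourier f : memL2 mu f -> nrm2 mu (F f) = nrm2 mu f.
Proof.
move=> fL; have FL := fourier_L2 FF fL.
rewrite -(fineK (memL2_nrm2 FL)) -(fineK (memL2_nrm2 fL)); congr EFin.
by apply: realc_inj; rewrite -!inner_nrm2// (fourier_isometry FF).
Qed.

Lemma nrm2_eq0_ae f : cmeasurable f -> nrm2 mu f = 0%E ->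
  {ae mu, forall x : borel K, f x = 0}.
Proof.
move=> mf f0; have mfE := cmeasurable_Esqmod mf.
have /(ae_eq_integral_abs mu measurableT mfE) : (\int[mu]_x `|(sqmod (f x))%:E| = 0)%E.
  by rewrite -[RHS]f0; apply: eq_integral => x _; rewrite gee0_abs// lee_fin sqmod_ge0.
apply: filterS => x /(_ I) [] /=; exact: sqmod_eq0.
Qed.

Lemma fourierB f g : memL2 mu f -> memL2 mu g ->
  {ae mu, forall x : borel K, F (fun x => f x - g x) x = F f x - F g x}.
Proof.
move=> fL gL; have := fourier_linear FF (-1) gL fL.
have -> : (fun x => -1 * g x + f x) = (fun x => f x - g x).
  by apply/funext => x; rewrite mulN1r addrC.
by apply: filterS => x ->; rewrite mulN1r addrC.
Qed.

Lemma nrm2_fourierB f g : memL2 mu f -> memL2 mu g ->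
  nrm2 mu (fun x => F f x - F g x) = nrm2 mu (fun x => f x - g x).
Proof.
move=> fL gL; have fgL := memL2B fL gL; rewrite -(nrm2_fourier fgL).
have Ff := fourier_L2 FF fL; have Fg := fourier_L2 FF gL.
apply: nrm2_ae.
- by have [] := memL2B Ff Fg.
- by have [] := fourier_L2 FF fgL.
- by apply: filterS (fourierB fL gL) => x ->.
Qed.

Lemma fourier_comb (I : Type) (s : seq (R[i] * I)) (e : I -> K -> R[i]) :
  (forall i, memL2 mu (e i)) ->
  {ae mu, forall x : borel K, F (fun x => \sum_(t <- s) t.1 * e t.2 x) x =
    \sum_(t <- s) t.1 * F (e t.2) x}.
Proof.
move=> eL; elim: s => [|t s ih].
  have := fourier_linear FF (-1) (memL20 mu) (memL20 mu).
  have -> : (fun x : K => -1 * 0 + 0 : R[i]) = (fun=> 0).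
    by apply/funext => x; rewrite mulr0 addr0.
  have -> : (fun x => \sum_(t <- [::]) t.1 * e t.2 x) = (fun=> 0).
    by apply/funext => x; rewrite big_nil.
  by apply: filterS => x ->; rewrite big_nil mulN1r addNr.
have sL : memL2 mu (fun x => \sum_(t <- s) t.1 * e t.2 x).
  by apply: memL2_sum => i; exact: memL2Z.
have -> : (fun x => \sum_(i <- t :: s) i.1 * e i.2 x) =
    (fun x => t.1 * e t.2 x + \sum_(i <- s) i.1 * e i.2 x).
  by apply/funext => x; rewrite big_cons.
apply: filterS2 ih (fourier_linear FF t.1 (eL t.2) sL) => x -> ->.
by rewrite big_cons.
Qed.

(** Both sides are continuous in f for the L2-norm, and agree on the
    truncations of f, where the transform is given by the integral. *)
Lemma fourier_affine f a b : a != 0 -> memL2 mu f ->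
  {ae mu, forall xi : borel K, F (fun x => f (a * x + b)) xi =
    ((abs a)^-1)%:C * chi (a^-1 * b * xi) * F f (a^-1 * xi)}.
Proof.
move=> a0 fL.
have aV0 : a^-1 != 0 by rewrite invr_eq0.
pose T f := fun x => f (a * x + b) : R[i].
pose T' g := fun xi => ((abs a)^-1)%:C * chi (a^-1 * b * xi) * g (a^-1 * xi) : R[i].
have TL g : memL2 mu g -> memL2 mu (T g) by exact: memL2_affine.
have mchi : cmeasurable (fun xi => chi (a^-1 * b * xi)).
  have := cmeasurable_affine (a^-1 * b) 0 cmeasurable_chi.
  by under eq_fun do rewrite addr0.
have T'L g : memL2 mu g -> memL2 mu (T' g).
  move=> gL; have g'L := memL2_affine 0 aV0 gL.
  have h x : sqmod (chi (a^-1 * b * x)) <= 1 by rewrite sqmod_chi.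
  have -> : T' g = (fun x => ((abs a)^-1)%:C *
      (g (a^-1 * x + 0) * chi (a^-1 * b * x))).
    by apply/funext => x; rewrite /T' addr0 -mulrA [g _ * _]mulrC.
  exact: memL2Z (memL2M h mchi g'L).
have nT g : memL2 mu g -> (nrm2 mu (T g) = ((abs a)^-1)%:E * nrm2 mu g)%E.
  by move=> [mg _]; exact: nrm2_affine.
have nT' g : memL2 mu g -> (nrm2 mu (T' g) = ((abs a)^-1)%:E * nrm2 mu g)%E.
  move=> [mg gi]; transitivity
      (nrm2 mu (fun x => ((abs a)^-1)%:C * g (a^-1 * x + 0))%R).
    apply: eq_integral => x _; rewrite /T' !sqmodM sqmod_chi mulr1 addr0//.
  rewrite nrm2Z; last exact: cmeasurable_affine.
  rewrite nrm2_affine// muleA -EFinM; congr (_%:E * _)%E.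
  rewrite sqmod_real (uabsV A) invrK expr2 -mulrA mulVf ?mulr1//.
  by rewrite (uabs_eq0 A).
pose D g := fun xi => F (T g) xi - T' (F g) xi.
have DL g : memL2 mu g -> memL2 mu (D g).
  move=> gL; apply: memL2B; first exact/(fourier_L2 FF)/TL.
  exact/T'L/(fourier_L2 FF).
have nD g : memL2 mu g -> (nrm2 mu (D g) <= (4 * (abs a)^-1)%:E * nrm2 mu g)%E.
  move=> gL; have h1 := fourier_L2 FF (TL g gL).
  have h2 := memL2N (T'L _ (fourier_L2 FF gL)).
  apply: le_trans (nrm2D_le h1 h2) _.
  have -> : nrm2 mu (fun x => - T' (F g) x) = nrm2 mu (T' (F g)).
    by apply: eq_integral => x _; rewrite sqmodN.
  rewrite nrm2_fourier ?nT ?nT' ?nrm2_fourier//; [|exact: (fourier_L2 FF)|exact: TL].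
  rewrite -(fineK (memL2_nrm2 gL)) -!EFinM -EFinD lee_fin.
  by rewrite le_eqVlt; apply/orP; left; apply/eqP; ring.
have Dtrunc M : {ae mu, forall xi : borel K,
    D (fun x => f x * cindic (qball_union M) x) xi = 0}.
  set g : K -> R[i] := fun x => f x * _; have mU := measurable_qball_union M.
  have gL : memL2 mu g by exact: memL2_cindic.
  have gL1 : memL1 mu g.
    apply: (memL1_support mU (mu_qball_union M) gL) => x nU.
    by rewrite /g /cindic indicE memNset ?mulr0.
  have TgL1 : memL1 mu (T g).
    apply: (@memL1_support _ ((fun x => a * x + b) @^-1` qball_union M)).
    - by rewrite -[X in measurable X]setTI; exact: measurable_affine.
    - rewrite (mu_affine_preimage S b a0 mU) lte_mul_pinfty//; last exact: mu_qball_union.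
      by rewrite lee_fin invr_ge0 (uabs_ge0 A).
    - exact: TL.
    - by move=> x nU; rewrite /T /g /cindic indicE memNset ?mulr0.
  have e1 := fourierE FF TgL1 (TL _ gL).
  have := ae_affine S 0 aV0 (fourierE FF gL1 gL).
  apply: filterS2 e1 => xi e1 e2; rewrite /D /T' e1.
  rewrite addr0 in e2; rewrite e2; apply/eqP; rewrite subr_eq0; apply/eqP.
  pose h := fun y => chi (a^-1 * b * xi) * (g y * (chi (a^-1 * xi * y))^*).
  have hi : cintegrable mu (fun y => g y * (chi (a^-1 * xi * y))^*).
    by apply: memL1_cintegrable; exact: memL1M_chi.
  transitivity (cintegral mu (fun x => h (a * x + b))).
    congr cintegral; apply/funext => x; rewrite /h /T mulrCA; congr (_ * _).
    have -> : a^-1 * xi * (a * x + b) = xi * x + a^-1 * b * xi.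
      by field.
    by rewrite (chiD ch) rmorphM /= mulrCA mulr_conjc sqmod_chi mulr1.
  rewrite cintegral_affine//; last exact: cintegrableZ.
  by rewrite cintegralZ// mulrA.
suff D0 : nrm2 mu (D f) = 0%E.
  have := nrm2_eq0_ae (proj1 (DL _ fL)) D0; apply: filterS => x /eqP.
  by rewrite /D subr_eq0 => /eqP.
apply/eqP; rewrite eq_le nrm2_ge0 andbT; apply/lee_addgt0Pr => r r0; rewrite add0e.
have c0 : 0 < 4 * (abs a)^-1 by rewrite mulr_gt0// invr_gt0 (uabs_gt0 A).
have [M hM] := trunc_approx fL (divr_gt0 r0 c0).
set g := fun x => f x * cindic (qball_union M) x in hM.
have gL : memL2 mu g by apply: memL2_cindic fL; exact: measurable_qball_union.
have fgL := memL2B fL gL.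
have -> : nrm2 mu (D f) = nrm2 mu (D (fun x => f x - g x)).
  apply: nrm2_ae; [by case: (DL _ fL)|by case: (DL _ fgL)|].
  have e1 := fourierB (TL _ fL) (TL _ gL).
  have e2 := ae_affine S 0 aV0 (fourierB fL gL).
  apply: filterS3 e1 e2 (Dtrunc M) => x e1 e2 e3.
  rewrite addr0 in e2.
  have -> : D (fun x => f x - g x) x = F (fun x => T f x - T g x) x -
    T' (F (fun x => f x - g x)) x by [].
  rewrite /D e1 /T' e2 mulrBr opprB; move: e3; rewrite -/g /D /T' => /eqP.
  by rewrite subr_eq0 => /eqP ->; ring.
apply: le_trans (nD _ fgL) _.
rewrite -(fineK (memL2_nrm2 fgL)) in hM *; rewrite -EFinM lee_fin.
by move: hM; rewrite lte_fin ltr_pdivlMr// mulrC => /ltW.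
Qed.

(** * Parseval's identity on balls *)

(** The modulus of the transform of a function supported in a + D is constant
    on the cosets of D, so that its square integral over K is the sum of its
    values at the representatives u(k). *)
Lemma parseval_unit g a : memL2 mu g -> (forall x, g x != 0 -> abs (x - a) <= 1) ->
  (\sum_(k <oo) (sqmod (cintegral mu (fun x => g x * (chi (un k * x))^*)))%:E =
   nrm2 mu g)%E.
Proof.
move=> gL supp; pose G xi := cintegral mu (fun x => g x * (chi (xi * x))^*).
pose D : set (borel K) := (fun x => 1 * x + - a) @^-1` qball 0 0.
have mD : measurable D.
  by rewrite -[X in measurable X]setTI; apply: measurable_affine => //; exact: (measurable_qball S).
have DP x : D x <-> abs (x - a) <= 1.
  by rewrite /D /preimage /qball /= oppr0 expr0z !mul1r u_at0 subr0.
have gL1 : memL1 mu g.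
  apply: (memL1_support mD _ gL).
    rewrite (mu_affine_preimage S (- a) (oner_neq0 K) (measurable_qball S 0 0)).
    by rewrite mu_qball0 mule1 ltry.
  move=> x nD; apply/eqP; rewrite -[_ == _]negbK; apply/negP => /supp /DP.
  exact: nD.
have gi xi := memL1_cintegrable (memL1M_chi xi gL1).
have Gper x y : abs (x - y) <= 1 -> sqmod (G x) = sqmod (G y).
  move=> xy; have -> : G x = (chi ((x - y) * a))^* * G y.
    rewrite /G -cintegralZ//; congr cintegral; apply/funext => t.
    have [->|gt0] := eqVneq (g t) 0; first by rewrite !mul0r mulr0.
    have -> : x * t = (x - y) * a + ((x - y) * (t - a) + y * t) by ring.
    rewrite !(chiD ch) (chi_integer S (x := _ * (t - a))); last first.
      rewrite (uabsM A) mulr_ile1 ?(uabs_ge0 A)//; exact: supp.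
    by rewrite mul1r rmorphM /= mulrCA.
  by rewrite sqmodM sqmod_chi_conj mul1r.
have mG : measurable_fun [set: borel K] (fun x : borel K => (sqmod (G x))%:E).
  by apply: (locally_constant_measurable S ltr01) => x y /Gper ->.
rewrite -(nrm2_fourier gL).
have -> : nrm2 mu (F g) = (\int[mu]_x (sqmod (G x))%:E)%E.
  apply: ae_eq_integral => //.
    by apply: cmeasurable_Esqmod; case: (fourier_L2 FF gL).
  by apply: filterS (fourierE FF gL1 gL) => x ->.
rewrite (ge0_integral_qballs 0 mG); last by move=> x; rewrite lee_fin sqmod_ge0.
apply: eq_eseriesr => k _.
rewrite (eq_integral (cst (sqmod (G (un k)))%:E)); last first.
  move=> x /set_mem; rewrite /qball /= oppr0 expr0z mul1r => /Gper ->//.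
by rewrite integral_cst ?mu_qball0 ?mule1//; exact: (measurable_qball S).
Qed.

Lemma parseval_scaled g w a : w != 0 -> memL2 mu g ->
  (forall x, g x != 0 -> abs (w * x - a) <= 1) ->
  (\sum_(k <oo) (sqmod (cintegral mu (fun x => g x * (chi (un k * (w * x)))^*)))%:E =
   ((abs w)^-1)%:E * nrm2 mu g)%E.
Proof.
move=> w0 gL supp; have wV0 : w^-1 != 0 by rewrite invr_eq0.
have aw : 0 < abs w := uabs_gt0 A w0.
pose g' := fun y => g (w^-1 * y + 0).
have g'L : memL2 mu g' by exact: memL2_affine.
have := parseval_unit (a := a) g'L.
have -> : nrm2 mu g' = ((abs w)%:E * nrm2 mu g)%E.
  by rewrite /g' nrm2_affine ?(uabsV A) ?invrK//; case: gL.
have s' x : g' x != 0 -> abs (x - a) <= 1.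
  by move=> /supp; rewrite addr0 mulVKf.
move=> /(_ s') e.
have e2 k : cintegral mu (fun x => g' x * (chi (un k * x))^*) =
    (abs w)%:C * cintegral mu (fun x => g x * (chi (un k * (w * x)))^*).
  pose H x := g x * (chi (un k * (w * x)))^*.
  have -> : (fun x => g' x * (chi (un k * x))^*) = (fun x => H (w^-1 * x + 0)).
    by apply/funext => x; rewrite /H /g' addr0 mulVKf.
  rewrite cintegral_affine// ?(uabsV A) ?invrK//.
  apply: memL1_cintegrable; have -> : H = (fun x => g x * (chi (un k * w * x))^*).
    by apply/funext => x; rewrite /H mulrA.
  apply: memL1M_chi.
  apply: (memL1_support (D := (fun x => w * x + - a) @^-1` qball 0 0) _ _ gL).
  - by rewrite -[X in measurable X]setTI; apply: measurable_affine => //; exact: (measurable_qball S).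
  - rewrite (mu_affine_preimage S (- a) w0 (measurable_qball S 0 0)).
    by rewrite mu_qball0 mule1 ltry.
  - move=> x nD; apply/eqP; rewrite -[_ == _]negbK; apply/negP => /supp h.
    by apply: nD; rewrite /preimage /qball /= oppr0 expr0z mul1r u_at0 subr0.
have e3 : (((abs w) ^+ 2)%:E *
    \sum_(k <oo) (sqmod (cintegral mu (fun x => g x * (chi (un k * (w * x)))^*)))%:E
    = (abs w)%:E * nrm2 mu g)%E.
  rewrite -nneseriesZl//; last by move=> k _; rewrite lee_fin sqmod_ge0.
  rewrite -e; apply: eq_eseriesr => k _.
  by rewrite e2 sqmodM sqmod_real EFinM.
have : (((abs w ^+ 2)^-1)%:E * (((abs w) ^+ 2)%:E *
    \sum_(k <oo) (sqmod (cintegral mu (fun x => g x * (chi (un k * (w * x)))^*)))%:E)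
    = ((abs w ^+ 2)^-1)%:E * ((abs w)%:E * nrm2 mu g))%E by rewrite e3.
rewrite !muleA -!EFinM mulVf ?expf_neq0 ?lt0r_neq0// mul1e => ->.
by rewrite expr2 invfM mulrVK// unitfE lt0r_neq0.
Qed.
End Fourier.

(** * Complex limits and periodization *)

Section ComplexLimits.
Context {R : realType}.

Lemma normc_sqmod (z : R[i]) : `|z| = (Num.sqrt (sqmod z))%:C.
Proof. by case: z => a b; rewrite normc_def. Qed.

Lemma cvg_complex (z : nat -> R[i]) (l : R[i]) :
  ((z : nat -> cplx R) @ \oo --> (l : cplx R)) <->
  ((fun n => complex.Re (z n)) @ \oo --> complex.Re l) /\
  ((fun n => complex.Im (z n)) @ \oo --> complex.Im l).
Proof.
split.
  move=> /cvgrPdist_lt zl; split; apply/cvgrPdist_lt => e e0.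
    have e0' : 0 < (e%:C : cplx R) by rewrite ltcE /= eqxx e0.
    have := zl _ e0'; apply: filterS => n.
    rewrite normc_sqmod ltcE /= => /andP[_]; apply: le_lt_trans.
    by have := normRe_le (l - z n); case: (l) => ? ?; case: (z n).
  have e0' : 0 < (e%:C : cplx R) by rewrite ltcE /= eqxx e0.
  have := zl _ e0'; apply: filterS => n.
  rewrite normc_sqmod ltcE /= => /andP[_]; apply: le_lt_trans.
  by have := normIm_le (l - z n); case: (l) => ? ?; case: (z n).
move=> [/cvgrPdist_lt zr /cvgrPdist_lt zi]; apply/cvgrPdist_lt => -[e e'].
rewrite ltcE /= => /andP[/eqP -> e0].
have e2 : 0 < e / 2 by rewrite divr_gt0.
apply: filterS2 (zr _ e2) (zi _ e2) => n h1 h2.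
rewrite normc_sqmod ltcE /= eqxx /= -[ltRHS](gtr0_norm e0) -sqrtr_sqr.
rewrite ltr_sqrt ?exprn_gt0//.
have : (complex.Re l - complex.Re (z n)) ^+ 2 < (e / 2) ^+ 2.
  by rewrite -(real_normK (num_real (_ - _))) ltr_pXn2r// nnegrE// ltW.
have : (complex.Im l - complex.Im (z n)) ^+ 2 < (e / 2) ^+ 2.
  by rewrite -(real_normK (num_real (_ - _))) ltr_pXn2r// nnegrE// ltW.
have -> : sqmod (l - z n) = (complex.Re l - complex.Re (z n)) ^+ 2 +
    (complex.Im l - complex.Im (z n)) ^+ 2.
  by case: (l) => ? ?; case: (z n).
move: (_ ^+ 2) ((complex.Re l - complex.Re (z n)) ^+ 2) => s t.
by rewrite expr_div_n; have := exprn_gt0 2 e0; move: (e ^+ 2) => E; lra.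
Qed.

Lemma Re_sum (I : Type) (s : seq I) (P : pred I) (f : I -> R[i]) :
  complex.Re (\sum_(i <- s | P i) f i) = \sum_(i <- s | P i) complex.Re (f i).
Proof. by elim/big_rec2: _ => // i a b _ <-; rewrite ReD. Qed.

Lemma Im_sum (I : Type) (s : seq I) (P : pred I) (f : I -> R[i]) :
  complex.Im (\sum_(i <- s | P i) f i) = \sum_(i <- s | P i) complex.Im (f i).
Proof. by elim/big_rec2: _ => // i a b _ <-; rewrite ImD. Qed.

Lemma cvg_nneseries_fine (a : nat -> R) : (forall k, 0 <= a k) ->
  (\sum_(k <oo) (a k)%:E < +oo)%E ->
  (fun n => \sum_(0 <= k < n) a k) @ \oo --> fine (\sum_(k <oo) (a k)%:E)%E.
Proof.
move=> a0 fin.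
have fin' : (\sum_(k <oo) (a k)%:E)%E \is a fin_num.
  by rewrite ge0_fin_numE// nneseries_ge0// => k _ _; rewrite lee_fin.
have -> : (fun n => \sum_(0 <= k < n) a k) =
    fine \o (fun n => \sum_(0 <= k < n) (a k)%:E)%E.
  by apply/funext => n /=; rewrite sumEFin.
apply: fine_cvg; rewrite fineK//.
by apply: is_cvg_nneseries => k _ _; rewrite lee_fin.
Qed.

Lemma posneg_cvg (a : nat -> R) :
  (\sum_(k <oo) (Num.max (a k) 0)%:E < +oo)%E ->
  (\sum_(k <oo) (Num.max (- a k) 0)%:E < +oo)%E ->
  (fun n => \sum_(0 <= k < n) a k) @ \oo -->
    fine (\sum_(k <oo) (Num.max (a k) 0)%:E)%E -
    fine (\sum_(k <oo) (Num.max (- a k) 0)%:E)%E.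
Proof.
move=> fp fn.
have h1 k : 0 <= Num.max (a k) 0 by rewrite le_max lexx orbT.
have h2 k : 0 <= Num.max (- a k) 0 by rewrite le_max lexx orbT.
have -> : (fun n => \sum_(0 <= k < n) a k) = (fun n =>
    \sum_(0 <= k < n) Num.max (a k) 0 - \sum_(0 <= k < n) Num.max (- a k) 0).
  apply/funext => n; rewrite -sumrB; apply: eq_bigr => k _.
  by rewrite /Num.max; do 2 case: ifPn; lra.
by apply: cvgB; exact: cvg_nneseries_fine.
Qed.
End ComplexLimits.

Section Periodization.
Context {R : realType} {K : topologicalFieldType}.
Variables (mu : {measure set (borel K) -> \bar R}) (abs : K -> R) (p c : nat).
Variables (eps : 'I_c -> K) (varpi : K) (chi : K -> R[i]).
Hypothesis S : wavelet_setting mu abs p eps varpi chi.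

Local Notation q := (p ^ c)%N.
Local Notation un := (u p eps varpi).
Local Notation qball := (qball abs p eps varpi).
Let A := ws_uabs S.
Let ch := ws_chi S.
Let w0 := prime_neq0 S.

Lemma qball00 x : qball 0 0 x <-> abs x <= 1.
Proof. by rewrite /qball /= oppr0 expr0z mul1r u_at0 subr0. Qed.

Lemma integral_qball0 k (f : borel K -> \bar R) :
  measurable_fun [set: borel K] f -> (forall x, 0 <= f x)%E ->
  (\int[mu]_(x in qball 0 k) f x = \int[mu]_(x in qball 0 0) f (x + un k)%R)%E.
Proof.
move=> mf f0.
have := ge0_integral_affine S (un k) (oner_neq0 K) (measurable_qball S 0 k) mf f0.
rewrite (uabs1 A) invr1 mul1e => <-.
have -> : (fun x : K => 1 * x + un k) @^-1` qball 0 k = qball 0 0.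
  apply/seteqP; split => x; rewrite /preimage /qball /= oppr0 expr0z !mul1r.
    by rewrite addrK u_at0 subr0.
  by rewrite addrK u_at0 subr0.
by apply: eq_integral => x _; rewrite mul1r.
Qed.

Lemma measurable_shift d (T : measurableType d) (f : borel K -> T) b :
  measurable_fun [set: borel K] f ->
  measurable_fun [set: borel K] (fun x : borel K => f (x + b : K)).
Proof.
move=> mf; have -> : (fun x : borel K => f (x + b : K)) =
    f \o ((fun x => 1 * x + b) : borel K -> borel K).
  by apply/funext => x /=; rewrite mul1r.
by apply: measurableT_comp => //; exact: measurable_affine.
Qed.

(** Integrating over K amounts to integrating over D the sum over the
    translates, since the sets D + b + u(k) partition K. *)
Lemma ge0_integral_periodize b (f : borel K -> \bar R) :
  measurable_fun [set: borel K] f -> (forall x, 0 <= f x)%E ->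
  (\int[mu]_(x in qball 0 0) (\sum_(k <oo) f (x + (b + un k))%R) =
   \int[mu]_x f x)%E.
Proof.
move=> mf f0.
have := ge0_integral_affine S b (oner_neq0 K) measurableT mf f0.
rewrite (uabs1 A) invr1 mul1e preimage_setT => <-.
have mfb := measurable_shift b mf.
have -> : (\int[mu]_x f (1 * x + b)%R = \int[mu]_x f (x + b)%R)%E.
  by apply: eq_integral => x _; rewrite mul1r.
rewrite (ge0_integral_qballs S 0 mfb)//.
under [RHS]eq_eseriesr do rewrite (integral_qball0 _ mfb)//.
rewrite integral_nneseries//.
- apply: eq_eseriesr => k _; apply: eq_integral => x _.
  by rewrite addrA addrAC.
- exact: (measurable_qball S).
- by move=> k; apply: measurable_funTS; exact: (measurable_shift (b + un k) mf).
Qed.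

(** * The characters chi (u(k) x) on the integers *)

Lemma chiN x : chi (- x) = (chi x)^*.
Proof.
apply: (mulfI (chi_neq0 S x)); rewrite mulr_conjc (sqmod_chi S) -(chiD ch) subrr.
exact: (chi0 S).
Qed.

(** Sum first over the last digit of i. This sum is 0 when |y| = 1, because a
    nontrivial character sums to 0; otherwise all its terms are 1, and the
    remaining digits are paired with y / varpi. *)
Lemma sum_chi_u n y : abs y <= 1 ->
  \sum_(0 <= i < q ^ n) chi (un i * y) =
  ((q ^ n)%:R * (abs y <= abs varpi ^+ n)%R%:R)%R.
Proof.
elim: n y => [|n ih] y y1.
  by rewrite big_nat1 u_at0 mul0r (chi0 S) expr0 y1 mul1r.
have sum_mul m (f : nat -> R[i]) : \sum_(0 <= i < m * q) f i =
    \sum_(0 <= i < m) \sum_(0 <= j < q) f (i * q + j)%N.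
  elim: m => [|m ihm]; first by rewrite mul0n !big_geq.
  rewrite mulSn addnC (big_cat_nat (n := m * q))//= ?leq_addr// ihm.
  rewrite [RHS]big_nat_recr//=; congr (_ + _).
  rewrite -{1}[(m * q)%N]add0n big_addn addKn.
  by apply: eq_bigr => j _; rewrite addnC.
rewrite expnSr sum_mul.
have inner0 i : \sum_(0 <= j < q) chi (un (i * q + j) * y) =
    chi (un i * (varpi^-1 * y)) * \sum_(j < q) chi (digit_rep p eps j * varpi^-1 * y).
  rewrite big_mkord mulr_sumr; apply: eq_bigr => j _.
  rewrite (u_cat S)// -(chiD ch); congr chi; ring.
under eq_bigr do rewrite inner0.
rewrite -mulr_suml.
have [y1'|y1'] := ltP (abs y) 1; last first.
  have y1e : abs y = 1 by apply/eqP; rewrite eq_le y1 y1'.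
  have lt1 : abs varpi ^+ n.+1 < 1.
    by rewrite exprn_ilt1// ?(uabs_ge0 A)// (abs_prime_lt1 S).
  by rewrite (sum_chi_digit S y1e) mulr0 y1e leNgt lt1 mulr0.
have -> : \sum_(j < q) chi (digit_rep p eps j * varpi^-1 * y) = q%:R.
  rewrite (eq_bigr (fun=> 1)) ?sumr_const ?card_ord// => j _.
  rewrite -mulrA; apply: (chi_integer S).
  rewrite (uabsM A) mulr_ile1 ?(uabs_ge0 A)//.
    exact: (digit_rep_le1 A (ws_char S) (ws_eps S)).
  exact: (abs_lt1_prime S).
rewrite ih; last exact: (abs_lt1_prime S).
rewrite natrM mulrAC; congr (_ * _ * (_ : bool)%:R).
by rewrite (uabsM A) (uabsV A) mulrC ler_pdivrMr ?exprSr// (uabs_gt0 A).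
Qed.

(** A trigonometric polynomial that is periodic under all the u(k) and coincides
    on D with the indicator of the ball number l of level n. *)
Definition ball_chi (n l : nat) (x : K) : R[i] :=
  ((q ^ n)%:R)^-1 * \sum_(0 <= i < q ^ n) chi (un i * (x - varpi ^+ n * un l)).

Lemma ball_chiE n l x : (l < q ^ n)%N -> abs x <= 1 ->
  ball_chi n l x = cindic (qball n l) x.
Proof.
move=> ln x1.
have qn0 : (0 : R[i]) < (q ^ n)%:R by rewrite ltr0n expn_gt0 (ws_q_gt0 S).
have c1 : abs (varpi ^+ n * un l) <= 1.
  apply/qball00; rewrite -(divn_small ln); apply: (qball_parent S).
  by rewrite add0r /qball /= -exprnN mulKf ?expf_neq0// subrr (uabs0 A).
rewrite /ball_chi sum_chi_u; last exact: (uabsB A).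
rewrite mulrA mulVf ?gt_eqF// mul1r /cindic indicE.
have -> : (abs (x - varpi ^+ n * un l) <= abs varpi ^+ n) = (x \in qball n l).
  apply/idP/idP => [h|/set_mem].
    apply/mem_set; rewrite /qball /= -exprnN -[un l](mulKf (expf_neq0 n w0)).
    rewrite -mulrBr (uabsM A) (uabsV A) (uabsX A) mulrC ler_pdivrMr ?mul1r//.
    by rewrite exprn_gt0// (uabs_gt0 A).
  rewrite /qball /= -exprnN -{1}[un l](mulKf (expf_neq0 n w0)).
  rewrite -mulrBr (uabsM A) (uabsV A) (uabsX A) mulrC ler_pdivrMr ?mul1r//.
  by rewrite exprn_gt0// (uabs_gt0 A).
by case: (_ \in _).
Qed.

Lemma ball_chi_periodic n l x k : ball_chi n l (x + un k) = ball_chi n l x.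
Proof.
rewrite /ball_chi; congr (_ * _); apply: eq_bigr => i _.
have -> : un i * (x + un k - varpi ^+ n * un l) =
  un i * (x - varpi ^+ n * un l) + un i * un k by ring.
by rewrite (chiD ch) (chi_uM S) mulr1.
Qed.

Lemma ball_chi_indic n l x : (l < q ^ n)%N ->
  exists D : bool, ball_chi n l x = D%:R%:C.
Proof.
move=> ln; have [k xk] := u_surj S x.
rewrite -(subrK (un k) x) ball_chi_periodic ball_chiE// /cindic indicE.
by eexists.
Qed.

(** Orthogonality, read off from Parseval's identity for the indicator of D,
    whose coefficient at k = 0 already has modulus 1. *)
Lemma cintegral_chi_unit (F : (K -> R[i]) -> (K -> R[i])) k :
  fourier_transform mu chi F ->
  cintegral mu (fun x => cindic (qball 0 0) x * (chi (un k * x))^*) = (k == 0%N)%:R.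
Proof.
move=> FF; have mD := measurable_qball S 0 0.
pose g : K -> R[i] := cindic (qball 0 0).
have g2 : nrm2 mu g = 1%E.
  have := nrm2_cindic mu (fun=> 1 : R[i]) mD.
  have -> : (fun x => 1 * cindic (qball 0 0) x : R[i]) = g.
    by apply/funext => x; rewrite mul1r.
  move=> ->; under eq_integral do rewrite sqmod1.
  by rewrite integral_cst// mul1e (mu_qball0 S).
have gL : memL2 mu g.
  by split; [exact: cmeasurable_indic|rewrite -/(nrm2 mu g) g2 ltry].
have c0 : cintegral mu (fun x => g x * (chi (un 0 * x))^*) = 1.
  have -> : (fun x => g x * (chi (un 0 * x))^*) = g.
    by apply/funext => x; rewrite u_at0 mul0r (chi0 S) rmorph1 mulr1.
  rewrite /cintegral /=; congr (_ +i* _).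
    rewrite /Rintegral integral_indic// setIT.
    by rewrite [X in fine X](mu_qball0 S).
  by rewrite Rintegral_cst// mul0r.
have [->|k0] := eqVneq k 0%N; first exact: c0.
apply: sqmod_eq0.
have supp x : g x != 0 -> abs (x - 0) <= 1.
  rewrite subr0 /g /cindic indicE; have [xD _|] := boolP (x \in _).
    exact/qball00/set_mem.
  by rewrite eqxx.
have := parseval_unit S FF gL supp; rewrite g2.
set a := fun i => (sqmod (cintegral mu (fun x => g x * (chi (un i * x))^*)))%:E.
have a0 i : (0 <= a i)%E by rewrite lee_fin sqmod_ge0.
move=> e; have : (a 0%N + a k <= 1%:E)%E.
  rewrite -e; apply: (@le_trans _ _ (\sum_(0 <= i < k.+1) a i)%E); last first.
    by apply: nneseries_lim_ge.
  rewrite big_nat_recr//= leeD2r// big_ltn ?lt0n// leeDl//.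
  by apply: sume_ge0.
rewrite /a c0 sqmod1 -EFinD lee_fin gerDl => h.
by apply/eqP; rewrite eq_le h sqmod_ge0.
Qed.
End Periodization.

(** * Fourier coefficients of a periodization *)

Section FourierCoefficients.
Context {R : realType} {K : topologicalFieldType}.
Variables (mu : {measure set (borel K) -> \bar R}) (abs : K -> R) (p c : nat).
Variables (eps : 'I_c -> K) (varpi : K) (chi : K -> R[i]).
Hypothesis S : wavelet_setting mu abs p eps varpi chi.

Local Notation q := (p ^ c)%N.
Local Notation un := (u p eps varpi).
Local Notation qball := (qball abs p eps varpi).
Let A := ws_uabs S.
Let ch := ws_chi S.

Local Notation pos t := (Num.max t 0).
Local Notation D := (qball 0 0 : set (borel K)).
Let mD : measurable D. Proof. exact: (measurable_qball S). Qed.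

Let pos_ge0 (t : R) : 0 <= pos t. Proof. by rewrite le_max lexx orbT. Qed.

(** Positive parts keep the sum over the translates meaningful before its
    convergence is known. *)
Definition periodized_pos (f : K -> R) (b : K) : borel K -> \bar R :=
  fun x => (\sum_(k <oo) (pos (f (x + (b + un k))))%:E)%E.

Lemma periodized_pos_ge0 f b x : (0 <= periodized_pos f b x)%E.
Proof. by apply: nneseries_ge0 => k _ _; rewrite lee_fin. Qed.

Let measurable_pos (f : K -> R) : measurable_fun [set: borel K] (f : borel K -> R) ->
  measurable_fun [set: borel K] ((fun x => (pos (f x))%:E) : borel K -> \bar R).
Proof.
move=> mf; apply/measurable_EFinP.
by apply: measurable_maxr => //; exact: measurable_cst.
Qed.

Lemma measurable_periodized_pos f b : measurable_fun [set: borel K] (f : borel K -> R) ->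
  measurable_fun [set: borel K] (periodized_pos f b).
Proof.
move=> mf; apply: ge0_emeasurable_sum.
  by move=> k x _; rewrite lee_fin.
by move=> k _; exact: (measurable_shift (b + un k) (measurable_pos mf)).
Qed.

Lemma integral_periodized_pos f b : measurable_fun [set: borel K] (f : borel K -> R) ->
  (\int[mu]_(x in D) periodized_pos f b x = \int[mu]_x (pos (f x))%:E)%E.
Proof.
move=> mf; rewrite -(ge0_integral_periodize S b (measurable_pos mf))//.
by move=> x; rewrite lee_fin.
Qed.

Variable (f : K -> R).
Hypothesis fi : mu.-integrable [set: borel K] (EFin \o (f : borel K -> R)).

Let mf : measurable_fun [set: borel K] (f : borel K -> R).
Proof. by move/integrableP : fi => [/measurable_EFinP]. Qed.
Let mNf : measurable_fun [set: borel K] ((fun x => - f x) : borel K -> R).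
Proof. exact: measurable_funN. Qed.

Let posE : ((EFin \o (f : borel K -> R))^\+)%E = (fun x => (pos (f x))%:E).
Proof. by apply/funext => x; rewrite funeposE /= EFin_max. Qed.
Let negE : ((EFin \o (f : borel K -> R))^\-)%E = (fun x => (pos (- f x))%:E).
Proof. by apply/funext => x; rewrite funenegE /= EFin_max. Qed.

Let fin_pos : (\int[mu]_x (pos (f x))%:E)%E \is a fin_num.
Proof. by have := integrable_pos_fin_num measurableT fi; rewrite posE. Qed.
Let fin_neg : (\int[mu]_x (pos (- f x))%:E)%E \is a fin_num.
Proof. by have := integrable_neg_fin_num measurableT fi; rewrite negE. Qed.

Lemma integrable_periodized_pos b : mu.-integrable D (periodized_pos f b) /\
  mu.-integrable D (periodized_pos (fun x => - f x)%R b).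
Proof.
split; apply/integrableP; split.
- by apply: measurable_funTS; exact: measurable_periodized_pos.
- under eq_integral do rewrite gee0_abs ?periodized_pos_ge0//.
  by rewrite integral_periodized_pos// ltey_eq fin_pos.
- by apply: measurable_funTS; exact: measurable_periodized_pos.
- under eq_integral do rewrite gee0_abs ?periodized_pos_ge0//.
  by rewrite integral_periodized_pos// ltey_eq fin_neg.
Qed.

Lemma integral_periodized_posB b : (\int[mu]_x (f x)%:E =
  \int[mu]_(x in D) periodized_pos f b x - \int[mu]_(x in D) periodized_pos (fun x => - f x)%R b x)%E.
Proof. by rewrite !integral_periodized_pos// integralE posE negE. Qed.

(** The periodizations of the positive and negative parts are integrable, hence
    finite almost everywhere. *)
Lemma periodized_pos_cvg b : {ae mu, forall x : borel K, D x ->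
  [/\ (periodized_pos f b x < +oo)%E, (periodized_pos (fun x => - f x)%R b x < +oo)%E &
  (fun n => \sum_(0 <= k < n) f (x + (b + un k))) @ \oo -->
    fine (periodized_pos f b x) - fine (periodized_pos (fun x => - f x)%R b x)]}.
Proof.
have [i1 i2] := integrable_periodized_pos b.
have h1 := integrable_ae mD i1; have h2 := integrable_ae mD i2.
apply: filterS2 h1 h2 => x h1 h2 Dx.
have {}h1 : (periodized_pos f b x < +oo)%E by rewrite ltey_eq h1.
have {}h2 : (periodized_pos (fun x => - f x)%R b x < +oo)%E by rewrite ltey_eq h2.
by split => //; exact: (posneg_cvg (a := fun k => f (x + (b + un k)))).
Qed.

Lemma integral_of_periodized (g : borel K -> R) :
  measurable_fun [set: borel K] g ->
  {ae mu, forall x : borel K, D x ->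
    (fun n => \sum_(0 <= k < n) f (x + un k)) @ \oo --> g x} ->
  (\int[mu]_x (f x)%:E = \int[mu]_(x in D) (g x)%:E)%E.
Proof.
move=> mg fg; rewrite (integral_periodized_posB 0); have [i1 i2] := integrable_periodized_pos 0.
rewrite -integralB//; apply: ae_eq_integral => //.
- by apply: emeasurable_funB; apply: measurable_funTS; exact: measurable_periodized_pos.
- by apply: measurable_funTS; apply/measurable_EFinP.
apply: filterS2 fg (periodized_pos_cvg 0) => x gx px Dx.
have [p1 p2 px'] := px Dx; have {}gx := gx Dx.
have -> : g x = fine (periodized_pos f 0 x) - fine (periodized_pos (fun x => - f x)%R 0 x).
  have e : (fun n => \sum_(0 <= k < n) f (x + un k)) =
      (fun n => \sum_(0 <= k < n) f (x + (0 + un k))).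
    by apply/funext => n; apply: eq_bigr => k _; rewrite add0r.
  rewrite e in gx; exact: (cvg_unique (@Rhausdorff R) gx px').
by rewrite EFinB !fineK// ge0_fin_numE ?periodized_pos_ge0.
Qed.
End FourierCoefficients.

Section FourierUniqueness.
Context {R : realType} {K : topologicalFieldType}.
Variables (mu : {measure set (borel K) -> \bar R}) (abs : K -> R) (p c : nat).
Variables (eps : 'I_c -> K) (varpi : K) (chi : K -> R[i]).
Hypothesis S : wavelet_setting mu abs p eps varpi chi.

Local Notation q := (p ^ c)%N.
Local Notation un := (u p eps varpi).
Local Notation qball := (qball abs p eps varpi).
Local Notation periodized_pos := (periodized_pos p eps varpi).
Local Notation ball_chi := (ball_chi p eps varpi chi).
Let A := ws_uabs S.
Let ch := ws_chi S.
Local Notation D := (qball 0 0 : set (borel K)).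
Let mD : measurable D. Proof. exact: (measurable_qball S). Qed.

Let omega n l x := complex.Re (ball_chi n l x).

Let omegaE n l x : (l < q ^ n)%N -> D x -> omega n l x = \1_(qball n l) x.
Proof. by move=> lq /(qball00 abs p eps varpi) x1; rewrite /omega (ball_chiE S). Qed.

Let omega_periodic n l x m k : omega n l (x + (un m + un k)) = omega n l x.
Proof. by rewrite /omega addrA !(ball_chi_periodic S). Qed.

Let omega_bool n l x : (l < q ^ n)%N -> exists d : bool, omega n l x = d%:R.
Proof. by move=> /(ball_chi_indic S x)[d e]; exists d; rewrite /omega e. Qed.

Lemma cmeasurable_ball_chi n l : cmeasurable (ball_chi n l).
Proof.
rewrite /ball_chi; apply: cmeasurableZ; apply: cmeasurable_sum => i.
have := cmeasurable_affine (un i) (- (un i * (varpi ^+ n * un l))) (cmeasurable_chi S).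
by under eq_fun do rewrite -mulrBr.
Qed.

(** Multiplying f by the periodized indicator of a ball B inside D restricts
    its periodization to B. The hypothesis thus says that the periodization has
    integral v mu(B) over B, which determines it. In order to compare
    nonnegative functions, the negative parts of f and of v are moved to the
    other side of the equation. *)
Lemma periodized_cst (f : K -> R) (v : R) m :
  mu.-integrable [set: borel K] (EFin \o (f : borel K -> R)) ->
  (forall n l, (l < q ^ n)%N ->
    \int[mu]_x (f x * omega n l x) = v * ((q ^ n)%:R)^-1) ->
  {ae mu, forall x : borel K, D x ->
    (fun n => \sum_(0 <= k < n) f (x + (un m + un k))) @ \oo --> v}.
Proof.
move=> fi fv; have mf : measurable_fun [set: borel K] (f : borel K -> R).
  by move/integrableP : fi => [/measurable_EFinP].
pose Nf x := - f x.
have mNf : measurable_fun [set: borel K] (Nf : borel K -> R) by exact: measurable_funN.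
have [i1 i2] := integrable_periodized_pos S fi (un m).
(* Outside D the functions are set to 0, so that only balls inside D matter. *)
pose G (h : K -> R) (t : R) : borel K -> \bar R :=
  ((fun x => periodized_pos h (un m) x + (Num.max t 0)%:E)%E \_ D).
have pos_ge0 (t : R) : 0 <= Num.max t 0 by rewrite le_max lexx orbT.
have mG h t : measurable_fun [set: borel K] (h : borel K -> R) ->
    measurable_fun [set: borel K] (G h t).
  move=> mh; apply/(measurable_restrictT _ mD); apply: emeasurable_funD => //.
  by apply: measurable_funTS; exact: measurable_periodized_pos.
have G0 h t x : (0 <= G h t x)%E.
  rewrite /G patchE; case: ifP => // _; apply: adde_ge0; last by rewrite lee_fin.
  exact: periodized_pos_ge0.
have perM (h : K -> R) n l : measurable_fun [set: borel K] (h : borel K -> R) ->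
    (l < q ^ n)%N ->
    (\int[mu]_(x in qball n l) periodized_pos h (un m) x =
     \int[mu]_x (Num.max (h x * omega n l x) 0)%:E)%E.
  move=> mh lq; have mom : measurable_fun [set: borel K] (fun x : borel K => h x * omega n l x).
    by apply: measurable_funM => //; case: (cmeasurable_ball_chi n l).
  rewrite -(integral_periodized_pos S (un m) mom).
  have sub : (qball n l : set K) `<=` D.
    move=> x xl; rewrite -(divn_small lq); apply: (qball_parent S).
    by rewrite add0r.
  rewrite [LHS]integral_mkcond [RHS]integral_mkcond; apply: eq_integral => x _.
  rewrite !patchE; have [xl|xl] := boolP (x \in qball n l).
    have xD : x \in D by apply/mem_set/sub/set_mem.
    rewrite xD; apply: eq_eseriesr => k _; congr (Num.max _ _)%:E.
    by rewrite omega_periodic omegaE ?indicE ?xl ?mulr1//; exact/set_mem.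
  case: ifP => // /set_mem xD; apply/esym/eseries0 => k _ _.
  by rewrite omega_periodic omegaE// indicE (negbTE xl) mulr0 maxxx.
have GB h t n l : measurable_fun [set: borel K] (h : borel K -> R) ->
    (l < q ^ n)%N -> (\int[mu]_(x in qball n l) G h t x =
     \int[mu]_x (Num.max (h x * omega n l x) 0)%:E +
     (Num.max t 0 * ((q ^ n)%:R)^-1)%:E)%E.
  move=> mh lq; have mB := measurable_qball S n l.
  rewrite -perM//.
  transitivity (\int[mu]_(x in qball n l) (periodized_pos h (un m) x + (Num.max t 0)%:E))%E.
    apply: eq_integral => x /set_mem xl; rewrite /G patchE mem_set//.
    rewrite -(divn_small lq); apply: (qball_parent S); by rewrite add0r.
  have p0 x : (qball n l : set (borel K)) x -> (0 <= periodized_pos h (un m) x)%E.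
    by move=> _; exact: periodized_pos_ge0.
  have pm : measurable_fun (qball n l : set (borel K)) (periodized_pos h (un m)).
    by apply: measurable_funTS; exact: measurable_periodized_pos.
  rewrite ge0_integralD//; last by move=> x _; rewrite lee_fin.
  rewrite integral_cst// [X in (_ * X)%E](mu_qball S) -EFinM.
  by rewrite -exprnN (natrX _ q n).
have fB n l : (l < q ^ n)%N -> mu.-integrable [set: borel K]
    (EFin \o (fun x : borel K => f x * omega n l x)).
  move=> lq; apply: (le_integrable _ _ _ fi) => //.
    apply/measurable_EFinP; apply: measurable_funM => //.
    by case: (cmeasurable_ball_chi n l).
  move=> x _ /=; rewrite lee_fin normrM; have [[] ->] := omega_bool x lq.
    by rewrite normr1 mulr1.
  by rewrite normr0 mulr0.
have GG n l : (l < q ^ n)%N ->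
    (\int[mu]_(x in qball n l) G f (- v)%R x =
     \int[mu]_(x in qball n l) G Nf v x)%E /\
    (\int[mu]_(x in qball n l) G f (- v)%R x < +oo)%E.
  move=> lq; rewrite !GB//.
  have e1 : ((EFin \o (fun x : borel K => (f x * omega n l x)%R))^\+)%E =
      (fun x => (Num.max (f x * omega n l x) 0)%:E).
    by apply/funext => x; rewrite funeposE /= EFin_max.
  have e2 : ((EFin \o (fun x : borel K => (f x * omega n l x)%R))^\-)%E =
      (fun x => (Num.max (Nf x * omega n l x) 0)%:E).
    by apply/funext => x; rewrite funenegE /= EFin_max mulNr.
  have fp := integrable_pos_fin_num measurableT (fB n l lq).
  have fn := integrable_neg_fin_num measurableT (fB n l lq).
  have : (\int[mu]_x (f x * omega n l x)%:E = (v * ((q ^ n)%:R)^-1)%:E)%E.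
    rewrite -(fv n l lq) /Rintegral fineK//.
    exact: (integrable_fin_num measurableT (fB n l lq)).
  rewrite integralE e1 e2.
  rewrite e1 in fp; rewrite e2 in fn.
  rewrite -(fineK fp) -(fineK fn) -EFinB -!EFinD => -[e]; split; last exact: ltry.
  congr EFin; move: e; set P := fine _; set N := fine _ => e.
  have -> : P = v / (q ^ n)%:R + N by rewrite -e subrK.
  have -> : Num.max v 0 = v + Num.max (- v) 0.
    by rewrite /Num.max; do 2 case: ifPn; lra.
  by ring.
have out n l (h : K -> R) t : ~ (exists x, qball n l x /\ D x) ->
    (\int[mu]_(x in qball n l) G h t x = 0)%E.
  move=> no; rewrite integral0_eq// => x xl; rewrite /G patchE.
  by case: ifP => // /set_mem xD; exfalso; apply: no; exists x.
have ball_cases (n : int) l : (0 < l)%N ->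
    (exists2 n' : nat, n = n' & (l < q ^ n')%N) \/ ~ (exists x, qball n l x /\ D x).
  move=> l0; have [[x [xl xD]]|?] := pselect (exists x, qball n l x /\ D x); last by right.
  left; case: n xl => [n|n] xl.
    exists n => //; rewrite ltnNge; apply/negP => ql.
    have xl' : qball (0 + n%:Z) l x by rewrite add0r.
    have e := qball_inj S xD (qball_parent S xl').
    have qn0 : (0 < q ^ n)%N by rewrite expn_gt0 (ws_q_gt0 S).
    by have : (0 < l %/ q ^ n)%N; [rewrite divn_gt0|rewrite -e].
  have xD' : qball (Negz n + n.+1%:Z) 0 x by rewrite NegzE addNr.
  have := qball_inj S xl (qball_parent S xD'); rewrite div0n => l00.
  by rewrite l00 in l0.
have := qball_integral_unique S (mG f (- v)%R mf) (mG Nf v mNf) (G0 f (- v)) (G0 Nf v).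
have hyp1 (n : int) l : (0 < l)%N -> (\int[mu]_(x in qball n l) G f (- v)%R x =
    \int[mu]_(x in qball n l) G Nf v x)%E.
  by move=> /(ball_cases n)[[n' -> /GG[]//]|no]; rewrite !out.
have hyp2 (n : int) l : (0 < l)%N -> (\int[mu]_(x in qball n l) G f (- v)%R x < +oo)%E.
  by move=> /(ball_cases n)[[n' -> /GG[]//]|no]; rewrite out.
move=> /(_ hyp1 hyp2) Gae.
apply: filterS2 Gae (periodized_pos_cvg S fi (un m)) => x Gx px Dx.
have [p1 p2 pc] := px Dx.
move: Gx; rewrite /G !patchE mem_set//.
have f1 : periodized_pos f (un m) x \is a fin_num by rewrite ge0_fin_numE// periodized_pos_ge0.
have f2 : periodized_pos Nf (un m) x \is a fin_num by rewrite ge0_fin_numE// periodized_pos_ge0.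
rewrite -(fineK f1) -(fineK f2) -!EFinD => -[e].
suff -> : v = fine (periodized_pos f (un m) x) - fine (periodized_pos (fun x => - f x)%R (un m) x) by [].
move: e; rewrite -/Nf; set P := fine _; set N := fine _.
by rewrite /Num.max; do 2 case: ifPn; lra.
Qed.

(** Since -u(i) is itself of the form u(i'), the characters and their
    conjugates are the same functions. *)
Lemma chi_index_opp i : exists i', [/\ forall x, chi (un i * x) = (chi (un i' * x))^* &
  (i' == 0%N) = (i == 0%N)].
Proof.
have [i' e] := u_sub S 0 i; rewrite u_at0 sub0r in e.
exists i'; split => [x|]; first by rewrite -(chiN S) -e mulNr opprK.
have abs0 : abs (0 : K) <= 1 by rewrite (uabs0 A) ler01.
apply/eqP/eqP => i0; apply: (u_inj S); rewrite u_at0 subr0.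
  by rewrite -(uabsN A) e i0 u_at0.
by rewrite -e i0 u_at0 oppr0.
Qed.

(** Only the trivial character in the trigonometric polynomial has a nonzero
    integral against h. *)
Lemma cintegral_ball_chi (h : K -> R[i]) (v : R[i]) n l :
  (forall k, cintegrable mu (fun x => h x * (chi (un k * x))^*)) ->
  (forall k, cintegral mu (fun x => h x * (chi (un k * x))^*) = v * (k == 0%N)%:R) ->
  cintegral mu (fun x => h x * ball_chi n l x) = v * ((q ^ n)%:R)^-1.
Proof.
move=> hk hv.
pose cf i := ((q ^ n)%:R)^-1 * chi (- (un i * (varpi ^+ n * un l))) : R[i].
have hE i : (fun x => cf i * (h x * chi (un i * x))) =
    (fun x => cf i * (h x * (chi (un (projT1 (cid (chi_index_opp i))) * x))^*)).
  by apply/funext => x; case: (cid _) => i' [e _] /=; rewrite e.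
have -> : (fun x => h x * ball_chi n l x) =
    (fun x => \sum_(i <- index_iota 0 (q ^ n)) cf i * (h x * chi (un i * x))).
  apply/funext => x; rewrite /ball_chi mulrCA mulr_sumr mulr_sumr.
  apply: eq_bigr => i _; rewrite mulrBr (chiD ch) /cf; ring.
have ii i : cintegrable mu (fun x => cf i * (h x * chi (un i * x))).
  by rewrite hE; exact: cintegrableZ.
have [_ ->] := cintegral_sum (index_iota 0 (q ^ n)) ii.
have term i : cintegral mu (fun x => cf i * (h x * chi (un i * x))) =
    cf i * (v * (i == 0%N)%:R).
  rewrite hE cintegralZ//; case: (cid _) => i' [e i0] /=.
  by rewrite hv i0.
under eq_bigr do rewrite term.
have q0 : (0 < q ^ n)%N by rewrite expn_gt0 (ws_q_gt0 S).
rewrite big_ltn// big_nat_cond big1 ?addr0; last first.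
  by move=> i /andP[/andP[i0 _] _]; rewrite gtn_eqF// !mulr0.
by rewrite /cf u_at0 mul0r oppr0 (chi0 S) !mulr1 mulrC.
Qed.

Variable F : (K -> R[i]) -> (K -> R[i]).
Hypothesis FF : fourier_transform mu chi F.

(** The integral over K of h against a character that is periodic under the
    u(k) is a Fourier coefficient on D of the periodization of h. Conversely the
    coefficients determine the periodization, because the indicators of the
    balls inside D are combinations of the characters. *)
Lemma fourier_coefficients_periodization (h : K -> R[i]) (v : R[i]) :
  cintegrable mu h ->
  (forall k, cintegrable mu (fun x => h x * (chi (un k * x))^*)) ->
  (forall k, cintegral mu (fun x => h x * (chi (un k * x))^*) = v * (k == 0%N)%:R) <->
  {ae mu, forall xi : borel K,
    (fun n : nat => (\sum_(0 <= k < n) h (xi + un k) : cplx R)) @ \oo -->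
      (v : cplx R)}.
Proof.
move=> hi hk; split=> [hv|hv k].
  have [hi1 hi2] := hi.
  have ReIm m : {ae mu, forall x : borel K, D x ->
      (fun n : nat => (\sum_(0 <= k < n) h (x + (un m + un k)) : cplx R)) @ \oo -->
      (v : cplx R)}.
    have c1 : {ae mu, forall x : borel K, D x -> (fun n =>
        \sum_(0 <= k < n) complex.Re (h (x + (un m + un k)))) @ \oo --> complex.Re v}.
      apply: (periodized_cst m hi1) => n l lq.
      have := cintegral_ball_chi n l hk hv; rewrite /cintegral.
      have -> : v * (q ^ n)%:R^-1 = v * ((q ^ n)%:R^-1)%:C.
        by rewrite fmorphV rmorph_nat.
      move=> /(congr1 (@complex.Re R)); rewrite ReM /= mulr0 subr0 => <-.
      apply: eq_Rintegral => x _; have [d ed] := ball_chi_indic S x lq.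
      by rewrite /omega ed ReM /= mulr0 subr0.
    have c2 : {ae mu, forall x : borel K, D x -> (fun n =>
        \sum_(0 <= k < n) complex.Im (h (x + (un m + un k)))) @ \oo --> complex.Im v}.
      apply: (periodized_cst m hi2) => n l lq.
      have := cintegral_ball_chi n l hk hv; rewrite /cintegral.
      have -> : v * (q ^ n)%:R^-1 = v * ((q ^ n)%:R^-1)%:C.
        by rewrite fmorphV rmorph_nat.
      move=> /(congr1 (@complex.Im R)); rewrite ImM /= mulr0 add0r => <-.
      apply: eq_Rintegral => x _; have [d ed] := ball_chi_indic S x lq.
      by rewrite /omega ed ImM /= mulr0 add0r.
    apply: filterS2 c1 c2 => x c1 c2 Dx; apply/cvg_complex; split.
      by under eq_fun do rewrite Re_sum; exact: c1.
    by under eq_fun do rewrite Im_sum; exact: c2.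
  have shifted m := ae_affine S (- un m) (oner_neq0 K) (ReIm m).
  have := ae_foralln shifted.
  apply: filterS => x all; have [m xm] := u_surj S x.
  have := all m; rewrite !mul1r => /(_ ((qball00 _ _ _ _ _).2 xm)).
  by under eq_fun do (under eq_bigr do rewrite addrA subrK).
have [hk1 hk2] := hk k.
pose G x : R[i] := v * (chi (un k * x))^*.
have mG : cmeasurable G by apply: cmeasurableZ; exact: (cmeasurable_chiM S).
have lim : {ae mu, forall x : borel K, D x ->
   (fun n : nat => (\sum_(0 <= i < n) h (x + un i) * (chi (un k * (x + un i)))^* : cplx R))
     @ \oo --> (G x : cplx R)}.
  apply: filterS hv => x hx _.
  have -> : (fun n : nat => (\sum_(0 <= i < n) h (x + un i) *
      (chi (un k * (x + un i)))^* : cplx R)) =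
    (fun n : nat => (\sum_(0 <= i < n) h (x + un i) : cplx R) * ((chi (un k * x))^* : cplx R)).
    apply/funext => n; rewrite mulr_suml; apply: eq_bigr => i _.
    by rewrite mulrDr (chiD ch) (chi_uM S) mulr1.
  by apply: cvgMl.
have eRe := integral_of_periodized S hk1 (proj1 mG) _.
have eIm := integral_of_periodized S hk2 (proj2 mG) _.
rewrite /cintegral /Rintegral eRe; last first.
  apply: filterS lim => x hx /hx /cvg_complex[+ _].
  by under eq_fun do rewrite Re_sum.
rewrite eIm; last first.
  apply: filterS lim => x hx /hx /cvg_complex[_].
  by under eq_fun do rewrite Im_sum.
rewrite -(cintegral_chi_unit S k FF).
have ci : cintegrable mu (fun x => cindic (qball 0 0) x * (chi (un k * x))^*).
  apply: memL1_cintegrable => //; apply: (memL1M_chi S).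
  apply: (memL1_support (D := qball 0 0)) => //.
  - by rewrite (mu_qball0 S) ltry.
  - split; first exact: cmeasurable_indic.
    under eq_integral do rewrite sqmod_cindic.
    by rewrite integral_indic// setIT [X in (X < _)%E](mu_qball0 S) ltry.
  - by move=> x nx; rewrite /cindic indicE memNset.
rewrite -cintegralZ// /cintegral /Rintegral; congr (_ +i* _).
  congr fine; rewrite [LHS]integral_mkcond; apply: eq_integral => x _.
  rewrite patchE /cindic indicE /G; case: ifP => _.
    by rewrite mul1r.
  by rewrite mul0r mulr0.
congr fine; rewrite [LHS]integral_mkcond; apply: eq_integral => x _.
rewrite patchE /cindic indicE /G; case: ifP => _.
  by rewrite mul1r.
by rewrite mul0r mulr0.
Qed.
End FourierUniqueness.

(** * The affine system on the Fourier side *)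

Section AffineSystem.
Context {R : realType} {K : topologicalFieldType}.
Variables (mu : {measure set (borel K) -> \bar R}) (abs : K -> R) (p c : nat).
Variables (eps : 'I_c -> K) (varpi : K) (chi : K -> R[i]).
Hypothesis S : wavelet_setting mu abs p eps varpi chi.
Variable F : (K -> R[i]) -> (K -> R[i]).
Hypothesis FF : fourier_transform mu chi F.
Variables (L : nat) (psi : 'I_L -> K -> R[i]).
Hypothesis psi_L2 : forall l, memL2 mu (psi l).

Local Notation q := (p ^ c)%N.
Local Notation un := (u p eps varpi).
Local Notation qball := (qball abs p eps varpi).
Local Notation aff := (affine_system p eps varpi psi).
Local Notation hpsi := (fun l => F (psi l)).
Let A := ws_uabs S.
Let ch := ws_chi S.
Let w0 := prime_neq0 S.

(** The square root of q^j, the normalizing factor of the affine system. *)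
Definition dil_scale (j : int) : R := (q%:R : R) `^ (j%:~R / 2).

Lemma dil_scale_gt0 j : 0 < dil_scale j.
Proof. by rewrite /dil_scale powR_gt0// ltr0n (ws_q_gt0 S). Qed.

Lemma dil_scale_sqr j : dil_scale j ^+ 2 = q%:R ^ j.
Proof.
rewrite /dil_scale -powR_mulrn ?powR_ge0// -powRrM -mulrA mulVf ?mulr1//.
by rewrite powR_intmul// ltW// ltr0n (ws_q_gt0 S).
Qed.

Lemma dil_scale0 : dil_scale 0 = 1.
Proof. by rewrite /dil_scale mul0r powRr0. Qed.

(** The Fourier transform of the affine system: dilations become inverse
    dilations, and translations become multiplications by characters. *)
Definition affine_hat (t : 'I_L * int * nat) : K -> R[i] :=
  let: (l, j, k) := t in fun xi =>
    ((dil_scale j)^-1)%:C * (F (psi l) (varpi ^ j * xi) *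
      (chi (un k * (varpi ^ j * xi)))^*).

Let wz0 (j : int) : varpi ^ j != 0. Proof. exact: expfz_neq0. Qed.

Lemma memL2_dilate l (j : int) : memL2 mu (fun xi => F (psi l) (varpi ^ j * xi)).
Proof.
have := memL2_affine S 0 (wz0 j) (fourier_L2 FF (psi_L2 l)).
by under eq_fun do rewrite addr0.
Qed.

Lemma cmeasurable_chi_dil k (j : int) :
  cmeasurable (fun xi => (chi (un k * (varpi ^ j * xi)))^*).
Proof.
have := cmeasurable_chiM S (un k * varpi ^ j).
by under eq_fun do rewrite -mulrA.
Qed.

Lemma memL2_aff t : memL2 mu (aff t).
Proof.
case: t => [[l j] k]; apply: memL2Z.
have := memL2_affine S (- un k) (wz0 (- j)) (psi_L2 l); exact.
Qed.

Lemma memL2_affine_hat t : memL2 mu (affine_hat t).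
Proof.
case: t => [[l j] k]; apply: memL2Z; apply: memL2M; last exact: memL2_dilate.
  by move=> x; rewrite (sqmod_chi_conj S).
exact: cmeasurable_chi_dil.
Qed.

Lemma fourier_aff t : {ae mu, forall xi : borel K, F (aff t) xi = affine_hat t xi}.
Proof.
case: t => [[l j] k].
have Tl : memL2 mu (fun x => psi l (varpi ^ (- j) * x + - un k)).
  exact: (memL2_affine S (- un k) (wz0 (- j)) (psi_L2 l)).
have h1 := fourier_comb FF [:: ((dil_scale j)%:C, tt)] (fun=> Tl).
have h2 := fourier_affine S FF (- un k) (wz0 (- j)) (psi_L2 l).
have e1 : (fun x => \sum_(t <- [:: ((dil_scale j)%:C, tt)])
    t.1 * psi l (varpi ^ (- j) * x + - un k)) = aff (l, j, k).
  by apply/funext => x; rewrite big_seq1.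
rewrite e1 in h1; apply: filterS2 h1 h2 => x -> h2; rewrite big_seq1 /= h2.
have ej : (varpi ^ (- j))^-1 = varpi ^ j by rewrite invr_expz opprK.
rewrite (abs_primeV S) ej /affine_hat.
have -> : varpi ^ j * - un k * x = - (un k * (varpi ^ j * x)) by ring.
have s0 := lt0r_neq0 (dil_scale_gt0 j).
have -> : ((dil_scale j)^-1)%:C = (dil_scale j)%:C * ((q%:R ^ j)^-1)%:C.
  by rewrite -rmorphM /= -dil_scale_sqr; congr (_%:C); field.
by rewrite (chiN S) -!mulrA [_^* * _]mulrC.
Qed.

Lemma inner_affine_hat s t : inner mu (affine_hat s) (affine_hat t) = inner mu (aff s) (aff t).
Proof.
rewrite -(fourier_isometry FF (memL2_aff s) (memL2_aff t)).
apply: inner_ae; try exact: memL2_affine_hat; try exact/(fourier_L2 FF)/memL2_aff.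
- by apply: filterS (fourier_aff s) => x ->.
- by apply: filterS (fourier_aff t) => x ->.
Qed.

Definition affine_hat_orthonormal : Prop :=
  forall s t, inner mu (affine_hat s) (affine_hat t) = (s == t)%:R.

Lemma nrm2_fourier_comb f g (s : seq (R[i] * ('I_L * int * nat))) :
  memL2 mu f -> memL2 mu g -> {ae mu, forall x : borel K, F f x = g x} ->
  nrm2 mu (fun x => g x - \sum_(t <- s) t.1 * affine_hat t.2 x) =
  nrm2 mu (fun x => f x - \sum_(t <- s) t.1 * aff t.2 x).
Proof.
move=> fL gL fg.
have sL : memL2 mu (fun x => \sum_(t <- s) t.1 * aff t.2 x).
  exact: (memL2_comb memL2_aff).
rewrite -(nrm2_fourierB FF fL sL); apply: nrm2_ae.
- by have [] := memL2B gL (memL2_comb memL2_affine_hat s).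
- by have [] := memL2B (fourier_L2 FF fL) (fourier_L2 FF sL).
have comb := fourier_comb FF s memL2_aff.
have all : {ae mu, forall x : borel K, \sum_(t <- s) t.1 * F (aff t.2) x =
    \sum_(t <- s) t.1 * affine_hat t.2 x}.
  elim: {comb sL} s => [|t s ih]; first by apply: aeW => x; rewrite !big_nil.
  by apply: filterS2 ih (fourier_aff t.2) => x e1 e2; rewrite !big_cons e1 e2.
by apply: filterS3 fg comb all => x -> -> ->.
Qed.

(** The Fourier transform is unitary and maps the affine system to
    [affine_hat]. *)
Lemma basic_waveletsP : basic_wavelets mu p eps varpi psi <->
  affine_hat_orthonormal /\ (forall g, memL2 mu g -> in_closed_span mu affine_hat g).
Proof.
split=> [[_ ON dense]|[ON dense]]; last first.
  split; [exact: memL2_aff|by move=> s t; rewrite -inner_affine_hat ON|].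
  move=> f fL r r0; have FL := fourier_L2 FF fL.
  have [s hs] := dense _ FL r r0; exists s.
  have e := nrm2_fourier_comb s fL FL (aeW _ (fun=> erefl)).
  by move: hs; rewrite e.
split; first by move=> s t; rewrite inner_affine_hat ON.
move=> g gL r r0; have [f fL fg] := fourier_surj FF gL.
have [s hs] := dense f fL r r0; exists s.
by rewrite (nrm2_fourier_comb s fL gL fg).
Qed.

(** * Orthonormality as a condition on the periodizations *)

Definition correlation (l m : 'I_L) (j : nat) : K -> R[i] :=
  fun xi => F (psi l) xi * (F (psi m) (varpi ^- j * xi))^*.

Let dilN m (j : nat) : memL2 mu (fun xi => F (psi m) (varpi ^- j * xi)).
Proof. by have := memL2_dilate m (- j%:Z); rewrite -exprnN. Qed.

Lemma cintegrable_correlation l m j : cintegrable mu (correlation l m j).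
Proof. by apply: memL2_cintegrable => //; exact: (fourier_L2 FF). Qed.

Lemma cintegrable_correlation_chi l m j k :
  cintegrable mu (fun xi => correlation l m j xi * (chi (un k * xi))^*).
Proof.
have h : memL2 mu (fun xi => F (psi l) xi * (chi (un k * xi))^*).
  apply: memL2M; last exact: (fourier_L2 FF).
    by move=> x; rewrite (sqmod_chi_conj S).
  exact: (cmeasurable_chiM S).
have := memL2_cintegrable h (dilN m j).
by congr cintegrable; apply/funext => x; rewrite /correlation mulrAC.
Qed.

Lemma correlation_condO :
  (forall l m j k, cintegral mu (fun xi => correlation l m j xi * (chi (un k * xi))^*) =
     ((j == 0%N) && (l == m))%:R * (k == 0%N)%:R) <->
  cond_O mu p eps varpi hpsi.
Proof.
split=> [h l m j|h l m j].
  have := (fourier_coefficients_periodization S FF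
    ((j == 0%N) && (l == m))%:R (cintegrable_correlation l m j)
    (cintegrable_correlation_chi l m j)).1 (h l m j).
  exact.
exact: (fourier_coefficients_periodization S FF
    ((j == 0%N) && (l == m))%:R (cintegrable_correlation l m j)
    (cintegrable_correlation_chi l m j)).2 (h l m j).
Qed.

(** Scaling by varpi^j1 turns the inner product of two elements of the affine
    system with dilation exponents j1 >= j2 into a Fourier coefficient of the
    correlation. In the rescaled variable the second character has the
    index k2 q^j, and k3 is the index of u(k1) - u(k2 q^j). *)
Lemma inner_affine_hat_correlation l m (j2 : int) (j k1 k2 : nat) : exists k3,
  inner mu (affine_hat (l, j2 + j%:Z, k1)) (affine_hat (m, j2, k2)) =
  ((dil_scale (j2 + j%:Z))^-1 * (dil_scale j2)^-1 * q%:R ^ (j2 + j%:Z))%:C *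
    cintegral mu (fun xi => correlation l m j xi * (chi (un k3 * xi))^*) /\
  (k3 == 0%N) = (k1 == k2 * q ^ j)%N /\ un k1 - un (k2 * q ^ j) = un k3.
Proof.
pose j1 := j2 + j%:Z.
have [k3 e3] := u_sub S k1 (k2 * q ^ j); exists k3; split; last first.
  split => //; apply/eqP/eqP => [k30|k12]; apply: (u_inj S).
    by rewrite e3 k30 u_at0 (uabs0 A).
  by rewrite u_at0 subr0 -e3 k12 subrr (uabs0 A).
pose H xi := correlation l m j xi * (chi (un k3 * xi))^*.
have Hi : cintegrable mu H by exact: cintegrable_correlation_chi.
have ej x : varpi ^- j * (varpi ^ j1 * x) = varpi ^ j2 * x.
  by rewrite mulrA /j1 expfzDr// mulrCA mulVf ?mulr1// expf_neq0.
have echi x : Num.conj (chi (un k3 * (varpi ^ j1 * x))) =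
    (chi (un k1 * (varpi ^ j1 * x)))^* * chi (un k2 * (varpi ^ j2 * x)).
  rewrite -[LHS]/((chi (un k3 * (varpi ^ j1 * x)))^*).
  rewrite -e3 (u_mulq S) mulrBl (chiD ch) rmorphM /= (chiN S) conjcK.
  congr (_ * chi _); rewrite -ej; move: (varpi ^- j) (varpi ^ j1 * x) => s t; ring.
transitivity (cintegral mu (fun x =>
    ((dil_scale j1)^-1 * (dil_scale j2)^-1)%:C * H (varpi ^ j1 * x + 0))).
  congr cintegral; apply/funext => x; rewrite addr0 /affine_hat -/j1 /H /correlation.
  have cr (t : R) : Num.conj (t%:C : R[i]) = t%:C by exact: conjc_real.
  rewrite ej echi !rmorphM /= conjCK cr.
  ring.
have Hi' := cintegrable_affine S 0 (wz0 j1) Hi.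
rewrite cintegralZ// (cintegral_affine S 0 (wz0 j1) Hi) mulrA -rmorphM /=.
congr (_%:C * _); congr (_ * _).
by rewrite (uabsXz A) (abs_prime S) exprz_inv invr_expz opprK.
Qed.

(** By conjugate symmetry it is enough to consider pairs with j1 >= j2. *)
Lemma affine_hat_orthonormal_condO : affine_hat_orthonormal <-> cond_O mu p eps varpi hpsi.
Proof.
rewrite -correlation_condO; split=> [ON l m j k|h].
  have [k3 [e [_ k3E]]] := inner_affine_hat_correlation l m (- j%:Z) j k 0.
  rewrite mul0n u_at0 subr0 in k3E.
  have k3k : k = k3 by apply: (u_inj S); rewrite k3E subrr (uabs0 A).
  move: e; rewrite ON !xpair_eqE addNr -k3k.
  have [->|j0] := eqVneq j 0%N.
    by rewrite oppr0 eqxx andbT dil_scale0 expr0z invr1 !mulr1 mul1r -natrM mulnb.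
  rewrite [0 == _]eq_sym oppr_eq0 eqz_nat (negbTE j0) andbF /= mul0r => /esym/eqP.
  rewrite mulf_eq0 => /orP[|/eqP//].
  rewrite dil_scale0 expr0z invr1 mul1r mulr1 => /eqP/(congr1 (@complex.Re R)) /= e.
  by have := dil_scale_gt0 (- j%:Z); rewrite -invr_gt0 e ltxx.
have half l m (j2 : int) (j k1 k2 : nat) :
    inner mu (affine_hat (l, j2 + j%:Z, k1)) (affine_hat (m, j2, k2)) =
    ((l, j2 + j%:Z, k1) == (m, j2, k2))%:R.
  have [k3 [-> [k30 _]]] := inner_affine_hat_correlation l m j2 j k1 k2.
  have e5 : (j2 + j%:Z == j2) = (j == 0%N).
    by rewrite -[eqbRHS]addr0 (inj_eq (addrI j2)) eqz_nat.
  rewrite h k30 !xpair_eqE e5.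
  have [->|j0] := eqVneq j 0%N; last first.
    by rewrite /= mul0r mulr0 andbF.
  rewrite addr0 andbT /= expn0 muln1 -natrM mulnb.
  rewrite [X in X * _](_ : _ = 1) ?mul1r//.
  rewrite -invfM -expr2 dil_scale_sqr mulVf//.
  by rewrite gt_eqF// (qexpz_gt0 S).
move=> [[l j1] k1] [[m j2] k2].
have [j12|/ltW j12] := leP j2 j1.
  have -> : j1 = j2 + `|j1 - j2|%N%:Z by rewrite gez0_abs ?subr_ge0// addrCA subrr addr0.
  exact: half.
have -> : j2 = j1 + `|j2 - j1|%N%:Z by rewrite gez0_abs ?subr_ge0// addrCA subrr addr0.
rewrite (inner_conj (memL2_affine_hat _) (memL2_affine_hat _)) half conjc_nat.
by rewrite eq_sym.
Qed.
End AffineSystem.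

(** * Energies of balls *)

Section Energy.
Context {R : realType} {K : topologicalFieldType}.
Variables (mu : {measure set (borel K) -> \bar R}) (abs : K -> R) (p c : nat).
Variables (eps : 'I_c -> K) (varpi : K) (chi : K -> R[i]).
Hypothesis S : wavelet_setting mu abs p eps varpi chi.
Variable F : (K -> R[i]) -> (K -> R[i]).
Hypothesis FF : fourier_transform mu chi F.
Variables (L : nat) (psi : 'I_L -> K -> R[i]).
Hypothesis psi_L2 : forall l, memL2 mu (psi l).

Local Notation q := (p ^ c)%N.
Local Notation un := (u p eps varpi).
Local Notation qball := (qball abs p eps varpi).
Local Notation affine_hat := (affine_hat p eps varpi chi F psi).
Let A := ws_uabs S.
Let w0 := prime_neq0 S.
Let wz0 (j : int) : varpi ^ j != 0. Proof. exact: expfz_neq0. Qed.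
Let affine_hatL := memL2_affine_hat S FF psi_L2.

Lemma memL2_indicator (B : set K) : measurable (B : set (borel K)) ->
  (mu B < +oo)%E -> memL2 mu (cindic B : K -> R[i]) /\
  nrm2 mu (cindic B : K -> R[i]) = mu B.
Proof.
move=> mB Boo; have e : nrm2 mu (cindic B : K -> R[i]) = mu B.
  rewrite /nrm2; under eq_integral do rewrite sqmod_cindic.
  by rewrite integral_indic// setIT.
split => //; split; first exact: cmeasurable_indic.
by rewrite -/(nrm2 mu _) e.
Qed.

Definition dilated (x : 'I_L * int) : K -> R[i] :=
  fun xi => F (psi x.1) (varpi ^ (- x.2) * xi).

Lemma memL2_dilated x : memL2 mu (dilated x).
Proof. exact: (memL2_dilate S FF psi_L2 x.1 (- x.2)). Qed.

Lemma measurable_sqmod_dilated x :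
  measurable_fun [set: borel K] (fun xi : borel K => (sqmod (dilated x xi))%:E).
Proof. by apply: cmeasurable_Esqmod; case: (memL2_dilated x). Qed.

(** The share of the measure of B that the wavelet number l can account for at
    scale j. It is real because the dilated function is square integrable. *)
Definition energy (B : set K) (x : 'I_L * int) : R :=
  fine (\int[mu]_(xi in B) (sqmod (dilated x xi))%:E)%E.

Lemma energyE (B : set K) x : measurable (B : set (borel K)) ->
  ((energy B x)%:E = \int[mu]_(xi in B) (sqmod (dilated x xi))%:E)%E.
Proof.
move=> mB; rewrite /energy fineK// ge0_fin_numE; last first.
  by apply: integral_ge0 => xi _; rewrite lee_fin sqmod_ge0.
apply: le_lt_trans (memL2_dilated x).2.
apply: ge0_subset_integral => //; first exact: measurable_sqmod_dilated.
by move=> xi _; rewrite lee_fin sqmod_ge0.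
Qed.

Lemma energy_ge0 B x : 0 <= energy B x.
Proof.
apply: fine_ge0; apply: integral_ge0 => xi _; rewrite lee_fin; exact: sqmod_ge0.
Qed.

(** The coefficients of the indicator of B at scale j. The exponent is negated
    because the element of index j of the system involves varpi^j, while the
    energy involves varpi^-j. *)
Definition coef (B : set K) (x : 'I_L * int) (k : nat) : R[i] :=
  inner mu (cindic B) (affine_hat (x.1, - x.2, k)).

(** Parseval's identity for the dilated function restricted to B, available when
    varpi^-j B fits in a translate of D. *)
Lemma coef_energy (B : set K) x a : measurable (B : set (borel K)) ->
  (mu B < +oo)%E -> (forall xi, B xi -> abs (varpi ^ (- x.2) * xi - a) <= 1) ->
  (\sum_(k <oo) (sqmod (coef B x k))%:E = (energy B x)%:E)%E.
Proof.
move=> mB Boo supp; have [BL _] := memL2_indicator mB Boo.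
case: x supp => l j /= supp; set w := varpi ^ (- j) in supp.
pose g xi : R[i] := dilated (l, j) xi * cindic B xi.
have gL : memL2 mu g by apply: memL2_cindic => //; exact: memL2_dilated.
have gsupp xi : g xi != 0 -> abs (w * xi - a) <= 1.
  move=> g0; apply: supp; apply: contrapT => nB; move: g0.
  by rewrite /g /cindic indicE memNset//= mulr0 eqxx.
have s0 := dil_scale_gt0 S (- j).
have e1 k : sqmod (coef B (l, j) k) = q%:R ^ j *
    sqmod (cintegral mu (fun xi => g xi * (chi (un k * (w * xi)))^*)).
  rewrite /coef (inner_conj (affine_hatL _) BL) sqmod_conj /inner.
  have -> : (fun xi => affine_hat (l, - j, k) xi * (cindic B xi)^*) =
      (fun xi => ((dil_scale p c (- j))^-1)%:C * (g xi * (chi (un k * (w * xi)))^*)).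
    apply/funext => xi; rewrite /g /= /dilated /=.
    have -> : Num.conj (cindic B xi : R[i]) = cindic B xi by exact: conjc_real.
    by rewrite -!mulrA; congr (_ * (_ * _)); rewrite mulrC.
  rewrite cintegralZ; last first.
    have h : memL2 mu (fun xi => dilated (l, j) xi * (chi (un k * (w * xi)))^*).
      apply: memL2M; last exact: memL2_dilated.
        by move=> xi; rewrite (sqmod_chi_conj S).
      exact: (cmeasurable_chi_dil S).
    have := memL2_cintegrable h BL.
    congr cintegrable; apply/funext => xi; rewrite /g.
    have -> : Num.conj (cindic B xi : R[i]) = cindic B xi by exact: conjc_real.
    by rewrite mulrAC.
  rewrite sqmodM; congr (_ * _); rewrite sqmod_real exprVn dil_scale_sqr.
  by rewrite invr_expz opprK.
under eq_eseriesr do rewrite e1 EFinM.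
rewrite nneseriesZl; last by move=> k _; rewrite lee_fin sqmod_ge0.
rewrite (parseval_scaled S FF (wz0 (- j)) gL gsupp) energyE//.
rewrite (nrm2_cindic _ (dilated (l, j)) mB) muleA -EFinM (abs_primeV S) divff ?mul1e//.
by rewrite gt_eqF// (qexpz_gt0 S).
Qed.

Let mq n k := measurable_qball S n k.
Let muq n k : (mu (qball n k) < +oo)%E.
Proof. by rewrite (mu_qball S) ltry. Qed.

Lemma memL2_qball n k : memL2 mu (cindic (qball n k) : K -> R[i]).
Proof. exact: (memL2_indicator (mq n k) (muq n k)).1. Qed.

Lemma nrm2_qball n k : nrm2 mu (cindic (qball n k) : K -> R[i]) = (q%:R ^ (- n))%:E.
Proof. by rewrite (memL2_indicator (mq n k) (muq n k)).2 (mu_qball S). Qed.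

(** For j <= N the dilation by varpi^-j maps a ball of radius q^-N into a
    translate of D. *)
Lemma coef_energy_small (N : int) i x : x.2 <= N ->
  (\sum_(k <oo) (sqmod (coef (qball N i) x k))%:E = (energy (qball N i) x)%:E)%E.
Proof.
move=> xN; apply: (coef_energy (a := varpi ^ (N - x.2) * un i) (mq N i) (muq N i)).

move=> xi xiN.
have -> : varpi ^ (- x.2) * xi - varpi ^ (N - x.2) * un i =
    varpi ^ (N - x.2) * (varpi ^ (- N) * xi - un i).
  rewrite mulrBr mulrA -expfzDr//; congr (varpi ^ _ * _ - _).
  by rewrite addrAC subrr add0r.
rewrite (uabsM A) -[leRHS]mulr1 ler_pM ?(uabs_ge0 A)//.
rewrite -[N - _]opprK (abs_primeV S) opprB.
have -> : x.2 - N = - (`|N - x.2|%N)%:Z by rewrite gez0_abs ?subr_ge0// opprB.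
by rewrite -exprnN invf_le1 ?exprn_gt0 ?ltr0n ?(ws_q_gt0 S)// exprn_ege1// ler1n (ws_q_gt0 S).
Qed.

Lemma cindic_sub (n : int) (M : nat) k xi : cindic (qball n k) xi =
  \sum_(j < q ^ M) cindic (qball (n + M%:Z) (k * q ^ M + j)) xi :> R[i].
Proof.
rewrite /cindic -rmorph_sum /=; congr (_%:C).
rewrite indicE; case: (boolP (xi \in qball n k)).
  move=> /set_mem/(qball_sub S n M k)[j jM xij].
  rewrite (bigD1 (Ordinal jM))//= big1 ?addr0; first by rewrite indicE mem_set.
  move=> j' /eqP jj'; rewrite indicE memNset// => xij'; apply: jj'; apply: val_inj => /=.
  by have /(@addnI _ _ _) := qball_inj S xij' xij.
rewrite notin_setE => nxi; rewrite big1// => j _; rewrite indicE memNset// => xij.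
by apply: nxi; apply/(qball_sub S n M); exists j.
Qed.

Lemma coef_sub (n : int) (M : nat) k x i :
  coef (qball n k) x i = \sum_(j < q ^ M) coef (qball (n + M%:Z) (k * q ^ M + j)) x i.
Proof.
rewrite /coef -(inner_suml (index_enum _)
  (fun j : 'I_(q ^ M) => memL2_qball (n + M%:Z) (k * q ^ M + j)) (affine_hatL _)).
by congr inner; apply/funext => xi; rewrite (cindic_sub n M).
Qed.

Lemma energy_sub (n : int) (M : nat) k x :
  energy (qball n k) x = \sum_(j < q ^ M) energy (qball (n + M%:Z) (k * q ^ M + j)) x.
Proof.
apply: EFin_inj; rewrite energyE; last exact: mq.
rewrite -sumEFin (qball_sub_bigsetU S n M) ge0_integral_bigsetU//.
- by apply: eq_bigr => j _; rewrite energyE//; exact: mq.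
- exact: index_enum_uniq.
- by move=> a b _ _ [y [ya yb]]; exact: val_inj (addnI (qball_inj S ya yb)).
- by apply: measurable_funTS; exact: measurable_sqmod_dilated.
- by move=> xi _; rewrite lee_fin sqmod_ge0.
Qed.

(** A ball too large for the scale j is cut into q^(j - N) smaller ones, for
    which Parseval's identity holds; the Cauchy-Schwarz inequality costs a factor
    q^(j - N). *)
Lemma coef_energy_le (N : int) i x n :
  \sum_(0 <= k < n) sqmod (coef (qball N i) x k) <=
  (1 + q%:R ^ (x.2 - N)) * energy (qball N i) x.
Proof.
have small N' i' : x.2 <= N' ->
    \sum_(0 <= k < n) sqmod (coef (qball N' i') x k) <= energy (qball N' i') x.
  move=> xN; rewrite -lee_fin -coef_energy_small// -sumEFin.
  by apply: nneseries_lim_ge => k _ _; rewrite lee_fin sqmod_ge0.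
have qe := ltW (qexpz_gt0 S (x.2 - N)); have e0 := energy_ge0 (qball N i) x.
have [/small xN|/ltW Nx] := leP x.2 N.
  by apply: le_trans (xN i) _; rewrite mulrDl mul1r lerDl mulr_ge0.
pose d := `|x.2 - N|%N; have dE : d%:Z = x.2 - N by rewrite gez0_abs ?subr_ge0.
have Nd : N + d%:Z = x.2 by rewrite dE addrCA subrr addr0.
rewrite mulrDl mul1r; apply: (@le_trans _ _ (q%:R ^ (x.2 - N) * energy (qball N i) x)).
  rewrite (energy_sub N d) -dE mulr_sumr.
  apply: (@le_trans _ _ (\sum_(j < q ^ d) q%:R ^ d *
      \sum_(0 <= k < n) sqmod (coef (qball (N + d%:Z) (i * q ^ d + j)) x k))).
    rewrite -mulr_sumr exchange_big /= mulr_sumr; apply: ler_sum => k _.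
    rewrite (coef_sub N d) -exprnP -(natrX _ q d).
    exact: (sqmod_sum_le _ (fun j => coef (qball (N + d%:Z) (i * q ^ d + j)) x k)).
  apply: ler_sum => j _; rewrite ler_wpM2l ?exprn_ge0//.
  by apply: small; rewrite Nd.
by rewrite lerDr.
Qed.
End Energy.

(** * Bessel's inequality for the energies *)

Section Completeness.
Context {R : realType} {K : topologicalFieldType}.
Variables (mu : {measure set (borel K) -> \bar R}) (abs : K -> R) (p c : nat).
Variables (eps : 'I_c -> K) (varpi : K) (chi : K -> R[i]).
Hypothesis S : wavelet_setting mu abs p eps varpi chi.
Variable F : (K -> R[i]) -> (K -> R[i]).
Hypothesis FF : fourier_transform mu chi F.
Variables (L : nat) (psi : 'I_L -> K -> R[i]).
Hypothesis psi_L2 : forall l, memL2 mu (psi l).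

Local Notation q := (p ^ c)%N.
Local Notation un := (u p eps varpi).
Local Notation qball := (qball abs p eps varpi).
Local Notation affine_hat := (affine_hat p eps varpi chi F psi).
Local Notation energy := (energy mu varpi F psi).
Local Notation coef := (coef mu p eps varpi chi F psi).
Local Notation dilated := (dilated varpi F psi).
Let A := ws_uabs S.
Let w0 := prime_neq0 S.
Let wz0 (j : int) : varpi ^ j != 0. Proof. exact: expfz_neq0. Qed.
Let affine_hatL := memL2_affine_hat S FF psi_L2.
Let energyE' := energyE S FF psi_L2.
Let mq n k := measurable_qball S n k.

(** Finite sets of indices that treat all the pairs in s alike, with the exponent
    negated as in [coef]. *)
Definition scale_box (s : seq ('I_L * int)) (n : nat) : seq ('I_L * int * nat) :=
  [seq (x.1, - x.2, k) | x <- s, k <- index_iota 0 n].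

Lemma scale_box_uniq s n : uniq s -> uniq (scale_box s n).
Proof.
move=> us; apply: allpairs_uniq => //; first exact: iota_uniq.
by move=> [[l j] k] [[l' j'] k'] _ _ /= [-> /oppr_inj -> ->].
Qed.

Lemma sum_scale_box B s n :
  \sum_(t <- scale_box s n) sqmod (inner mu (cindic B) (affine_hat t)) =
  \sum_(x <- s) \sum_(0 <= k < n) sqmod (coef B x k).
Proof. by rewrite big_allpairs_dep. Qed.

Lemma energy_series (N : int) i s : (forall x, x \in s -> x.2 <= N) ->
  (\sum_(x <- s) (energy (qball N i) x)%:E =
   \sum_(k <oo) (\sum_(x <- s) sqmod (coef (qball N i) x k))%:E)%E.
Proof.
move=> sN; under eq_eseriesr do rewrite -sumEFin.
rewrite nneseries_sum; last by move=> x k _; rewrite lee_fin sqmod_ge0.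
rewrite big_seq [RHS]big_seq; apply: eq_bigr => x xs.
by rewrite (coef_energy_small S FF psi_L2)// sN.
Qed.

Lemma scale_bound (s : seq ('I_L * int)) (n : int) :
  exists M : nat, forall x, x \in s -> x.2 <= n + M%:Z.
Proof.
elim: s => [|x s [M ih]]; first by exists 0%N.
exists (M + `|x.2 - n|)%N => y; rewrite inE => /orP[/eqP ->|/ih]; last first.
  by move=> /le_trans; apply; rewrite PoszD addrA lerDl.
rewrite !PoszD abszE addrA -lerBlDl opprD addrA.
by apply: le_trans (ler_norm _); rewrite lerBlDr lerDl.
Qed.

Section Bessel.
Hypothesis ON : affine_hat_orthonormal mu p eps varpi chi F psi.

Let bessel_small (N : int) i s : uniq s -> (forall x, x \in s -> x.2 <= N) ->
  \sum_(x <- s) energy (qball N i) x <= q%:R ^ (- N).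
Proof.
move=> us sN; rewrite -lee_fin -sumEFin energy_series//.
apply: lime_le.
  apply: is_cvg_nneseries => k _ _; rewrite lee_fin.
  by apply: sumr_ge0 => x _; exact: sqmod_ge0.
apply: nearW => n; rewrite sumEFin lee_fin exchange_big /= -sum_scale_box.
rewrite -[leRHS]/(fine (q%:R ^ (- N))%:E) -(nrm2_qball S N i).
apply: (bessel affine_hatL ON); last exact: scale_box_uniq.
exact: (memL2_qball S).
Qed.

(** The ball is cut into balls so small that Parseval's identity holds for all
    the scales in s; Bessel's inequality is then applied to each of them. *)
Lemma energy_bessel (n : int) k s : uniq s ->
  \sum_(x <- s) energy (qball n k) x <= q%:R ^ (- n).
Proof.
move=> us; have [M sM] := scale_bound s n.
under eq_bigr do rewrite (energy_sub S FF psi_L2 n M).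
rewrite exchange_big /=.
apply: (@le_trans _ _ (\sum_(j < q ^ M) q%:R ^ (- (n + M%:Z)))).
  by apply: ler_sum => j _; exact: bessel_small.
have q0 : (q%:R : R) != 0 by rewrite pnatr_eq0 -lt0n (ws_q_gt0 S).
rewrite sumr_const card_ord -[leLHS]mulr_natl (natrX _ q M) exprnP -expfzDr//.
by rewrite opprD addrCA addrN addr0.
Qed.

Lemma energy_bessel_esum (n : int) k :
  (\esum_(x in [set: 'I_L * int]) (energy (qball n k) x)%:E <= (q%:R ^ (- n))%:E)%E.
Proof. by apply: esum_le_seq => s us; rewrite sumEFin lee_fin energy_bessel. Qed.
End Bessel.

(** * The rescaled energy *)

Lemma qball_abs n k x : (0 < k)%N -> qball n k x -> abs x = abs (varpi ^ n * un k).
Proof.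
move=> k0 xk; have uk := abs_u_gt1 S k0.
have e : abs (varpi ^ (- n) * x) = abs (un k).
  apply: (uabs_dist_max A); rewrite -(uabsN A) opprB.
  exact: le_lt_trans xk uk.
rewrite (uabsM A) -e (uabsM A) mulrA -(uabsM A) -expfzDr// subrr expr0z.
by rewrite (uabs1 A) mul1r.
Qed.

(** The change of variable y = varpi^-j xi, which replaces the dilated functions
    by the transform of a single wavelet on varying sets. *)
Lemma energy_rescale (B : set K) x : measurable (B : set (borel K)) ->
  ((q%:R ^ x.2 * energy B x)%:E =
   \int[mu]_(y in (fun y => varpi ^ x.2 * y + 0)%R @^-1` B) (sqmod (F (psi x.1) y))%:E)%E.
Proof.
move=> mB; rewrite EFinM energyE'//.
have -> : q%:R ^ x.2 = (abs (varpi ^ x.2))^-1.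
  by rewrite -(abs_primeV S) -(uabsV A) invr_expz.
rewrite -(ge0_integral_affine S 0 (wz0 x.2) mB); last 2 first.
- exact: (measurable_sqmod_dilated S FF psi_L2).
- by move=> y; rewrite lee_fin sqmod_ge0.
apply: eq_integral => y _; rewrite /dilated /dilated addr0 mulrA -expfzDr//.
by rewrite addNr expr0z mul1r.
Qed.

Lemma measurable_sqmod_F l :
  measurable_fun [set: borel K] (fun y : borel K => (sqmod (F (psi l) y))%:E).
Proof. by apply: cmeasurable_Esqmod; case: (fourier_L2 FF (psi_L2 l)). Qed.

Lemma measurable_dil_preimage (B : set K) (j : int) : measurable (B : set (borel K)) ->
  measurable ((fun y => varpi ^ j * y + 0) @^-1` B : set (borel K)).
Proof.
by move=> mB; rewrite -[X in measurable X]setTI; exact: measurable_affine.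
Qed.

(** A point has at most one multiple by a power of the prime element with a
    prescribed nonzero absolute value. *)
Lemma trivIset_dilates (B : set K) (r : R) : 0 < r -> (forall x, B x -> abs x = r) ->
  trivIset setT (fun j : int => (fun y => varpi ^ j * y + 0) @^-1` B).
Proof.
move=> r0 Br i j _ _ [y [/= yi yj]]; rewrite !addr0 in yi yj.
have := Br _ yi; rewrite -(Br _ yj) !(uabsM A) => /mulIf e.
have y0 : abs y != 0.
  by apply: contraTneq r0 => y0; rewrite -(Br _ yi) (uabsM A) y0 mulr0 ltxx.
move: (e y0); rewrite -(opprK i) -(opprK j) !(abs_primeV S) => h.
congr (- _); apply: (ieexprIz _ _ h); first by rewrite ltr0n (ws_q_gt0 S).
by rewrite pnatr_eq1 gtn_eqF// (ws_q_gt1 S).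
Qed.

(** The absolute value is a nonzero constant on a ball that avoids 0, so its
    dilates are disjoint and the rescaled energies of one wavelet add up to at
    most its squared norm. *)
Lemma rescaled_energy_finite (n : int) k : (0 < k)%N ->
  (\esum_(x in [set: 'I_L * int]) (q%:R ^ x.2 * energy (qball n k) x)%:E < +oo)%E.
Proof.
move=> k0; have uk := abs_u_gt1 S k0.
have r0 : 0 < abs (varpi ^ n * un k).
  by rewrite (uabsM A) mulr_gt0 //; [apply: (uabs_gt0 A)|exact: lt_trans uk].
have tD := trivIset_dilates r0 (fun x => @qball_abs n k x k0).
rewrite -(@sum_esum_pair _ _ _ (fun x => (q%:R ^ x.2 * energy (qball n k) x)%:E)); last first.
  by move=> x; rewrite lee_fin mulr_ge0 ?energy_ge0 ?ltW ?(qexpz_gt0 S).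
apply: lte_sum_pinfty => l _; under eq_esum do rewrite energy_rescale//=.
rewrite esum_integral_disjoint//=.
- apply: le_lt_trans (fourier_L2 FF (psi_L2 l)).2.
  apply: ge0_subset_integral => //.
  + apply: countable_bigcupT_measurable => [|j]; first exact: countableP.
    exact: measurable_dil_preimage.
  + exact: measurable_sqmod_F.
  + by move=> y _; rewrite lee_fin sqmod_ge0.
- by move=> j; exact: measurable_dil_preimage.
- exact: measurable_sqmod_F.
- by move=> y; rewrite lee_fin sqmod_ge0.
Qed.
End Completeness.

(** * Tight balls and completeness *)

Section Tightness.
Context {R : realType} {K : topologicalFieldType}.
Variables (mu : {measure set (borel K) -> \bar R}) (abs : K -> R) (p c : nat).
Variables (eps : 'I_c -> K) (varpi : K) (chi : K -> R[i]).
Hypothesis S : wavelet_setting mu abs p eps varpi chi.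
Variable F : (K -> R[i]) -> (K -> R[i]).
Hypothesis FF : fourier_transform mu chi F.
Variables (L : nat) (psi : 'I_L -> K -> R[i]).
Hypothesis psi_L2 : forall l, memL2 mu (psi l).

Local Notation q := (p ^ c)%N.
Local Notation un := (u p eps varpi).
Local Notation qball := (qball abs p eps varpi).
Local Notation affine_hat := (affine_hat p eps varpi chi F psi).
Local Notation energy := (energy mu varpi F psi).
Local Notation coef := (coef mu p eps varpi chi F psi).
Let affine_hatL := memL2_affine_hat S FF psi_L2.
Let q0 : (q%:R : R) != 0. Proof. by rewrite pnatr_eq0 -lt0n (ws_q_gt0 S). Qed.

Hypothesis ON : affine_hat_orthonormal mu p eps varpi chi F psi.

(** Equality in Bessel's inequality: the wavelets account for the whole measure
    q^-n of the ball. *)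
Definition tight_ball (n : int) (k : nat) : Prop :=
  (\esum_(x in [set: 'I_L * int]) (energy (qball n k) x)%:E = (q%:R ^ (- n))%:E)%E.

(** The squared norm of the indicator is approached by its projections, whose
    squared norms are finite sums of squared coefficients; [coef_energy_le]
    bounds these by the energies. *)
Lemma dense_energy_ge (N : int) i : in_closed_span mu affine_hat (cindic (qball N i)) ->
  ((q%:R ^ (- N))%:E <= \esum_(x in [set: 'I_L * int])
    ((1 + q%:R ^ (x.2 - N)) * energy (qball N i) x)%:E)%E.
Proof.
move=> dense; apply/lee_addgt0Pr => e e0; have [s se] := dense e e0.
pose n := (\max_(t <- s) t.2.2).+1.
pose X := undup [seq (t.2.1.1, - t.2.1.2) | t <- s].
have uX : uniq X by exact: undup_uniq.
have sX t : t \in s -> t.2 \in scale_box X n.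
  move=> ts; apply/allpairsP; exists ((t.2.1.1, - t.2.1.2), t.2.2) => /=; split.
  - by rewrite mem_undup; apply/mapP; exists t.
  - by rewrite mem_index_iota ltnS /=; exact: leq_bigmax_seq.
  - by case: t ts => a [[l j] k] /= _; rewrite opprK.
have uT := scale_box_uniq n uX.
have := le_lt_trans (onproj_best affine_hatL ON (memL2_qball S N i) uT sX) se.
rewrite (nrm2_sub_onproj affine_hatL ON (memL2_qball S N i) uT) (nrm2_qball S) /=.
rewrite lte_fin ltrBlDl => lt1; apply: (@le_trans _ _
    ((\sum_(t <- scale_box X n) sqmod (inner mu (cindic (qball N i)) (affine_hat t)))%:E
      + e%:E)%E).
  by rewrite -EFinD lee_fin; exact: ltW lt1.
rewrite leeD2r//; apply: le_trans (seq_le_esum _ uX).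
rewrite sumEFin lee_fin sum_scale_box; apply: ler_sum => x _.
exact: (coef_energy_le S FF psi_L2).
Qed.

(** The bound [dense_energy_ge] is applied to the q^M parts of level n + M of the
    ball. The sum of the bounds exceeds the total energy of the ball by q^-(n + M)
    times its rescaled energy, which is finite because the ball avoids 0; let M
    tend to infinity. *)
Lemma dense_tight (n : int) k : (0 < k)%N ->
  (forall N i, in_closed_span mu affine_hat (cindic (qball N i))) -> tight_ball n k.
Proof.
move=> k0 dense; apply/eqP; rewrite eq_le (energy_bessel_esum S FF psi_L2 ON) /=.
set E := esum _ _.
pose G := (\esum_(x in [set: 'I_L * int]) (q%:R ^ x.2 * energy (qball n k) x)%:E)%E.
have G0 : (0 <= G)%E.
  by apply: esum_ge0 => x _; rewrite lee_fin mulr_ge0 ?energy_ge0 ?ltW ?(qexpz_gt0 S).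
have Goo : (G < +oo)%E := rescaled_energy_finite S FF psi_L2 n k0.
have step (M : nat) : ((q%:R ^ (- n))%:E <= E + (q%:R ^ (- (n + M%:Z)))%:E * G)%E.
  set N := n + M%:Z.
  apply: (@le_trans _ _ (\esum_(x in [set: 'I_L * int])
      ((1 + q%:R ^ (x.2 - N)) * energy (qball n k) x)%:E)%E).
    have eM : (q%:R ^ (- n))%:E = (\sum_(j < q ^ M) (q%:R ^ (- N))%:E)%E :> \bar R.
      rewrite sumEFin sumr_const card_ord; congr EFin.
      rewrite -[RHS]mulr_natl (natrX _ q M) exprnP -expfzDr//.
      by rewrite /N opprD addrCA addrN addr0.
    rewrite eM; apply: (@le_trans _ _ (\sum_(j < q ^ M) \esum_(x in [set: 'I_L * int])
      ((1 + q%:R ^ (x.2 - N)) * energy (qball N (k * q ^ M + j)) x)%:E)%E).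
      by apply: lee_sum => j _; apply: dense_energy_ge; exact: dense.
    rewrite -esum_sum; last first.
      move=> x j _ _; rewrite lee_fin mulr_ge0 ?energy_ge0//.
      by rewrite addr_ge0// ltW// (qexpz_gt0 S).
    apply: le_esum => x _; rewrite sumEFin lee_fin -mulr_sumr.
    by rewrite -(energy_sub S FF psi_L2).
  apply: esum_le_seq => s us.
  rewrite (eq_bigr (fun x => (energy (qball n k) x)%:E + (q%:R ^ (- N))%:E *
      (q%:R ^ x.2 * energy (qball n k) x)%:E)%E); last first.
    move=> x _; rewrite -EFinM -EFinD mulrDl mul1r mulrA -expfzDr//.
    by rewrite [- N + _]addrC.
  rewrite big_split /=; apply: leeD; first exact: seq_le_esum.
  rewrite -ge0_sume_distrr; last first.
    by move=> x _; rewrite lee_fin mulr_ge0 ?energy_ge0 ?ltW ?(qexpz_gt0 S).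
  by apply: lee_wpmul2l; [rewrite lee_fin ltW// (qexpz_gt0 S)|exact: seq_le_esum].
apply/lee_addgt0Pr => e e0.
have Gfin : G \is a fin_num by rewrite ge0_fin_numE.
have d0 : 0 < e * q%:R ^ n / (fine G + 1).
  by rewrite divr_gt0 ?mulr_gt0 ?(qexpz_gt0 S)// ltr_wpDl// fine_ge0.
have [M ltM] := prime_exp_lt S d0.
apply: le_trans (step M) _; rewrite leeD2l// -(fineK Gfin) -EFinM lee_fin.
have G1 : 0 < fine G + 1 by rewrite ltr_wpDl// fine_ge0.
have qn := qexpz_gt0 S n.
rewrite opprD expfzDr// -exprnN -exprVn -(abs_prime S) -(uabsX (ws_uabs S)).
rewrite -invr_expz; move: ltM; rewrite ltr_pdivlMr// => /ltW ltM.
rewrite -mulrA ler_pdivrMl// [q%:R ^ n * e]mulrC; apply: le_trans ltM.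
by rewrite ler_wpM2l ?(uabs_ge0 (ws_uabs S))// lerDl.
Qed.

(** The indicator is cut into the indicators of q^M parts of level N = n + M,
    and each is projected on finitely many elements of scales at most N. The
    projections capture nearly all the energy of these scales, so that by tightness
    the squared errors add up to little more than the energy of the scales above N. The
    Cauchy-Schwarz inequality costs a factor q^M, but q^N times the energy of the
    scales above N is dominated by the tail of the rescaled energy. *)
Lemma tight_in_closed_span (n : int) k : (0 < k)%N -> tight_ball n k ->
  in_closed_span mu affine_hat (cindic (qball n k)).
Proof.
move=> k0 tight r r0.
pose E x := energy (qball n k) x.
have Eg0 x : 0 <= E x by exact: energy_ge0.
pose Q x : R := q%:R ^ x.2 * E x.
have Qg0 (x : 'I_L * int) : 0 <= Q x by rewrite mulr_ge0// ltW// (qexpz_gt0 S).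
pose G := (\esum_(x in [set: 'I_L * int]) (Q x)%:E)%E.
have Gfin : G \is a fin_num.
  rewrite ge0_fin_numE; first exact: (rescaled_energy_finite S FF psi_L2 n k0).
  by apply: esum_ge0 => x _; rewrite lee_fin.
(* The final error is at most q^M (e + q^-N d), and both terms are r / 2. *)
pose d := q%:R ^ n * (r / 2).
have d0 : 0 < d by rewrite mulr_gt0 ?(qexpz_gt0 S)// divr_gt0.
have [s0 us0 s0G] : exists2 s0, uniq s0 & fine G - d < \sum_(x <- s0) Q x.
  have [|s0 us0] := @esum_gt_seq R _ (fun x => (Q x)%:E) (fine G - d)%:E.
    by rewrite -/G -(fineK Gfin) lte_fin ltrBlDr ltrDl.
  by rewrite sumEFin lte_fin => h; exists s0.
have [M s0M] := scale_bound s0 n; set N := n + M%:Z in s0M.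
pose e := (r / 2) / q%:R ^+ M.
have e0 : 0 < e by rewrite !divr_gt0// exprn_gt0// ltr0n (ws_q_gt0 S).
have [s1 us1 s1E] : exists2 s1, uniq s1 & q%:R ^ (- n) - e < \sum_(x <- s1) E x.
  have [|s1 us1] := @esum_gt_seq R _ (fun x => (E x)%:E) (q%:R ^ (- n) - e)%:E.
    by rewrite tight lte_fin ltrBlDr ltrDl.
  by rewrite sumEFin lte_fin => h; exists s1.
pose s := [seq x <- s1 | x.2 <= N].
have us : uniq s by exact: filter_uniq.
have sN x : x \in s -> x.2 <= N by rewrite mem_filter => /andP[].
have tail : q%:R ^ N * \sum_(x <- s1 | ~~ (x.2 <= N)) E x < d.
  rewrite mulr_sumr; apply: (@le_lt_trans _ _ (\sum_(x <- [seq x <- s1 | ~~ (x.2 <= N)]) Q x)).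
    rewrite big_filter; apply: ler_sum => x; rewrite -ltNge => /ltW Nx.
    by rewrite ler_wpM2r// ler_weXz2l// ler1n (ws_q_gt0 S).
  rewrite -(ltrD2l (\sum_(x <- s0) Q x)) -big_cat /=.
  apply: (@le_lt_trans _ _ (fine G)); last by rewrite -ltrBlDr.
  rewrite -lee_fin fineK// -sumEFin; apply: seq_le_esum.
  rewrite cat_uniq us0 filter_uniq// andbT; apply/hasPn => x.
  rewrite mem_filter => /andP[xN _]; apply: contra xN; exact: s0M.
have sE : q%:R ^ (- n) - e - q%:R ^ (- N) * d < \sum_(x <- s) E x.
  rewrite ltrBlDr; apply: lt_le_trans s1E _.
  rewrite (bigID (fun x => x.2 <= N)) /= -big_filter lerD2l.
  rewrite -(ler_pM2l (qexpz_gt0 S N)) mulrA -expfzDr// subrr expr0z mul1r.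
  exact: ltW.
pose B (j : nat) := qball N (k * q ^ M + j).
have [m mE] : exists m, q%:R ^ (- n) - e - q%:R ^ (- N) * d <
    \sum_(j < q ^ M) \sum_(t <- scale_box s m) sqmod (inner mu (cindic (B j)) (affine_hat t)).
  have [||m] := @nneseries_gt R
      (fun i => \sum_(j < q ^ M) (\sum_(x <- s) sqmod (coef (B j) x i))%:E)%E
      (q%:R ^ (- n) - e - q%:R ^ (- N) * d)%:E.
  - by move=> i; apply: sume_ge0 => j _; rewrite lee_fin sumr_ge0// => x _; exact: sqmod_ge0.
  - rewrite nneseries_sum; last first.
      by move=> j i _; rewrite lee_fin sumr_ge0// => x _; exact: sqmod_ge0.
    apply: (@lt_le_trans _ _ (\sum_(x <- s) E x)%:E); first by rewrite lte_fin.
    rewrite (eq_bigr (fun j : 'I_(q ^ M) => \sum_(x <- s) (energy (B j) x)%:E)%E); last first.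
      by move=> j _; rewrite (energy_series S FF psi_L2).
    rewrite exchange_big /= -sumEFin; apply: lee_sum => x _.
    by rewrite sumEFin lee_fin /E (energy_sub S FF psi_L2 n M).
  exists m; move: p0; under eq_bigr do rewrite sumEFin.
  rewrite sumEFin lte_fin exchange_big /=.
  under eq_bigr do rewrite -exchange_big /= -sum_scale_box.
  done.
pose T := scale_box s m; have uT : uniq T by exact: scale_box_uniq.
exists [seq (inner mu (cindic (qball n k)) (affine_hat t), t) | t <- T].
have BL j : memL2 mu (cindic (B j) : K -> R[i]) by exact: (memL2_qball S).
have -> : (fun x => cindic (qball n k) x - \sum_(t <- [seq
      (inner mu (cindic (qball n k)) (affine_hat t), t) | t <- T]) t.1 * affine_hat t.2 x) =
    (fun x => \sum_(j < q ^ M) (cindic (B j) x - onproj mu affine_hat T (cindic (B j)) x)).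
  apply/funext => x; rewrite big_map /= sumrB (cindic_sub S n M); congr (_ - _).
  rewrite /onproj exchange_big /=; apply: eq_bigr => t _; rewrite -mulr_suml; congr (_ * _).
  rewrite -(inner_suml (index_enum _) (fun j : 'I_(q ^ M) => BL j) (affine_hatL t)).
  by congr inner; apply/funext => y; rewrite (cindic_sub S n M).
have mg j : cmeasurable (fun x => cindic (B j) x - onproj mu affine_hat T (cindic (B j)) x).
  exact: (memL2B (BL j) (memL2_onproj affine_hatL T _)).1.
apply: (le_lt_trans (nrm2_sum_le mu (q ^ M) mg)).
under eq_bigr do rewrite (nrm2_sub_onproj affine_hatL ON (BL _) uT) (nrm2_qball S) /=.
rewrite sumEFin -EFinM lte_fin sumrB sumr_const card_ord.
have qM0 : 0 < (q%:R : R) ^+ M by rewrite exprn_gt0// ltr0n (ws_q_gt0 S).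
rewrite (natrX _ q M) mulrC -ltr_pdivlMr// ltrBlDl -ltrBlDr.
apply: le_lt_trans mE; rewrite le_eqVlt; apply/orP; left; apply/eqP.
rewrite /e /d -[_ *+ _]mulr_natl (natrX _ q M) /N.
rewrite opprD expfzDr// -exprnN -invr_expz.
have := qexpz_gt0 S n; move: qM0 => /lt0r_neq0 + /lt0r_neq0.
by move: (q%:R ^ n) (q%:R ^+ M) => a b b0 a0; field; rewrite b0 a0.
Qed.
End Tightness.

Section Density.
Context {R : realType} {K : topologicalFieldType}.
Variables (mu : {measure set (borel K) -> \bar R}) (abs : K -> R) (p c : nat).
Variables (eps : 'I_c -> K) (varpi : K) (chi : K -> R[i]).
Hypothesis S : wavelet_setting mu abs p eps varpi chi.
Variable F : (K -> R[i]) -> (K -> R[i]).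
Hypothesis FF : fourier_transform mu chi F.

Local Notation q := (p ^ c)%N.
Local Notation un := (u p eps varpi).
Local Notation qball := (qball abs p eps varpi).
Let A := ws_uabs S.
Let ch := ws_chi S.
Let w0 := prime_neq0 S.
Let BL n k : memL2 mu (cindic (qball n k) : K -> R[i]).
Proof. exact: (memL2_qball S). Qed.

(** * Density of the indicators of balls *)

(** For fixed k these functions form an orthonormal basis of the square-integrable
    functions on the ball number k of level 0. *)
Definition local_wave (k i : nat) : K -> R[i] :=
  fun x => chi (un i * x) * cindic (qball 0 k) x.

Let cmeas_chi i : cmeasurable (fun x => chi (un i * x)).
Proof.
have := cmeasurable_conj (cmeasurable_chiM S (un i)).
by under eq_fun do rewrite conjcK.
Qed.

Lemma memL2_local_wave k i : memL2 mu (local_wave k i).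
Proof.
have h : memL2 mu (fun x => cindic (qball 0 k) x * chi (un i * x)).
  by apply: memL2M => // x; rewrite (sqmod_chi S).
by move: h; congr memL2; apply/funext => x; rewrite mulrC.
Qed.

Lemma local_wave_orthonormal k i j :
  inner mu (local_wave k i) (local_wave k j) = (i == j)%:R.
Proof.
have [m em] := u_sub S j i.
pose h x : R[i] := cindic (qball 0 k) x * (chi (un m * x))^*.
have hi : cintegrable mu h.
  have := memL2_cintegrable (BL 0 k) (memL2_local_wave k m).
  congr cintegrable; apply/funext => x; rewrite /h /local_wave.
  by rewrite rmorphM /= mulrA mulrC mulrA conj_cindic cindic_idem.
transitivity (cintegral mu h).
  congr cintegral; apply/funext => x; rewrite /h /local_wave -em mulrBl.
  rewrite (chiD ch) (chiN S) !rmorphM /= conjCK.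
  by rewrite conj_cindic -[in RHS]cindic_idem; ring.
have := cintegral_affine S (un k) (oner_neq0 K) hi.
rewrite (uabs1 A) invr1 mul1r => <-.
have -> : (i == j) = (m == 0%N).
  apply/eqP/eqP => [ij|m0]; apply: (u_inj S).
    by rewrite -em ij subrr u_at0 subr0 (uabs0 A).
  by rewrite -(uabsN A) opprB em m0 u_at0 (uabs0 A).
rewrite -(cintegral_chi_unit S m FF); congr cintegral; apply/funext => x.
rewrite /h mul1r mulrDr (chiD ch) (chi_uM S) mulr1; congr (_ * _).
rewrite /cindic !indicE; congr (_%:R%:C); congr (nat_of_bool _).
have e : qball 0 k (x + un k) <-> qball 0 0 x.
  rewrite (qball00 _ _ _ _ _) /qball /=.
  by rewrite oppr0 expr0z mul1r addrK.
by apply/idP/idP => /set_mem/e/mem_set.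
Qed.

Variables (I : eqType) (e : I -> K -> R[i]).
Hypothesis eL : forall t, memL2 mu (e t).
Hypothesis eball : forall (n : int) k, (0 < k)%N ->
  in_closed_span mu e (cindic (qball n k)).

(** A ball around 0, deprived of ever smaller balls around 0, is a union of balls
    that avoid 0. *)
Lemma closed_span_qball n k : in_closed_span mu e (cindic (qball n k)).
Proof.
have [->|] := posnP k; last exact: eball.
apply: (closed_span_limit eL) => // r r0.
have d0 : 0 < r * q%:R ^ n by rewrite mulr_gt0// (qexpz_gt0 S).
have [M ltM] := prime_exp_lt S d0.
pose f j : K -> R[i] := cindic (qball (n + M%:Z) j.+1).
exists (fun x => \sum_(j <- index_iota 0 (q ^ M).-1) 1 * f j x); split.
- by apply: memL2_sum => j; apply: memL2Z; exact: BL.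
- apply: (closed_span_sum eL _ (fun=> 1)) => j; first exact: BL.
  exact: eball.
have -> : (fun x => cindic (qball n 0) x -
    \sum_(j <- index_iota 0 (q ^ M).-1) 1 * f j x) = cindic (qball (n + M%:Z) 0).
  apply/funext => x; rewrite (cindic_sub S n M) mul0n.
  under eq_bigr do rewrite add0n.
  rewrite -(big_mkord xpredT (fun j => cindic (qball (n + M%:Z) j) x)).
  have [Q QE] : exists Q, (q ^ M)%N = Q.+1.
    by exists (q ^ M).-1; rewrite prednK// expn_gt0 (ws_q_gt0 S).
  rewrite QE /= big_nat_recl//=.
  by under [X in _ - X]eq_bigr do rewrite mul1r; rewrite addrK.
rewrite (nrm2_qball S) lte_fin opprD expfzDr ?pnatr_eq0 -?lt0n ?(ws_q_gt0 S)//.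
rewrite -exprnN -exprVn -(abs_prime S) -(uabsX A) -invr_expz.
by rewrite mulrC ltr_pdivrMr// (qexpz_gt0 S).
Qed.

(** A character is constant on small balls. *)
Lemma closed_span_local_wave k i : in_closed_span mu e (local_wave k i).
Proof.
have e0 : 0 < (abs (un i) + 1)^-1 by rewrite invr_gt0 ltr_wpDl// (uabs_ge0 A).
have [N ltN] := prime_exp_lt S e0.
pose g j : K -> R[i] := cindic (qball (0 + N%:Z) (k * q ^ N + j)).
pose y j := varpi ^+ N * un (k * q ^ N + j).
have -> : local_wave k i =
    (fun x => \sum_(j <- index_iota 0 (q ^ N)) chi (un i * y j) * g j x).
  apply/funext => x; rewrite /local_wave (cindic_sub S 0 N) mulr_sumr big_mkord.
  apply: eq_bigr => j _; rewrite /g /cindic indicE.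
  case: (boolP (x \in _)) => [/set_mem xj|_]; last by rewrite !mulr0.
  congr (_ * _); apply: (chi_periodic S); rewrite -mulrBr /y.
  have -> : x - varpi ^+ N * un (k * q ^ N + j) =
      varpi ^+ N * (varpi ^ (- N%:Z) * x - un (k * q ^ N + j)).
    by rewrite mulrBr mulrA -exprnN divff ?mul1r// expf_neq0.
  rewrite mulrA (uabsM A) -[leRHS]mulr1 ler_pM ?(uabs_ge0 A)//.
  rewrite (uabsM A) mulrC; move: ltN; rewrite -[ltRHS]mul1r ltr_pdivlMr; last first.
    by rewrite ltr_wpDl// (uabs_ge0 A).
  by move=> /ltW; apply: le_trans; rewrite ler_wpM2l ?(uabs_ge0 A)// lerDl.
apply: (closed_span_sum eL) => j; first exact: BL.
exact: closed_span_qball.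
Qed.

(** Parseval's identity makes the local system complete in the ball. *)
Lemma closed_span_local f k : memL2 mu f ->
  in_closed_span mu e (fun x => f x * cindic (qball 0 k) x).
Proof.
move=> fL; set g := fun x => _.
have gL : memL2 mu g by apply: memL2_cindic => //; exact: (measurable_qball S).
apply: (closed_span_limit eL) => // r r0.
have supp x : g x != 0 -> abs (x - un k) <= 1.
  move=> gx; have : qball 0 k x.
    apply: contrapT => nB; move: gx.
    by rewrite /g /cindic indicE memNset//= mulr0 eqxx.
  by rewrite /qball /= oppr0 expr0z mul1r.
have ei i : cintegral mu (fun x => g x * (chi (un i * x))^*) =
    inner mu g (local_wave k i).
  congr cintegral; apply/funext => x; rewrite /g /local_wave rmorphM /=.
  by rewrite conj_cindic -[in LHS]cindic_idem; ring.
have pars : (\sum_(i <oo) (sqmod (inner mu g (local_wave k i)))%:E = nrm2 mu g)%E.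
  rewrite -(parseval_unit S FF gL supp); apply: eq_eseriesr => i _.
  by rewrite -ei.
have [|||n ltn] := @nneseries_tail R
  (fun i => (sqmod (inner mu g (local_wave k i)))%:E) r.
- by move=> i; rewrite lee_fin sqmod_ge0.
- by rewrite pars; case: gL.
- by [].
exists (onproj mu (local_wave k) (index_iota 0 n) g); split.
- exact: (memL2_onproj (memL2_local_wave k)).
- apply: (closed_span_sum eL) => i; first exact: memL2_local_wave.
  exact: closed_span_local_wave.
rewrite (nrm2_sub_onproj (memL2_local_wave k) (local_wave_orthonormal k) gL (iota_uniq _ _)).
rewrite lte_fin ltrBlDl -lte_fin fineK; last exact: memL2_nrm2.
by rewrite -pars EFinD -sumEFin.
Qed.

Lemma closed_span_all f : memL2 mu f -> in_closed_span mu e f.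
Proof.
move=> fL; apply: (closed_span_limit eL) => // r r0.
have [M ltM] := trunc_approx S fL r0.
exists (fun x => f x * cindic (qball_union abs p eps varpi M) x); split => //.
  by apply: memL2_cindic => //; exact: (measurable_qball_union S).
have -> : (fun x => f x * cindic (qball_union abs p eps varpi M) x) =
    (fun x => \sum_(k <- index_iota 0 M) 1 * (f x * cindic (qball 0 k) x)).
  apply/funext => x; under eq_bigr do rewrite mul1r.
  rewrite -mulr_sumr; congr (_ * _); rewrite /cindic -rmorph_sum; congr (_%:C).
  rewrite indicE; case: (boolP (x \in _)) => [/set_mem[k kM xk]|].
    rewrite (bigD1_seq k)/= ?iota_uniq ?mem_index_iota//.
    rewrite indicE mem_set// big1 ?addr0// => l lk; rewrite indicE memNset// => xl.
    by rewrite (qball_inj S xl xk) eqxx in lk.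
  rewrite notin_setE => nx; rewrite big_seq big1// => l.
  rewrite mem_index_iota => lM; rewrite indicE memNset// => xl; apply: nx.
  by exists l.
apply: (closed_span_sum eL _ (fun=> 1)) => k; last exact: closed_span_local.
by apply: memL2_cindic => //; exact: (measurable_qball S).
Qed.
End Density.

Section Conditions.
Context {R : realType} {K : topologicalFieldType}.
Variables (mu : {measure set (borel K) -> \bar R}) (abs : K -> R) (p c : nat).
Variables (eps : 'I_c -> K) (varpi : K) (chi : K -> R[i]).
Hypothesis S : wavelet_setting mu abs p eps varpi chi.
Variable F : (K -> R[i]) -> (K -> R[i]).
Hypothesis FF : fourier_transform mu chi F.
Variables (L : nat) (psi : 'I_L -> K -> R[i]).
Hypothesis psi_L2 : forall l, memL2 mu (psi l).

Local Notation q := (p ^ c)%N.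
Local Notation un := (u p eps varpi).
Local Notation qball := (qball abs p eps varpi).
Local Notation hpsi := (fun l => F (psi l)).
Local Notation energy := (energy mu varpi F psi).
Local Notation dilated := (dilated varpi F psi).
Local Notation tight_ball := (tight_ball mu abs p eps varpi F psi).
Let A := ws_uabs S.
Let w0 := prime_neq0 S.
Let wz0 (j : int) : varpi ^ j != 0. Proof. exact: expfz_neq0. Qed.
Let mq n k := measurable_qball S n k.
Let q0 : (q%:R : R) != 0. Proof. by rewrite pnatr_eq0 -lt0n (ws_q_gt0 S). Qed.
Let Eenergy_ge0 B x : (0 <= (energy B x)%:E)%E.
Proof. by rewrite lee_fin energy_ge0. Qed.

(** * The condition on the sum over dilations *)

(** The total energy of a ball is the integral over it of the sum in [cond_T], and
    the integrals over the balls that avoid 0 determine a function. *)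
Lemma cond_T_tight :
  cond_T mu varpi hpsi <-> forall n k, (0 < k)%N -> tight_ball n k.
Proof.
pose W (xi : borel K) :=
  (\esum_(x in [set: 'I_L * int]) (sqmod (dilated x xi))%:E)%E.
have d0 x xi : (0 <= (sqmod (dilated x xi))%:E)%E by rewrite lee_fin sqmod_ge0.
have md x : measurable_fun setT (fun xi : borel K => (sqmod (dilated x xi))%:E).
  exact: (measurable_sqmod_dilated S FF psi_L2).
have mW : measurable_fun setT W by exact: measurable_esum.
have W0 xi : (0 <= W xi)%E by apply: esum_ge0.
have WT : cond_T mu varpi hpsi <-> {ae mu, forall xi : borel K, W xi = 1%E}.
  by split; apply: filterS => xi /=;
    rewrite /W -(sum_esum_pair (fun x => d0 x xi)).
have Wq n k : (\int[mu]_(xi in qball n k) W xi =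
    \esum_(x in [set: 'I_L * int]) (energy (qball n k) x)%:E)%E.
  rewrite /W integral_esum//; last by move=> x; exact: measurable_funTS.
  by apply: eq_esum => x _; rewrite (energyE S FF psi_L2).
have q1 n k : (\int[mu]_(xi in qball n k) 1%E = (q%:R ^ (- n))%:E)%E.
  by rewrite integral_cst// mul1e (mu_qball S).
rewrite WT; split=> [W1 n k k0|tight].
  rewrite /tight_ball -Wq -(q1 n k).
  apply: ge0_ae_eq_integral => //; first exact: measurable_funTS.
  by apply: filterS W1 => xi e _; rewrite e.
apply: (qball_integral_unique S (g := cst 1%E)) => //.
- by move=> n k k0; rewrite Wq q1; exact: tight.
- by move=> n k k0; rewrite Wq (tight n k k0) ltry.
Qed.

(** * Propagation of tightness *)

Lemma energy_dilate n d k l j :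
  energy (qball (n + d) k) (l, j + d) = q%:R ^ (- d) * energy (qball n k) (l, j).
Proof.
have e : (q%:R ^ (j + d) * energy (qball (n + d) k) (l, j + d) =
    q%:R ^ j * energy (qball n k) (l, j)).
  apply: EFin_inj.
  rewrite (energy_rescale S FF psi_L2 (l, j + d))// (energy_rescale S FF psi_L2 (l, j))//=.
  congr integral; apply/seteqP; split => y; rewrite /qball /= !addr0 !mulrA -!expfzDr//.
    by rewrite (_ : - (n + d) + (j + d) = - n + j)//; ring.
  by rewrite (_ : - (n + d) + (j + d) = - n + j)//; ring.
apply: (mulfI (lt0r_neq0 (qexpz_gt0 S (j + d)))); rewrite e mulrA -expfzDr//.
by rewrite addrK.
Qed.

(** Dilating the ball by varpi^d shifts the scales by d. *)
Lemma tight_ball_dilate n d k : tight_ball n k -> tight_ball (n + d) k.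
Proof.
rewrite /tight_ball => tight.
have bij : set_bij [set: 'I_L * int] [set: 'I_L * int] (fun x => (x.1, x.2 + d)).
  split => //; first by move=> [l j] [l' j'] _ _ /= [-> /addIr ->].
  by move=> [l j] _; exists (l, j - d) => //=; rewrite subrK.
rewrite (reindex_esum _ _ _ _ bij); transitivity (\esum_(x in [set: 'I_L * int])
    ((q%:R ^ (- d))%:E * (energy (qball n k) x)%:E))%E.
  by apply: eq_esum => -[l j] _; rewrite energy_dilate.
by rewrite esumZl ?tight ?ltW ?(qexpz_gt0 S)// -EFinM -expfzDr// opprD addrC.
Qed.

Section TightChild.
Hypothesis ON : affine_hat_orthonormal mu p eps varpi chi F psi.

(** Bessel's inequality bounds the energy of each ball by its measure, so a
    family of balls with full total energy consists of tight balls. *)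
Lemma tight_balls (s : seq nat) n (f : nat -> nat) :
  (\esum_(x in [set: 'I_L * int]) (\sum_(i <- s) (energy (qball n (f i)) x)%:E) =
   \sum_(i <- s) (q%:R ^ (- n))%:E)%E ->
  forall i, i \in s -> tight_ball n (f i).
Proof.
move=> e i si; rewrite esum_sum// in e.
apply: (sume_eq_bounds (a := fun i => (\esum_(x in [set: 'I_L * int])
  (energy (qball n (f i)) x)%:E)%E) _ e si) => k.
by rewrite (energy_bessel_esum S FF psi_L2 ON) andbT; apply: esum_ge0.
Qed.

Lemma tight_child n k i : tight_ball n k -> (i < q)%N -> tight_ball (n + 1) (k * q + i).
Proof.
move=> tight iq; apply: (@tight_balls (index_iota 0 q) (n + 1) (fun i => k * q + i)%N).
  transitivity (\esum_(x in [set: 'I_L * int]) (energy (qball n k) x)%:E)%E.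
    apply: eq_esum => x _; rewrite (energy_sub S FF psi_L2 n 1) -sumEFin big_mkord.
    by rewrite expn1.
  rewrite tight sumEFin big_const_nat subn0 iter_addr_0; congr EFin.
  by rewrite -[RHS]mulr_natl opprD expfzDr// exprN1 mulrCA divff// mulr1.
by rewrite mem_index_iota.
Qed.

(** The balls of level 1 in the unit sphere generate all the balls that avoid 0
    by dilation and subdivision. *)
Lemma tight_all : (forall i, (0 < i < q)%N -> tight_ball 1 i) ->
  forall n k, (0 < k)%N -> tight_ball n k.
Proof.
move=> base n k; elim/ltn_ind: k n => k ih n k0.
have [kq|qk] := ltnP k q.
  have -> : n = 1 + (n - 1) by rewrite addrC subrK.
  by apply: tight_ball_dilate; apply: base; rewrite k0.
have -> : n = (n - 1) + 1 by rewrite subrK.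
rewrite (divn_eq k q); apply: tight_child; last by rewrite ltn_mod (ws_q_gt0 S).
apply: ih; last by rewrite divn_gt0// (ws_q_gt0 S).
by rewrite ltn_Pdiv// (ws_q_gt1 S).
Qed.
End TightChild.

(** * The integral condition *)

Definition unit_sphere : set K := [set x | abs x = 1].

Lemma unit_sphere_qball :
  unit_sphere = \big[setU/set0]_(i <- index_iota 1 q) qball 1 i.
Proof.
have e0 x : qball 1 0 x <-> abs x < 1.
  rewrite /qball /= u_at0 subr0 exprN1; split => [h|]; last exact: (abs_lt1_prime S).
  by rewrite -[x](mulVKf w0); exact: (abs_prime_lt1M S).
rewrite -bigcup_seq; apply/seteqP; split => x.
  move=> x1; have x00 : qball 0 0 x by rewrite (qball00 _ _ _ _ _) x1.
  have [i iq] := (qball_sub S 0 1 0 x).1 x00; rewrite mul0n add0n add0r => xi.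
  exists i => //=; rewrite expn1 in iq; rewrite mem_index_iota iq andbT.
  rewrite lt0n; apply/eqP => i0; move: xi; rewrite i0 => /e0.
  by rewrite x1 ltxx.
move=> [i /= + xi]; rewrite mem_index_iota => /andP[i0 iq].
have : abs x <= 1.
  apply/(qball00 abs p eps varpi); apply/(qball_sub S 0 1 0).
  by exists i; rewrite ?expn1// mul0n add0n.
rewrite le_eqVlt => /orP[/eqP//|/e0 x0].
by move: i0; rewrite (qball_inj S xi x0).
Qed.

Lemma energy_unit_sphere x : ((energy unit_sphere x)%:E =
  \sum_(i <- index_iota 1 q) (energy (qball 1 i) x)%:E)%E.
Proof.
have mU : measurable (\big[setU/set0]_(i <- index_iota 1 q) qball 1 i : set (borel K)).
  by apply: bigsetU_measurable => i _; exact: mq.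
rewrite unit_sphere_qball (energyE S FF psi_L2)// ge0_integral_bigsetU//.
- by apply: eq_bigr => i _; rewrite (energyE S FF psi_L2).
- exact: iota_uniq.
- by move=> a b _ _ [y [ya yb]]; exact: (qball_inj S ya yb).
- by apply: measurable_funTS; exact: (measurable_sqmod_dilated S FF psi_L2).
- by move=> xi _; rewrite lee_fin sqmod_ge0.
Qed.

(** The powers of q are the only values of the absolute value outside 0. *)
Lemma prime_power_norm y : y != 0 -> exists j : int, abs (varpi ^ j * y) = 1.
Proof.
move=> y0; have ay : 0 < abs y by exact: (uabs_gt0 A).
have ay' : 0 < (abs y)^-1 by rewrite invr_gt0.
have [r ltr] := prime_exp_lt S ay'.
pose y' := varpi ^+ r * y.
have y'1 : abs y' <= 1.
  by rewrite (uabsM A) -ler_pdivlMr// mul1r ltW.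
have y'0 : 0 < abs y' by apply: (uabs_gt0 A); rewrite mulf_neq0 ?expf_neq0.
have ex : exists n, 1 < abs (varpi ^- n * y').
  have [n ltn] := prime_exp_lt S y'0; exists n.
  rewrite (uabsM A) (uabsV A) mulrC ltr_pdivlMr ?mul1r//.
  by apply: (uabs_gt0 A); rewrite expf_neq0.
case: (ex_minnP ex) => -[|n]; first by rewrite invr1 mul1r ltNge y'1.
move=> ltn minn; exists (r%:Z - n%:Z).
have e : varpi ^ (r%:Z - n%:Z) * y = varpi ^- n * y'.
  by rewrite expfzDr// -exprnN -exprnP /y' mulrA [X in X * y]mulrC.
rewrite e; apply/eqP; rewrite eq_le; apply/andP; split.
  by rewrite leNgt; apply/negP => /minn; rewrite ltnn.
rewrite leNgt; apply/negP => /(abs_lt1_prime S).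
by rewrite mulrA -invfM -exprS leNgt ltn.
Qed.

(** Away from 0 the absolute value is locally constant. *)
Lemma measurable_comp_abs (g : R -> R) :
  measurable_fun [set: borel K] (fun x : borel K => g (abs x)).
Proof.
move=> _ B mB; rewrite setTI; set P := _ @^-1` B.
have -> : P = ([set x | x = 0 /\ P 0]) `|` (P `&` ~` [set 0]).
  apply/seteqP; split => x /=.
    by have [->|/eqP x0] := eqVneq x 0; [left|right].
  by move=> [[->]|[]].
apply: measurableU.
  have [B0|nB0] := pselect (P 0).
    rewrite [X in measurable X](_ : _ = [set 0]).
      by apply: borel_closed; exact: (local_field_closed1 (ws_local S)).
    by apply/seteqP; split => x /=; [case|].
  rewrite [X in measurable X](_ : _ = set0) //.
  by rewrite -subset0 => x [].
apply: borel_open; rewrite openE => x [Bx /= /eqP x0].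
have ax : 0 < abs x by exact: (uabs_gt0 A).
have op : open [set y | abs (x - y) < abs x].
  have a2 : 0 < abs x / 2 by rewrite divr_gt0.
  apply: (uabs_open A a2) => y z /= xy yz.
  rewrite -{1}(subrK y x) -addrA.
  apply: (@le_lt_trans _ _ (Num.max (abs (x - y)) (abs x / 2))); last first.
    by rewrite gt_max xy ltr_pdivrMr// ltr_pMr// ltr1n.
  apply: (uabsD A); first by rewrite le_max lexx.
  by rewrite le_max yz orbT.
have := open_nbhs_nbhs (conj op (_ : [set y | abs (x - y) < abs x] x)).
rewrite /= subrr (uabs0 A) => /(_ ax); apply: filterS => y /= xy.
have e := uabs_dist_max A xy; split; first by rewrite /P /preimage /= e.
by move=> y0; move: e ax; rewrite y0 (uabs0 A) => <-; rewrite ltxx.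
Qed.

(** The dilates of the unit sphere by the powers of the prime element partition
    K deprived of 0; on each of them |xi| is constant, and division by it is the
    Jacobian of the dilation. *)
Lemma cond_I_energy : cond_I mu p c abs hpsi <->
  (\esum_(x in [set: 'I_L * int]) (energy unit_sphere x)%:E
   = ((q%:R - 1) / q%:R)%:E)%E.
Proof.
have mD : measurable (unit_sphere : set (borel K)).
  rewrite unit_sphere_qball; apply: bigsetU_measurable => i _; exact: mq.
have tD := trivIset_dilates S ltr01 (fun x (h : unit_sphere x) => h).
pose f l (y : borel K) : \bar R := (sqmod (F (psi l) y) / abs y)%:E.
have f0 l y : (0 <= f l y)%E.
  by rewrite lee_fin divr_ge0 ?sqmod_ge0// (uabs_ge0 A).
have mf l : measurable_fun setT (f l).
  apply/measurable_EFinP; apply: measurable_funM.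
    by apply: cmeasurable_sqmod; case: (fourier_L2 FF (psi_L2 l)).
  exact: (measurable_comp_abs GRing.inv).
pose D j : set (borel K) := (fun y => varpi ^ j * y + 0) @^-1` unit_sphere.
have mDj j : measurable (D j) by exact: measurable_dil_preimage.
have eD l j : ((energy unit_sphere (l, j))%:E = \int[mu]_(y in D j) f l y)%E.
  have r0 := qexpz_gt0 S j.
  have h := energy_rescale S FF psi_L2 (l, j) mD.
  have -> : ((energy unit_sphere (l, j))%:E =
      (q%:R ^ j)^-1%:E * (q%:R ^ j * energy unit_sphere (l, j))%:E)%E.
    by rewrite -EFinM mulKf// lt0r_neq0.
  rewrite h -ge0_integralZl//; last 4 first.
  - exact: mDj.
  - by apply: measurable_funTS; exact: (measurable_sqmod_F FF psi_L2).
  - by move=> y _; rewrite lee_fin sqmod_ge0.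
  - by rewrite lee_fin invr_ge0 ltW.
  apply: eq_integral => y; rewrite inE => yD.
  rewrite /f -EFinM mulrC; congr (_ * _)%:E; congr _^-1.
  move: yD; rewrite /D /unit_sphere /= addr0 (uabsM A) -(opprK j) (abs_primeV S).
  rewrite -[q%:R ^ (- j)]invr_expz => e.
  by rewrite -[RHS](mulVKf (lt0r_neq0 r0)) e mulr1 opprK.
have UD : \bigcup_j D j = ~` [set 0].
  apply/seteqP; split => y.
    move=> [j _]; rewrite /D /unit_sphere /= addr0 => + y0.
    by rewrite y0 mulr0 (uabs0 A) => /esym/eqP; rewrite oner_eq0.
  move=> /= /eqP/prime_power_norm[j e]; exists j => //.
  by rewrite /D /unit_sphere /= addr0.
rewrite -(sum_esum_pair (fun x => Eenergy_ge0 unit_sphere x)) /cond_I.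
rewrite [X in _ <-> X = _](_ : _ = \sum_(l < L) \int[mu]_y f l y)%E//.
apply: eq_bigr => l _; under eq_esum do rewrite eD.
rewrite esum_integral_disjoint// UD [LHS]integral_mkcond.
apply: eq_integral => y _; rewrite patchE; case: ifPn => //.
by rewrite notin_setE /= => /contrapT ->; rewrite /f (uabs0 A) invr0 mulr0.
Qed.
(** The total energy of the unit sphere is the sum in [cond_I], and (q - 1) / q is
    its measure. By Bessel's inequality equality means that the balls of level 1 in
    the sphere are tight. *)
Lemma cond_I_tight : affine_hat_orthonormal mu p eps varpi chi F psi ->
  cond_I mu p c abs hpsi <-> forall n k, (0 < k)%N -> tight_ball n k.
Proof.
move=> ON; rewrite cond_I_energy; under eq_esum do rewrite energy_unit_sphere.
have -> : (((q%:R - 1) / q%:R)%:E = \sum_(i <- index_iota 1 q) (q%:R ^ (- 1%:Z))%:E :> \bar R)%E.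
  rewrite sumEFin big_const_nat iter_addr_0; congr EFin; rewrite -[RHS]mulr_natl natrB//.
  exact: (ws_q_gt0 S).
split=> [total|tight].
  apply: tight_all => // i iq; apply: (tight_balls ON total).
  by rewrite mem_index_iota.
rewrite esum_sum// big_seq [RHS]big_seq; apply: eq_bigr => i.
by rewrite mem_index_iota => /andP[i0 _]; exact: tight.
Qed.
End Conditions.

(** * The characterization of wavelets *)

Theorem theorem3p5
  (R : realType)
  (K : topologicalFieldType) (K_local : local_field K)
  (p : nat) (K_char : p \in [pchar K])
  (mu : {measure set (borel K) -> \bar R}) (mu_haar : haar_measure mu)
  (abs : K -> R) (abs_modulus : haar_modulus mu abs)
  (mu_normalized : mu (integer_ring abs) = 1%E)
  (varpi : K) (varpi_prime : prime_element abs varpi)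
  (c : nat) (c_gt0 : (0 < c)%N)
  (residue_GFq : residue_field_GF abs (p ^ c))
  (eps : 'I_c -> K) (eps_gen : gfq_generators abs p eps)
  (chi : K -> R[i]) (chi_basic : basic_character p eps varpi chi)
  (F : (K -> R[i]) -> (K -> R[i])) (F_fourier : fourier_transform mu chi F)
  (L : nat) (L_gt0 : (0 < L)%N)
  (psi : 'I_L -> K -> R[i]) (psi_L2 : forall l, memL2 mu (psi l)) :
  let hpsi := fun l => F (psi l) in
  let condO := cond_O mu p eps varpi hpsi in
  let condT := cond_T mu varpi hpsi in
  let condI := cond_I mu p c abs hpsi in
  (basic_wavelets mu p eps varpi psi <-> condO /\ condT) /\
  (basic_wavelets mu p eps varpi psi <-> condO /\ condI).
Proof.
move=> hpsi condO condT condI.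
have S := WaveletSetting K_local K_char mu_haar abs_modulus mu_normalized
  varpi_prime c_gt0 residue_GFq eps_gen chi_basic.
have affine_hatL := memL2_affine_hat S F_fourier psi_L2.
have basicP : basic_wavelets mu p eps varpi psi <-> condO /\
    forall n k, (0 < k)%N -> tight_ball mu abs p eps varpi F psi n k.
  rewrite (basic_waveletsP S F_fourier psi_L2).
  rewrite (affine_hat_orthonormal_condO S F_fourier psi_L2) -/condO.
  split=> [[orth dense]|[orth dense]];
      have ON := (affine_hat_orthonormal_condO S F_fourier psi_L2).2 orth.
    split=> // n k k0; apply: (dense_tight S F_fourier psi_L2 ON n k0) => N i.
    by apply: dense; exact: (memL2_qball S).
  split=> // g; apply: (closed_span_all S F_fourier affine_hatL) => n k k0.
  by apply: (tight_in_closed_span S F_fourier psi_L2 ON k0); exact: dense.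
split; rewrite basicP.
  by rewrite -(cond_T_tight S F_fourier psi_L2).
split=> [[orth h]|[orth h]];
    have ON := (affine_hat_orthonormal_condO S F_fourier psi_L2).2 orth.
  by split=> //; apply/(cond_I_tight S F_fourier psi_L2 ON).
by split=> //; apply/(cond_I_tight S F_fourier psi_L2 ON).
Qed.
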